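(* Assume that for every $\ell\in\{1,\dots,L\}$, $0<D(f_{1,\ell}\,\|\,f_{0,\ell})<\infty$ and $0<D(f_{0,\ell}\,\|\,f_{1,\ell})<\infty$, and that the log likelihood ratios $\log\frac{f_{1,\ell}(X)}{f_{0,\ell}(X)}$ have finite and positive absolute moments up to third order, both when $X\sim f_{0,\ell}$ and when $X\sim f_{1,\ell}$. Let $\mu_\ell>0$, $0\le h_\ell<\infty$ and $D_\ell\ge 0$ for all $\ell$ be fixed, let $\alpha\in(0,1]$, and let $\Pi_{\mathrm{DCM}}$ be the DE-Censor-Max algorithm with these parameters and with fusion center threshold $A=\log\frac{L}{\alpha}$. Suppose the change occurs in exactly one stream $\ell^*\in\{1,\dots,L\}$. Then $$\mathsf{FAR}(\Pi_{\mathrm{DCM}})\le\alpha,$$ $$\mathsf{PDC}_\ell(\Pi_{\mathrm{DCM}})=\frac{\mathbb{E}_\infty[\tau_{\ell-}]}{\mathbb{E}_\infty[\tau_{\ell-}]+\mathbb{E}_\infty\big[\lceil |W_{\tau_{\ell-}}^{h_\ell+}|/\mu_\ell\rceil\big]}\quad\forall\ell,$$ $$\mathsf{PTC}_\ell(\Pi_{\mathrm{DCM}})=\frac{\mathbb{E}_\infty[U_{D_\ell}]}{\mathbb{E}_\infty[\tau_{\ell-}]+\mathbb{E}_\infty\big[\lceil |W_{\tau_{\ell-}}^{h_\ell+}|/\mu_\ell\rceil\big]}\quad\forall\ell,$$ $$\mathsf{WADD}(\Pi_{\mathrm{DCM}})\le\frac{|\log\alpha|}{D(f_{1,\ell^*}\,\|\,f_{0,\ell^*})}(1+o(1))\quad\text{as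 }\alpha\to0.$$ Moreover, if instead $h_\ell=\infty$ for all $\ell$ (other parameters as before), then $$\mathsf{PDC}_\ell(\Pi_{\mathrm{DCM}})\le\frac{\mu_\ell}{\mu_\ell+D(f_{0,\ell}\,\|\,f_{1,\ell})}\quad\forall\ell.$$
   Context: **Model.** There are $L\ge1$ sensors. At sensor $\ell$ a sequence of random variables $\{X_{n,\ell}\}_{n\ge1}$ is observed. For known densities $f_{0,\ell},f_{1,\ell}$, a deterministic change point $\gamma\in\{1,2,\dots\}\cup\{\infty\}$ and a nonempty affected subset $\kappa\subset\{1,\dots,L\}$: all $X_{n,\ell}$ are independent over $n$ and $\ell$; for $\ell\in\kappa$, $X_{n,\ell}\sim f_{0,\ell}$ if $n<\gamma$ and $X_{n,\ell}\sim f_{1,\ell}$ if $n\ge\gamma$; for $\ell\notin\kappa$, $X_{n,\ell}\sim f_{0,\ell}$ for all $n$. $\mathbb{P}_\gamma,\mathbb{E}_\gamma$ denote the corresponding probability and expectation ($\gamma=\infty$: no change). ''The change occurs in stream $\ell^*$'' means $\kappa=\{\ell^*\}$. $D(f\,\|\,g)$ is the Kullback–Leibler divergence. **Algorithm.** Write $(x)^{h+}=\max\{x,-h\}$ (so $(x)^{\infty+}=x$). For parameters $\mu_\ell>0$, $h_\ell\in[0,\infty]$, the DE-CuSum statistics start at $W_{0,\ell}=0$ and evolve, for all $n\ge0$, by: $S_{n+1,\ell}=1$ if $W_{n,\ell}\ge0$ and $S_{n+1,\ell}=0$ otherwise ($S_{n,\ell}$ indicates whether $X_{n,\ell}$ is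 used), and $$W_{n+1,\ell}=\begin{cases}\min\{W_{n,\ell}+\mu_\ell,0\}&\text{if }S_{n+1,\ell}=0,\\ \Big(W_{n,\ell}+\log\frac{f_{1,\ell}(X_{n+1,\ell})}{f_{0,\ell}(X_{n+1,\ell})}\Big)^{h_\ell+}&\text{if }S_{n+1,\ell}=1.\end{cases}$$ At time $n$ sensor $\ell$ transmits iff $W_{n,\ell}>D_\ell$; let $T_{n,\ell}=\mathbb{I}_{\{W_{n,\ell}>D_\ell\}}$ and $Y_{n,\ell}=W_{n,\ell}\mathbb{I}_{\{W_{n,\ell}>D_\ell\}}$ (no transmission counts as $0$ at the fusion center). DE-Censor-Max, $\Pi_{\mathrm{DCM}}$, stops at $\tau=\inf\{n\ge1:\max_{1\le\ell\le L}Y_{n,\ell}>A\}$. **Metrics.** The recursions for $W_{n,\ell},S_{n,\ell},T_{n,\ell}$ are run for all $n$, also beyond $\tau$. $$\mathsf{PDC}_\ell=\limsup_{\gamma\to\infty}\frac1\gamma\mathbb{E}_\infty\Big[\sum_{k=1}^{\gamma-1}S_{k,\ell}\Big],\qquad \mathsf{PTC}_\ell=\limsup_{\gamma\to\infty}\frac1\gamma\mathbb{E}_\infty\Big[\sum_{k=1}^{\gamma-1}T_{k,\ell}\Big],\qquad \mathsf{FAR}=\frac{1}{\mathbb{E}_\infty[\tau]},$$ $$\mathsf{WADD}=\sup_{\gamma\ge1}\operatorname{ess\,sup}\;\mathbb{E}_\gamma\big[(\tau-\gamma)^+\mid\boldsymbol{\mathcal I}_{\gamma-1}\big],$$ where $\boldsymbol{\mathcal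 I}_n$ is the information at time $n$: all $S_{k,\ell}$, $k\le n$, $1\le\ell\le L$, and those $X_{k,\ell}$, $k\le n$, with $S_{k,\ell}=1$. The change points $\gamma$ in the supremum are finite and the affected subset is fixed. **Ladder quantities.** Let $Z_{n,\ell}=\sum_{k=1}^n\log\frac{f_{1,\ell}(X_{k,\ell})}{f_{0,\ell}(X_{k,\ell})}$. Then $\tau_{\ell-}=\inf\{n\ge1:Z_{n,\ell}<0\}$; $W_{\tau_{\ell-}}$ is the ladder height $Z_{\tau_{\ell-},\ell}$ and $W_{\tau_{\ell-}}^{h_\ell+}=\max\{Z_{\tau_{\ell-},\ell},-h_\ell\}$; $U_{D_\ell}$ is the number of $n$ with $1\le n<\tau_{\ell-}$ and $Z_{n,\ell}>D_\ell$. **Asymptotic notation.** $p(\alpha)\le q(\alpha)(1+o(1))$ as $\alpha\to0$ means $\limsup_{\alpha\to0}p(\alpha)/q(\alpha)\le1$, with the model and the parameters $\mu_\ell,h_\ell,D_\ell$ fixed. *)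

(* Defs.v *)
From HB Require Import structures.
From mathcomp Require Import all_boot all_order all_algebra.
From mathcomp Require Import all_classical all_reals all_analysis.
From mathcomp Require Import measurable_realfun ess_sup_inf.

Set Implicit Arguments.
Unset Strict Implicit.
Unset Printing Implicit Defensive.
Import Order.TTheory GRing.Theory Num.Theory.
Import numFieldNormedType.Exports.
Local Open Scope classical_set_scope.
Local Open Scope ring_scope.

Section divergence.
Context {R : realType}.
Variable nu : {sigma_finite_measure set R -> \bar R}.
Implicit Types f g : R -> R.

Definition is_density f : Prop :=
  [/\ measurable_fun [set: R] f, forall x, 0 <= f x
    & (\int[nu]_x (f x)%:E = 1)%E].

(* [log (f x / g x)] in the extended reals: [+oo] if [g x = 0 < f x] and [-oo]
   if [f x = 0]. *)
Definition log_ratio f g (x : R) : \bar R := lne ((f x)%:E / (g x)%:E)%E.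

(* As [0 * _ = 0] in [\bar R], the integrand vanishes where [f] does, and
   the integral is [+oo] unless [f] is absolutely continuous w.r.t. [g]. *)
Definition KL f g : \bar R := (\int[nu]_x ((f x)%:E * log_ratio f g x))%E.

(* [E |log (f1 X / f0 X)|^k] for [X] of density [f]. *)
Definition abs_moment f1 f0 f (k : nat) : \bar R :=
  (\int[nu]_x (`|log_ratio f1 f0 x| ^+ k * (f x)%:E))%E.

End divergence.

Section probability.
Context {R : realType} {d : measure_display} {Omega : measurableType d}.
Variable P : probability Omega R.

Definition mutually_independent (I : eqType) (Y : I -> Omega -> R)
  : Prop :=
  forall (s : seq I) (B : I -> set R), uniq s ->
    (forall i, measurable (B i)) ->
    P (\big[setI/setT]_(i <- s) (Y i @^-1` B i)) =
    (\prod_(i <- s) P (Y i @^-1` B i))%E.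

(* [g] is a version of the conditional expectation of the nonnegative [f]
   given the sub-sigma-algebra [G]. *)
Definition is_cond_exp (G : set (set Omega)) (f g : Omega -> \bar R) : Prop :=
  [/\ forall w, (0 <= g w)%E,
      forall B : set (\bar R), measurable B -> G (g @^-1` B)
    & forall A, G A -> (\int[P]_(w in A) g w = \int[P]_(w in A) f w)%E].

(* A version always exists when [f] is nonnegative and measurable; the default
   value [+oo] is never used in that case. *)
Definition cond_exp (G : set (set Omega)) (f : Omega -> \bar R) :
  Omega -> \bar R := xget (cst +oo%E) [set g | is_cond_exp G f g].

End probability.

(* First [n >= 1] with [Q n]; [+oo] if there is none. *)
Definition first_time {R : realType} (Q : nat -> Prop) : \bar R :=
  ereal_inf [set (n%:R : R)%:E | n in [set n : nat | (1 <= n)%N /\ Q n]].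

(* One sensor, along one path [x 1, x 2, ...] of observations ([x 0] is not
   used). *)
Section sensor.
Context {R : realType}.
Variables (f0 f1 : R -> R) (mu : R) (h : \bar R) (D : R) (x : nat -> R).

(* [fine] sends the values [+oo] and [-oo] to [0]. If both divergences are
   finite, [f0] and [f1] vanish at the same points up to a null set, so this
   alters the log likelihood ratio with probability zero only. *)
Definition llr (y : R) : R := fine (log_ratio f1 f0 y).

(* [(y)^{h+} = max(y, -h)], equal to [y] if [h = +oo]. *)
Definition trunc_below (y : R) : R := fine (maxe y%:E (- h))%E.

Fixpoint decusum (n : nat) : R :=
  if n is m.+1 then
    if 0 <= decusum m then trunc_below (decusum m + llr (x m.+1))
    else Num.min (decusum m + mu) 0
  else 0.

(* [sampled n] is only meaningful for [n >= 1]. *)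
Definition sampled (n : nat) : bool := 0 <= decusum n.-1.
Definition transmits (n : nat) : bool := D < decusum n.
Definition sent (n : nat) : R := decusum n * (transmits n)%:R.

Definition llr_sum (n : nat) : R := \sum_(1 <= k < n.+1) llr (x k).
Definition ladder_time : \bar R := first_time (fun n => llr_sum n < 0).

(* On [ladder_time = +oo] (a null event before the change) this is
   [llr_sum 0 = 0]. *)
Definition ladder_height : R := llr_sum (Num.truncn (fine ladder_time)).

Definition skip_time : R := (Num.ceil (`|trunc_below ladder_height| / mu))%:~R.

Definition ladder_transmissions : \bar R :=
  (\sum_(1 <= n <oo | ((n%:R : R)%:E < ladder_time) && (D < llr_sum n)%R) 1)%E.

End sensor.

Section network.
Context {R : realType} {L : nat}.
Context {d : measure_display} {Omega : measurableType d}.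
Variable nu : 'I_L -> {sigma_finite_measure set R -> \bar R}.
Variables f0 f1 : 'I_L -> R -> R.
Variable X : nat -> 'I_L -> {mfun Omega >-> R}.

(* A change point is [Some g] with [g >= 1], or [None] for infinity. *)
Definition changed (gamma : option nat) (n : nat) : bool :=
  if gamma is Some g then (g <= n)%N else false.

(* The law of the observations [X n l], [n >= 1], under [P]. *)
Definition change_model (kappa : {set 'I_L}) (gamma : option nat)
    (P : probability Omega R) : Prop :=
  mutually_independent P (fun i : nat * 'I_L => X i.1.+1 i.2) /\
  forall (n : nat) (l : 'I_L) (B : set R),
    (1 <= n)%N -> measurable B ->
    P (X n l @^-1` B) =
    (\int[nu l]_(y in B)
       (if (l \in kappa) && changed gamma n then f1 l y else f0 l y)%:E)%E.

Variables (mu : 'I_L -> R) (h : 'I_L -> \bar R) (D : 'I_L -> R) (A : R).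

Definition obs (l : 'I_L) (w : Omega) (n : nat) : R := X n l w.
Definition Sn (n : nat) (l : 'I_L) (w : Omega) : bool :=
  sampled (f0 l) (f1 l) (mu l) (h l) (obs l w) n.
Definition Tn (n : nat) (l : 'I_L) (w : Omega) : bool :=
  transmits (f0 l) (f1 l) (mu l) (h l) (D l) (obs l w) n.
Definition Yn (n : nat) (l : 'I_L) (w : Omega) : R :=
  sent (f0 l) (f1 l) (mu l) (h l) (D l) (obs l w) n.

Definition tau (w : Omega) : \bar R :=
  first_time (fun n => (A%:E < \big[maxe/-oo]_(l < L) (Yn n l w)%:E)%E).

(* The sigma-algebra of what has been observed up to time [n]: which samples
   were taken, and the values of those that were. *)
Definition information (n : nat) : set (set Omega) :=
  <<s [set E | exists k l, (1 <= k <= n)%N /\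
         (E = [set w | Sn k l w] \/
          exists2 B : set R, measurable B &
            E = [set w | Sn k l w] `&` X k l @^-1` B)] >>.

Variable P : option nat -> probability Omega R.

Definition PDC (l : 'I_L) : \bar R :=
  limn_esup (fun g : nat => ((g%:R : R)^-1%:E *
    \int[P None]_w (\sum_(1 <= k < g) (Sn k l w)%:R)%:E)%E).

Definition PTC (l : 'I_L) : \bar R :=
  limn_esup (fun g : nat => ((g%:R : R)^-1%:E *
    \int[P None]_w (\sum_(1 <= k < g) (Tn k l w)%:R)%:E)%E).

Definition FAR : \bar R := ((\int[P None]_w tau w)^-1)%E.

Definition WADD : \bar R :=
  ereal_sup [set ess_sup (P (Some g))
                   (cond_exp (P (Some g)) (information g.-1)
                      (fun w => maxe (tau w - (g%:R : R)%:E)%E 0%E))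
            | g in [set g : nat | (1 <= g)%N]].

(* Expectations under no change of the ladder time, of the number of samples
   skipped after it, and of the number of transmissions before it. *)
Definition mean_ladder_time (l : 'I_L) : \bar R :=
  (\int[P None]_w ladder_time (f0 l) (f1 l) (obs l w))%E.
Definition mean_skip_time (l : 'I_L) : \bar R :=
  (\int[P None]_w (skip_time (f0 l) (f1 l) (mu l) (h l) (obs l w))%:E)%E.
Definition mean_ladder_transmissions (l : 'I_L) : \bar R :=
  (\int[P None]_w ladder_transmissions (f0 l) (f1 l) (D l) (obs l w))%E.

End network.

(* Main.v *)
Require Import Defs.
From HB Require Import structures.
From mathcomp Require Import all_boot all_order all_algebra.
From mathcomp Require Import all_classical all_reals all_analysis.
From mathcomp Require Import measurable_realfun ess_sup_inf.
From mathcomp Require Import ring lra.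

Set Implicit Arguments.
Unset Strict Implicit.
Unset Printing Implicit Defensive.
Import Order.TTheory GRing.Theory Num.Theory.
Import numFieldNormedType.Exports.
Local Open Scope classical_set_scope.
Local Open Scope ring_scope.

(* False alarms: [exp W <= r] on [W > 0] for the Shiryaev-Roberts statistic [r]
   driven by the sampled observations only. Before the change [r n] has mean at
   most [n], so summing over the sensors and stopping at [tau] gives
   [L E tau >= exp A = L / alpha].

   Duty cycles: [W] starts afresh whenever it returns to [0] from below. A cycle
   is a random walk up to its first negative value, followed by the skipped
   samples. The renewal-reward limit comes from convolving the renewal sequence
   with the occupation probabilities of one cycle, the convolution for the whole
   cycle being constantly [1].

   Detection delay: after the change, [(A + c - min (W, A + c)) / I] plus the
   potential of the samples still to be skipped decreases by [1] on average at
   every step before [tau], whatever the past. Here [I] is the drift of the log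
   likelihood ratio capped at [c], which tends to the divergence as [c] grows,
   and the potential is bounded because [h] is finite.

   Without truncation: [W] is at most [mu] times the number of skipped samples
   plus the sum of the sampled log likelihood ratios, while [E W] is bounded below
   by [- c - n m2 / c] for every [c > 0], [m2] being the second moment. Hence
   [(mu + D) E N <= mu n + c + n m2 / c] for the number [N] of samples taken. *)

(** The Hellinger affinity [rho = E exp (llr / 2)] is less than 1 because the log likelihood ratio
    is not almost surely 0, and it serves twice. Before the change it gives the ladder time a
    geometric tail, hence a finite mean. After the change, with the sign reversed, it pays for the
    samples skipped on the way up. The delay is a worst case over the past, so a bound on its plain
    mean is too weak: the drift inequality is integrated over an arbitrary event [E] of the past of
    all observations, and a bound [C * P E] for all of them bounds the essential supremum given the
    coarser [information]. The other streams can only raise the alarm earlier: as long as there is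
    none, the statistic of [lstar] is at most [A], once [D <= A]. The cap [c] limits the overshoot
    beyond [A] but costs drift; it is chosen for each [I] below the divergence, so the additive
    constant in the delay depends on [I], and [alpha] tends to 0 before [I] approaches the
    divergence. Duty cycles are Cesaro averages, and of the occupation probabilities of one cycle
    only the total enters the limit. *)

(** * Integration against densities, and independence of the past *)

Section density_law.
Local Open Scope ereal_scope.
Context {R : realType} {d : measure_display} {T : measurableType d}.

(** Both [f] and the Radon-Nikodym derivative of [m] integrate to [m] over every measurable set, so
    they agree [nu]-almost everywhere, and the change of variables for the derivative passes to
    [f]. *)
Lemma ge0_integral_density (nu : {sigma_finite_measure set T -> \bar R})
    (m : {finite_measure set T -> \bar R}) (f : T -> R) (G : T -> \bar R) :
  measurable_fun setT f -> (forall x, (0 <= f x)%R) ->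
  (forall B, measurable B -> m B = \int[nu]_(y in B) (f y)%:E) ->
  measurable_fun setT G -> (forall x, 0 <= G x) ->
  \int[m]_x G x = \int[nu]_x (G x * (f x)%:E).
Proof.
move=> mf f0 mE mG G0.
have mEf : measurable_fun setT (EFin \o f) by exact/measurable_EFinP.
have dom : m `<< nu.
  apply/null_content_dominatesP => A mA nuA.
  by rewrite mE//; apply: null_set_integral => //; exact: measurable_funTS.
rewrite -(Radon_Nikodym_SigmaFinite.change_of_variables dom)//.
apply: ge0_ae_eq_integral => //.
- apply: emeasurable_funM => //.
  exact: measurable_int (Radon_Nikodym_SigmaFinite.f_integrable dom).
- exact: emeasurable_funM.
- by move=> x _; rewrite mule_ge0// Radon_Nikodym_SigmaFinite.f_ge0.
- by move=> x _; rewrite mule_ge0// lee_fin.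
apply: ae_eqe_mul2l.
apply: integral_ae_eq => //.
- exact: Radon_Nikodym_SigmaFinite.f_integrable.
- by move=> E _ mE'; rewrite -Radon_Nikodym_SigmaFinite.f_integral// mE.
Qed.

End density_law.

Section independent_integral.
Local Open Scope ereal_scope.
Context {R : realType} {d : measure_display} {T : measurableType d}.
Variables (P : probability T R) (S : set (set T)) (X : {mfun T >-> R}).
Hypothesis mS : S `<=` measurable.
Hypothesis indep : forall A B, <<s S >> A -> measurable B ->
  P (A `&` X @^-1` B) = P A * P (X @^-1` B).

(** The same points with only the sub-sigma-algebra, so that measurability with respect to
    [<<s S >>] becomes ordinary measurability on a type. *)
Let T' := g_sigma_algebraType S.
Let toT' (w : T) : T' := w.

Let mtoT' : measurable_fun setT toT'.
Proof.
move=> _ B mB; rewrite setTI.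
have : <<s S >> `<=` @measurable d T.
  by apply: smallest_sub => //; exact: sigma_algebra_measurable.
exact.
Qed.

Let toT'_mixin := isMeasurableFun.Build _ _ _ _ _ mtoT'.
Let toT'_mfun : {mfun T >-> T'} := HB.pack toT' toT'_mixin.

Let pr (w : T) : T' * R := (toT' w, X w).

Let mpr : measurable_fun setT pr.
Proof. by apply: measurable_fun_pair => //; exact: mtoT'. Qed.

Let pr_mixin := isMeasurableFun.Build _ _ _ _ _ mpr.
Let pr_mfun : {mfun T >-> (T' * R)%type} := HB.pack pr pr_mixin.

Let m1 : probability T' R := distribution P toT'_mfun.
Let m2 : probability R R := distribution P X.
Let m12 : probability (T' * R)%type R := distribution P pr_mfun.

Let m12E A : measurable A -> m12 A = (m1 \x m2) A.
Proof.
move=> mA; apply/esym.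
apply: (@product_measure_unique _ _ _ _ R m1 m2 m12 _ A mA) => A1 A2 mA1 mA2.
exact: indep.
Qed.

(** Independence says that the joint law of the identity into [T'] and of [X] is a product measure,
    since rectangles determine it; Tonelli then splits the integral. *)
Lemma ge0_integral_indep (F : T' -> \bar R) (G : R -> \bar R) :
  measurable_fun [set: T'] F -> (forall w, 0 <= F w) ->
  measurable_fun setT G -> (forall x, 0 <= G x) ->
  \int[P]_w (F w * G (X w)) = (\int[P]_w F w) * \int[P]_w G (X w).
Proof.
move=> mF F0 mG G0.
pose FG (z : T' * R) : \bar R := F z.1 * G z.2.
have mFG : measurable_fun setT FG.
  by apply: emeasurable_funM; exact: measurableT_comp.
have FG0 z : 0 <= FG z by rewrite /FG mule_ge0.
have -> : \int[P]_w (F w * G (X w)) = \int[m12]_z FG z.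
  by rewrite ge0_integral_distribution.
have -> : \int[m12]_z FG z = \int[m1 \x m2]_z FG z.
  by apply: eq_measure_integral => A mA _; exact: m12E.
rewrite fubini_tonelli1//.
have -> : \int[P]_w F w = \int[m1]_w F w by rewrite ge0_integral_distribution.
have -> : \int[P]_w G (X w) = \int[m2]_w G w by rewrite ge0_integral_distribution.
rewrite -ge0_integralZr//; last exact: integral_ge0.
by apply: eq_integral => w _; rewrite /fubini_F /FG/= ge0_integralZl.
Qed.

End independent_integral.

Section pi_system_independence.
Local Open Scope ereal_scope.
Context {R : realType} {d : measure_display} {T : measurableType d}.
Variable P : probability T R.

(** As functions of [A], both sides are finite measures that agree on a pi-system containing the
    whole space. *)
Lemma indep_g_sigma_algebra (G : set (set T)) (E : set T) :
  G `<=` measurable -> setI_closed G -> G setT -> measurable E ->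
  (forall A, G A -> P (A `&` E) = P A * P E) ->
  forall A, <<s G >> A -> P (A `&` E) = P A * P E.
Proof.
move=> mG GI GT mE GE A sGA.
have PE0 : (0 <= fine (P E))%R by rewrite fine_ge0.
have PEE : P E = (fine (P E))%:E by rewrite fineK// fin_num_measure.
have mrE B : mrestr P mE B = P (B `&` E) by [].
have msE B : mscale (NngNum PE0) P B = P E * P B by rewrite [in RHS]PEE.
rewrite -mrE muleC -msE.
have cov : \bigcup_(k in [set: nat]) (fun=> [set: T]) k = setT.
  by apply/seteqP; split => // x _; exists 0%N.
apply: (@g_sigma_algebra_measure_unique _ _ _ G mG _ (fun=> GT) cov 
  (mrestr P mE) (mscale (NngNum PE0) P) GI) => //.
- by move=> B GB; rewrite [LHS]mrE [RHS]msE GE// muleC.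
- by move=> _; rewrite [ltLHS]mrE setTI ltey_eq fin_num_measure.
Qed.

End pi_system_independence.

Section past.
Context {R : realType} {L : nat}.
Context {d : measure_display} {Omega : measurableType d}.
Variable X : nat -> 'I_L -> {mfun Omega >-> R}.

(** Generators for all observations up to time [n], sampled or not; the sigma-algebra they generate
    contains [information n]. *)
Definition past (n : nat) : set (set Omega) :=
  [set E | exists k l, (1 <= k <= n)%N /\
     exists2 B : set R, measurable B & E = X k l @^-1` B].

Lemma measurable_past n : past n `<=` measurable.
Proof.
move=> _ [k [l [_ [B mB ->]]]]; rewrite -[_ @^-1` _]setTI.
exact: measurable_funPT.
Qed.

Lemma sub_past m n : (m <= n)%N -> past m `<=` past n.
Proof.
move=> mn _ [k [l [/andP[k1 km] [B mB ->]]]]; exists k, l.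
by rewrite k1 (leq_trans km mn); split => //; exists B.
Qed.

Lemma sub_g_past m n : (m <= n)%N -> <<s past m >> `<=` <<s past n >>.
Proof.
by move=> mn; apply: sub_smallest2r; [exact: smallest_sigma_algebra|exact: sub_past].
Qed.

Lemma g_past_measurable n : <<s past n >> `<=` measurable.
Proof.
apply: smallest_sub; first exact: sigma_algebra_measurable.
exact: measurable_past.
Qed.

Variable P : probability Omega R.
Hypothesis indepX :
  mutually_independent P (fun i : nat * 'I_L => X i.1.+1 i.2 : Omega -> R).

Let idx n : seq (nat * 'I_L) := [seq (k, l) | k <- iota 0 n, l <- enum 'I_L].

Let uniq_idx n : uniq (idx n).
Proof.
by apply: allpairs_uniq; [exact: iota_uniq|exact: enum_uniq|move=> [? ?] [? ?]].
Qed.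

Let mem_idx n (i : nat * 'I_L) : (i \in idx n) = (i.1 < n)%N.
Proof.
apply/allpairsP/idP => [[[k l] [/= kn _ ->/=]]|kn].
  by move: kn; rewrite mem_iota.
by exists i; rewrite mem_iota mem_enum; case: i kn.
Qed.

(** Product events form a pi-system that contains the generators in [past n]. Times are counted from
    0 here, to match the family in the independence hypothesis. *)
Let rect n (B : nat * 'I_L -> set R) : set Omega :=
  \big[setI/setT]_(i <- idx n) (X i.1.+1 i.2 @^-1` B i).

Let rects n : set (set Omega) :=
  [set A | exists2 B, (forall i, measurable (B i)) & A = rect n B].

Let mpre k l B : measurable B -> measurable (X k l @^-1` B).
Proof. by move=> mB; rewrite -[_ @^-1` _]setTI; exact: measurable_funPT. Qed.

Let mrects n : rects n `<=` measurable.
Proof.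
move=> _ [B mB ->]; rewrite /rect; apply: big_ind => //.
- exact: measurableI.
- by move=> i _; exact: mpre.
Qed.

Let rectsI n : setI_closed (rects n).
Proof.
move=> _ _ [B mB ->] [C mC ->]; exists (fun i => B i `&` C i).
  by move=> i; exact: measurableI.
rewrite /rect -big_split/=; apply: eq_bigr => i _.
by rewrite preimage_setI.
Qed.

Let past_rects n : past n `<=` rects n.
Proof.
move=> _ [k [l [/andP[k1 kn] [B mB ->]]]].
exists (fun i => if i == (k.-1, l) then B else setT).
  by move=> i; case: ifP.
rewrite /rect (bigD1_seq (k.-1, l))//=; last by rewrite mem_idx/= prednK.
rewrite eqxx prednK// big1 ?setIT// => i /negbTE ->.
by rewrite preimage_setT.
Qed.

(** The index [(n, l)] is new to a rectangle over earlier times, so mutual independence gives the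
    product rule on rectangles, and these generate the past. *)
Lemma past_indep n l A B : <<s past n >> A -> measurable B ->
  P (A `&` X n.+1 l @^-1` B) = (P A * P (X n.+1 l @^-1` B))%E.
Proof.
move=> pA mB.
apply: (@indep_g_sigma_algebra _ _ _ P (rects n)).
- exact: mrects.
- exact: rectsI.
- exists (fun=> setT) => //.
  by rewrite /rect big1// => i _; rewrite preimage_setT.
- exact: mpre.
- move=> _ [C mC ->].
  pose C' i := if i == (n, l) then B else C i.
  have mC' i : measurable (C' i) by rewrite /C'; case: ifP.
  have nidx : (n, l) \notin idx n by rewrite mem_idx/= ltnn.
  have us : uniq ((n, l) :: idx n) by rewrite /= nidx uniq_idx.
  have := indepX us mC'; rewrite !big_cons /C' eqxx/=.
  have CE : forall i, i \in idx n -> C' i = C i.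
    move=> i; rewrite /C'; case: eqP => // -> ii.
    by rewrite ii in nidx.
  rewrite (eq_big_seq (fun i => X i.1.+1 i.2 @^-1` C i)); last first.
    by move=> i /CE; rewrite /C' => ->.
  rewrite [X in _ = (_ * X)%E](eq_big_seq (fun i => P (X i.1.+1 i.2 @^-1` C i)));
    last by move=> i /CE; rewrite /C' => ->.
  by rewrite -indepX// setIC => ->; rewrite muleC.
- move: pA; apply: sub_smallest2r; first exact: smallest_sigma_algebra.
  exact: past_rects.
Qed.

End past.

(** * Log likelihood ratios and their moments *)

Section log_likelihood_ratio.
Context {R : realType}.
Implicit Types f g : R -> R.

Lemma log_ratioE f g y : 0 <= f y -> 0 <= g y ->
  log_ratio f g y = if 0 < f y then
    (if 0 < g y then (ln (f y / g y))%:E else +oo%E) else -oo%E.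
Proof.
move=> fy gy; rewrite /log_ratio; case: ifPn => [f0|].
  case: ifPn => [g0|].
    by rewrite inver gt_eqF// -EFinM lne_EFin// divr_gt0.
  rewrite -leNgt => g0; have -> : g y = 0 by apply/eqP; rewrite eq_le g0 gy.
  by rewrite inve0 gt0_muley ?lte_fin.
rewrite -leNgt => f0; have -> : f y = 0 by apply/eqP; rewrite eq_le f0 fy.
by rewrite mul0e le0_lneNy.
Qed.

Lemma llrE f g y : 0 <= f y -> 0 <= g y ->
  llr f g y = if (0 < f y) && (0 < g y) then ln (g y / f y) else 0.
Proof.
move=> fy gy; rewrite /llr log_ratioE//.
by case: (0 < g y); case: (0 < f y).
Qed.

Lemma llr_swap f g y : 0 <= f y -> 0 <= g y -> llr g f y = - llr f g y.
Proof.
move=> fy gy; rewrite !llrE// [in LHS]andbC; case: ifPn => [/andP[f0 g0]|].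
  by rewrite -lnV ?posrE ?divr_gt0// invf_div.
by rewrite oppr0.
Qed.

Lemma abse_log_ratio_swap f g y : 0 <= f y -> 0 <= g y ->
  (`|log_ratio f g y| = `|log_ratio g f y|)%E.
Proof.
move=> fy gy; rewrite !log_ratioE//.
case: ifPn => f0; case: ifPn => g0 //=.
by rewrite -(invf_div (g y)) lnV ?posrE ?divr_gt0// normrN.
Qed.

Lemma measurable_log_ratio f g : (forall y, 0 <= f y) -> (forall y, 0 <= g y) ->
  measurable_fun setT f -> measurable_fun setT g ->
  measurable_fun setT (log_ratio f g).
Proof.
move=> f0 g0 mf mg.
rewrite (_ : log_ratio f g = fun y => if 0 < f y then
    (if 0 < g y then (ln (f y) - ln (g y))%:E else +oo%E) else -oo%E); last first.
  apply/funext => y; rewrite log_ratioE//; case: ifPn => // fy.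
  by case: ifPn => // gy; rewrite ln_div ?posrE.
apply: measurable_fun_ifT => //.
  exact: measurable_fun_ltr.
apply: measurable_fun_ifT => //.
  exact: measurable_fun_ltr.
apply/measurable_EFinP; apply: measurable_funB.
  by apply: measurableT_comp => //; exact: measurable_ln.
by apply: measurableT_comp => //; exact: measurable_ln.
Qed.

Lemma measurable_llr f g : (forall y, 0 <= f y) -> (forall y, 0 <= g y) ->
  measurable_fun setT f -> measurable_fun setT g ->
  measurable_fun setT (llr f g).
Proof.
move=> f0 g0 mf mg; apply: measurableT_comp => //.
exact: measurable_log_ratio.
Qed.

End log_likelihood_ratio.

Section log_likelihood_moments.
Local Open Scope ereal_scope.
Context {R : realType}.
Variable nu : {sigma_finite_measure set R -> \bar R}.
Variables f g : R -> R.
Hypothesis (hf : is_density nu f) (hg : is_density nu g).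
Hypothesis moment1 : abs_moment nu g f f 1 < +oo.

Let mf : measurable_fun setT f. Proof. by case: hf. Qed.
Let mg : measurable_fun setT g. Proof. by case: hg. Qed.
Let f0 y : (0 <= f y)%R. Proof. by case: hf. Qed.
Let g0 y : (0 <= g y)%R. Proof. by case: hg. Qed.
Let mlr : measurable_fun setT (log_ratio g f).
Proof. exact: measurable_log_ratio. Qed.
Let mllr : measurable_fun setT (llr f g).
Proof. exact: measurable_llr. Qed.

(** Where [g] vanishes and [f] does not, the log ratio is infinite with positive weight; a finite
    first moment makes this a null set. *)
Let ae_pos : {ae nu, forall y, (0 < f y)%R -> (0 < g y)%R}.
Proof.
have int : nu.-integrable setT (fun y => `|log_ratio g f y| * (f y)%:E).
  apply/integrableP; split.
    apply: emeasurable_funM; last exact/measurable_EFinP.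
    exact: measurableT_comp.
  rewrite [ltLHS](_ : _ = abs_moment nu g f f 1)//.
  by apply: eq_integral => y _; rewrite gee0_abs// mule_ge0// lee_fin.
have := integrable_ae measurableT int.
apply: filterS => y /(_ I) + fy.
rewrite log_ratioE//; case: ifPn => // _ /=.
by rewrite gt0_mulye// lte_fin.
Qed.

(** Almost everywhere the integrand is [g] on [f > 0] and 0 elsewhere, so the integral is the mass
    that [g] puts on [f > 0], which may be smaller than 1. *)
Lemma integral_expR_llr : \int[nu]_y ((expR (llr f g y))%:E * (f y)%:E) <= 1.
Proof.
have [_ _ <-] := hg.
apply: ae_ge0_le_integral => //.
- by move=> y _; rewrite mule_ge0// lee_fin// expR_ge0.
- apply: emeasurable_funM; last exact/measurable_EFinP.
  by apply/measurable_EFinP; exact: measurableT_comp.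
- by move=> y _; rewrite lee_fin.
- exact/measurable_EFinP.
move: ae_pos; apply: filterS => y fg _.
rewrite -EFinM lee_fin llrE//; case: ifPn => [/andP[fy gy]|].
  by rewrite lnK ?posrE ?divr_gt0// divfK ?gt_eqF.
rewrite negb_and -!leNgt => /orP[fy|gy].
  have -> : f y = 0%R by apply/eqP; rewrite eq_le fy f0.
  by rewrite mulr0.
have -> : f y = 0%R.
  apply/eqP; rewrite eq_le f0 andbT leNgt; apply/negP => /fg.
  by rewrite ltNge gy.
by rewrite mulr0.
Qed.

Lemma abs_moment_llr k : (0 < k)%N ->
  \int[nu]_y ((`|llr f g y| ^+ k)%:E * (f y)%:E) = abs_moment nu g f f k.
Proof.
move=> k0; apply: ge0_ae_eq_integral => //.
- apply: emeasurable_funM; last exact/measurable_EFinP.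
  apply/measurable_EFinP; apply: measurable_funX.
  exact: measurableT_comp.
- apply: emeasurable_funM; last exact/measurable_EFinP.
  elim: k {k0} => [|k IH].
    exact: measurable_cst.
  under eq_fun do rewrite expeS.
  by apply: emeasurable_funM => //; exact: measurableT_comp.
- by move=> y _; rewrite mule_ge0// lee_fin// exprn_ge0.
- by move=> y _; rewrite mule_ge0// ?lee_fin// expe_ge0.
move: ae_pos; apply: filterS => y fg _.
rewrite /llr log_ratioE//.
have [fy|] := ltP 0%R (f y).
  by rewrite (fg fy)/= -EFin_expe.
move=> fy; have -> : f y = 0%R by apply/eqP; rewrite eq_le fy f0.
by rewrite !mule0.
Qed.

(** The sign comes from [llr f g] being the logarithm of [g / f]; where [f] vanishes both integrands
    are 0, whatever [fine] does to infinite values. *)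
Lemma integral_llr : \int[nu]_y ((llr f g y)%:E * (f y)%:E) = - KL nu f g.
Proof.
have int : nu.-integrable setT (fun y => (llr f g y)%:E * (f y)%:E).
  apply/integrableP; split.
    by apply: emeasurable_funM; exact/measurable_EFinP.
  rewrite [ltLHS](_ : _ = abs_moment nu g f f 1)// -abs_moment_llr//.
  by apply: eq_integral => y _; rewrite abseM/= expr1 [in X in _ * X]ger0_norm.
rewrite -[LHS]oppeK; congr (- _).
rewrite -integralN/=; last exact: integrable_add_def.
apply: ae_eq_integral => //.
- apply/measurable_EFinP; apply: measurable_funN.
  exact: measurable_funM.
- apply: emeasurable_funM; first exact/measurable_EFinP.
  exact: measurable_log_ratio.
move: ae_pos; apply: filterS => y fg _ /=.
rewrite -mulNr -llr_swap// EFinM muleC /llr log_ratioE//.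
have [fy|] := ltP 0%R (f y); first by rewrite (fg fy).
move=> fy; have -> : f y = 0%R by apply/eqP; rewrite eq_le fy f0.
by rewrite !mul0e.
Qed.

End log_likelihood_moments.

Lemma integral_cst_prob {R : realType} {d : measure_display}
    {Omega : measurableType d} (P : probability Omega R) (r : R) :
  (\int[P]__ r%:E = r%:E)%E.
Proof.
by rewrite (integral_cst P measurableT) [X in (_ * X)%E](probability_setT P) mule1.
Qed.

Section law_of_llr.
Local Open Scope ereal_scope.
Context {R : realType} {d : measure_display} {Omega : measurableType d}.
Variables (P : probability Omega R) (X : {mfun Omega >-> R}).
Variables (nu : {sigma_finite_measure set R -> \bar R}) (f : R -> R).
Hypothesis hf : is_density nu f.
Hypothesis lawX : forall B : set R, measurable B ->
  P (X @^-1` B) = \int[nu]_(y in B) (f y)%:E.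

Let mf : measurable_fun setT f. Proof. by case: hf. Qed.
Let f0 y : (0 <= f y)%R. Proof. by case: hf. Qed.

Lemma ge0_integral_law (G : R -> \bar R) : measurable_fun setT G ->
  (forall y, 0 <= G y) -> \int[P]_w G (X w) = \int[nu]_y (G y * (f y)%:E).
Proof.
move=> mG G0.
rewrite -(@ge0_integral_density _ _ _ nu (distribution P X))//.
by rewrite ge0_integral_distribution.
Qed.

Lemma integral_law (G : R -> R) : measurable_fun setT G ->
  \int[P]_w (G (X w))%:E = \int[nu]_y ((G y)%:E * (f y)%:E).
Proof.
move=> mG; have mEG : measurable_fun setT (EFin \o G) by exact/measurable_EFinP.
rewrite [LHS]integralE [RHS]integralE.
rewrite (_ : (fun w => (G (X w))%:E)^\+ = (fun w => (EFin \o G)^\+ (X w))).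
  2: by apply/funext => w; rewrite !funeposE.
rewrite (_ : (fun w => (G (X w))%:E)^\- = (fun w => (EFin \o G)^\- (X w))).
  2: by apply/funext => w; rewrite !funenegE.
rewrite !ge0_integral_law//; last 2 first.
- exact: measurable_funeneg.
- exact: measurable_funepos.
congr (_ - _); apply: eq_integral => y _.
- by rewrite !funeposE/= -EFin_max -!EFinM -EFin_max maxr_pMl// mul0r.
- by rewrite !funenegE/= -EFin_max -EFinM -EFin_max maxr_pMl// mul0r mulNr.
Qed.

Variable g : R -> R.
Hypothesis hg : is_density nu g.
Hypothesis moment1 : abs_moment nu g f f 1 < +oo.

Let mg : measurable_fun setT g. Proof. by case: hg. Qed.
Let g0 y : (0 <= g y)%R. Proof. by case: hg. Qed.
Let mllr : measurable_fun setT (llr f g).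
Proof. exact: measurable_llr. Qed.

Lemma mean_expR_llr : \int[P]_w (expR (llr f g (X w)))%:E <= 1.
Proof.
rewrite (ge0_integral_law (G := fun y => (expR (llr f g y))%:E)).
- exact: integral_expR_llr.
- by apply/measurable_EFinP; exact: measurableT_comp.
- by move=> y; rewrite lee_fin expR_ge0.
Qed.

Lemma mean_abs_llr k : (0 < k)%N ->
  \int[P]_w (`|llr f g (X w)| ^+ k)%:E = abs_moment nu g f f k.
Proof.
move=> k0; rewrite -abs_moment_llr//.
rewrite (ge0_integral_law (G := fun y => (`|llr f g y| ^+ k)%:E))//.
by apply/measurable_EFinP; apply: measurable_funX; exact: measurableT_comp.
Qed.

Lemma mean_llr : \int[P]_w (llr f g (X w))%:E = - KL nu f g.
Proof. by rewrite integral_law// integral_llr. Qed.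

End law_of_llr.

Section affinity.
Local Open Scope ereal_scope.
Context {R : realType} {d : measure_display} {Omega : measurableType d}.
Variables (P : probability Omega R) (Y : Omega -> R).
Hypothesis mY : measurable_fun setT Y.

(* Integrate [e^{Y/2} + (e^{Y/2} - 1)^2 / 2 = (1 + e^Y) / 2]. *)
Lemma mean_expR_half_lt1 : \int[P]_w (expR (Y w))%:E <= 1 ->
  0 < \int[P]_w `|Y w|%:E -> \int[P]_w (expR (Y w / 2))%:E < 1.
Proof.
move=> eY Y0.
have me : measurable_fun setT (fun w => expR (Y w / 2)).
  by apply: measurableT_comp => //; exact: measurable_funM.
pose q w : R := ((expR (Y w / 2) - 1) ^+ 2 / 2)%R.
have mq : measurable_fun setT q.
  by apply: measurable_funM => //; apply: measurable_funX; exact: measurable_funB.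
have q0 w : (0 <= q w)%R by rewrite /q divr_ge0// sqr_ge0.
have sumE : \int[P]_w (expR (Y w / 2))%:E + \int[P]_w (q w)%:E <= 1.
  rewrite -ge0_integralD//; last 3 first.
  - exact/measurable_EFinP.
  - by move=> w _; rewrite lee_fin.
  - exact/measurable_EFinP.
  rewrite (_ : 1 = 2^-1%:E + 2^-1%:E); last by rewrite -EFinD; congr EFin; lra.
  have -> : \int[P]_w ((expR (Y w / 2))%:E + (q w)%:E) =
      \int[P]_w (2^-1%:E + 2^-1%:E * (expR (Y w))%:E).
    apply: eq_integral => w _; rewrite -!EFinM -!EFinD /q; congr EFin.
    have -> : expR (Y w) = (expR (Y w / 2) * expR (Y w / 2))%R.
      by rewrite -expRD; congr expR; lra.
    by field.
  rewrite ge0_integralD//; last first.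
    by apply: measurable_funeM; apply/measurable_EFinP; exact: measurableT_comp.
  have -> : \int[P]__ (2^-1)%:E = 2^-1%:E.
    by rewrite integral_cst_prob.
  rewrite leeD2l//.
  rewrite ge0_integralZl//.
    by rewrite -[leRHS]mule1 lee_wpmul2l// lee_fin.
  by apply/measurable_EFinP; exact: measurableT_comp.
(* An affinity of 1 would leave nothing for the square [q], hence [Y = 0] almost surely, against the
   positive first moment. *)
rewrite ltNge; apply/negP => e1.
have iq0 : \int[P]_w (q w)%:E = 0.
  apply/eqP; rewrite eq_le integral_ge0 ?andbT; last by move=> w _; rewrite lee_fin.
  rewrite leNgt; apply/negP => iq.
  have : 1 + 0 < 1 + \int[P]_w (q w)%:E by rewrite lteD2lE.
  rewrite adde0 ltNge => /negP; apply.
  by apply: le_trans sumE; rewrite leeD2r.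
have : ae_eq P setT (EFin \o q) (cst 0).
  apply/(ae_eq_integral_abs P measurableT); first exact/measurable_EFinP.
  by rewrite -[RHS]iq0; apply: eq_integral => w _ /=; rewrite ger0_norm.
move=> q_eq0; move: Y0; rewrite lt_neqAle => /andP[+ _] => /eqP; apply.
apply/esym/(ae_eq_integral_abs P measurableT (f := EFin \o Y)).
  exact/measurable_EFinP.
move: q_eq0; apply: filterS => w /(_ I)/= -[/eqP qw0] _; congr EFin.
move: qw0; rewrite /q mulf_eq0 invr_eq0 pnatr_eq0 orbF sqrf_eq0 subr_eq0.
rewrite -[X in _ == X]expR0 => /eqP/expR_inj/eqP; rewrite mulf_eq0 invr_eq0 pnatr_eq0.
by rewrite orbF => /eqP.
Qed.

End affinity.

Section truncated_mean.
Local Open Scope ereal_scope.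
Context {R : realType} {d : measure_display} {Omega : measurableType d}.
Variables (P : probability Omega R) (Y : Omega -> R).
Hypothesis mY : measurable_fun setT Y.

(** Pointwise, the part of [Y] above [c] is at most [Y ^ 2 / c], so capping at [c] lowers the mean
    by at most [m2 / c]. *)
Lemma mean_sub_min_le (m m2 c : R) : (0 < c)%R ->
  P.-integrable setT (EFin \o Y) -> \int[P]_w (Y w)%:E = m%:E ->
  \int[P]_w (`|Y w| ^+ 2)%:E = m2%:E ->
  \int[P]_w (c - Num.min (Y w) c)%:E <= (c - m + m2 / c)%:E.
Proof.
move=> c0 iY mE m2E.
have iY2 : P.-integrable setT (fun w => (`|Y w| ^+ 2 / c)%:E).
  under eq_fun do rewrite EFinM.
  apply: integrableZr => //; apply/integrableP; split.
    apply/measurable_EFinP; apply: measurable_funX; exact: measurableT_comp.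
  rewrite (_ : \int[P]_x _ = m2%:E) ?ltry// -m2E.
  by apply: eq_integral => w _; rewrite /= ger0_norm// exprn_ge0.
have icY : P.-integrable setT (fun w => (c - Y w)%:E).
  under eq_fun do rewrite EFinB.
  by apply: integrableB => //; exact: finite_measure_integrable_cst.
have -> : (c - m + m2 / c)%:E = \int[P]_w ((c - Y w)%:E + (`|Y w| ^+ 2 / c)%:E).
  rewrite integralD//; under eq_integral do rewrite EFinB.
  rewrite integralB//=; last exact: finite_measure_integrable_cst.
  rewrite integral_cst_prob mE.
  under eq_integral do rewrite EFinM.
  rewrite integralZr//=; first by rewrite m2E -EFinM.
  apply/integrableP; split.
    apply/measurable_EFinP; apply: measurable_funX; exact: measurableT_comp.
  rewrite (_ : \int[P]_x _ = m2%:E) ?ltry// -m2E.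
  by apply: eq_integral => w _; rewrite /= ger0_norm// exprn_ge0.
apply: ge0_le_integral => //.
- by move=> w _; rewrite lee_fin subr_ge0 ge_min lexx orbT.
- by apply/measurable_EFinP; apply: measurable_funB => //; exact: measurable_minr.
- apply: emeasurable_funD; first exact: measurable_int icY.
  exact: measurable_int iY2.
move=> w _; rewrite -EFinD lee_fin.
have y2c : (0 <= `|Y w| ^+ 2 / c)%R by rewrite divr_ge0 ?exprn_ge0// ltW.
have [yc|cy] := leP (Y w) c; first by lra.
have y0 : (0 <= Y w)%R by rewrite (le_trans _ (ltW cy))// ltW.
have : (Y w <= `|Y w| ^+ 2 / c)%R.
  by rewrite ger0_norm// ler_pdivlMr// expr2 ler_wpM2l// ltW.
lra.
Qed.

End truncated_mean.

(** * First passage times as series, adapted statistics and the stopping time *)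

Section first_time.
Context {R : realType}.
Implicit Types Q : nat -> Prop.

Lemma first_time_cases Q :
  (exists m, [/\ (1 <= m)%N, Q m, (forall k, (1 <= k < m)%N -> ~ Q k) &
     first_time Q = (m%:R : R)%:E]) \/
  ((forall k, (1 <= k)%N -> ~ Q k) /\ first_time Q = +oo%E :> \bar R).
Proof.
have [[m0 m0Q]|nQ] := pselect (exists m, (1 <= m)%N /\ Q m); [left|right].
  pose p m := `[< (1 <= m)%N /\ Q m >].
  have ep : exists m, p m by exists m0; exact/asboolP.
  exists (ex_minn ep); case: ex_minnP => m /asboolP[m1 Qm] minm; split => //.
    move=> k /andP[k1 km] Qk.
    have pk : p k by apply/asboolP.
    by have := minm k pk; rewrite leqNgt km.
  rewrite /first_time; apply/eqP; rewrite eq_le; apply/andP; split.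
    by apply: ereal_inf_lbound; exists m.
  apply: le_ereal_inf_tmp => _ [n [n1 Qn] <-]; rewrite lee_fin ler_nat minm//.
  exact/asboolP.
split; first by move=> k k1 Qk; apply: nQ; exists k.
rewrite /first_time (_ : [set _ | _ in _] = set0) ?ereal_inf0//.
by apply/seteqP; split => // x [n [n1 Qn] _]; apply: nQ; exists n.
Qed.

Lemma lt_first_time Q n : ((n%:R : R)%:E < first_time Q)%E =
  `[< forall k, (1 <= k <= n)%N -> ~ Q k >].
Proof.
have [[m [m1 Qm minm ->]]|[nQ ->]] := first_time_cases Q; last first.
  by rewrite ltry; apply/esym/asboolP => k /andP[k1 _]; exact: nQ.
rewrite lte_fin ltr_nat; apply/idP/asboolP => [nm k /andP[k1 kn]|h].
  by apply: minm; rewrite k1 (leq_ltn_trans kn).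
by rewrite ltnNge; apply/negP => mn; apply: (h m) => //; rewrite m1.
Qed.

Lemma first_time_ge0 Q : (0 <= first_time Q :> \bar R)%E.
Proof.
by apply: le_ereal_inf_tmp => _ [n _ <-]; rewrite lee_fin.
Qed.

Lemma nneseries_ind_lt (g m : nat) : (g <= m)%N ->
  (\sum_(g <= n <oo) ((n < m)%N%:R : R)%:E = (m%:R - g%:R : R)%:E)%E.
Proof.
move=> gm.
rewrite (nneseries_split g (m - g)); last by move=> k _; rewrite lee_fin.
rewrite subnKC// eseries0 ?adde0; last first.
  by move=> k mk _ /=; rewrite ltnNge mk.
rewrite (eq_big_nat _ _ (F2 := fun=> 1%E)); last first.
  by move=> k /andP[_ ->].
rewrite big_const_nat iter_addr addr0 -natrB// -[in RHS]mulr_natl mulr1.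
by rewrite EFin_natmul.
Qed.

(** The positive part counts the integers from [g] on that lie below the first time; if there is no
    such time, the series diverges. *)
Lemma first_time_subE Q g : (maxe (first_time Q - (g%:R : R)%:E) 0 =
  \sum_(g <= n <oo) (((n%:R : R)%:E < first_time Q)%E%:R)%:E)%E.
Proof.
have [[m [m1 Qm minm ->]]|[nQ ->]] := first_time_cases Q; last first.
  rewrite addye ?ltNyr// max_l ?leey//; apply/esym.
  rewrite (eq_eseriesr (g := fun=> 1%E)); last by move=> n _; rewrite ltry.
  apply: eq_infty => r.
  pose m := (g + (Num.Def.truncn (`|r| : R)).+1)%N.
  have gm : (g <= m)%N by exact: leq_addr.
  apply: (@le_trans _ _ (m%:R - g%:R : R)%:E).
    rewrite lee_fin /m natrD addrAC subrr add0r.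
    apply: (le_trans (ler_norm r)); exact: ltW (truncnS_gt _).
  rewrite -nneseries_ind_lt//; apply: lee_nneseries => n _ //.
  by rewrite lee_fin lern1 leq_b1.
under eq_eseriesr do rewrite lte_fin ltr_nat.
have [gm|mg] := leqP g m.
  by rewrite nneseries_ind_lt// -EFinB max_l// lee_fin subr_ge0 ler_nat.
rewrite max_r; last by rewrite -EFinB lee_fin subr_le0 ler_nat ltnW.
rewrite eseries0// => n gn _; rewrite ltnNge.
by rewrite (leq_trans (ltnW mg) gn).
Qed.

Lemma first_timeE Q : first_time Q =
  (\sum_(0 <= n <oo) (((n%:R : R)%:E < first_time Q)%E%:R)%:E)%E :> \bar R.
Proof.
by rewrite -first_time_subE sube0 max_l// first_time_ge0.
Qed.

End first_time.

Section sensor_measurable.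
Context {R : realType} {d : measure_display} {T : measurableType d}.
Variables (f0 f1 : R -> R) (mu : R) (h : \bar R) (D : R).
Hypothesis mllr : measurable_fun setT (llr f0 f1).
Variable xs : nat -> T -> R.

Lemma measurable_fun_setle (f g : T -> R) : measurable_fun setT f ->
  measurable_fun setT g -> measurable [set w | f w <= g w].
Proof.
move=> mf mg.
have mB : measurable [set true] by [].
have := measurable_fun_ler mf mg measurableT mB.
by rewrite setTI.
Qed.

Lemma measurable_trunc_below : measurable_fun setT (trunc_below h).
Proof.
by apply: measurableT_comp => //; apply: measurable_maxe.
Qed.

(** Only the coordinates 1 to [n] have to be measurable, and [T] is arbitrary: [Omega] with the past
    up to [n] makes the statistic adapted, a path space makes it a measurable function of the
    path. *)
Lemma measurable_decusum n :
  (forall k, (1 <= k <= n)%N -> measurable_fun setT (xs k)) ->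
  measurable_fun setT (fun w => decusum f0 f1 mu h (xs ^~ w) n).
Proof.
elim: n => [|n IH] mxs; first exact: measurable_cst.
have mW : measurable_fun setT (fun w => decusum f0 f1 mu h (xs ^~ w) n).
  by apply: IH => k /andP[k1 kn]; apply: mxs; rewrite k1 leqW.
apply: measurable_fun_ifT => //=.
- exact: measurable_fun_ler.
- apply: measurableT_comp; first exact: measurable_trunc_below.
  apply: measurable_funD => //; apply: measurableT_comp => //.
  by apply: mxs; rewrite ltnS leqnn.
- by apply: measurable_minr => //; exact: measurable_funD.
Qed.

Lemma measurable_llr_sum n :
  (forall k, (1 <= k <= n)%N -> measurable_fun setT (xs k)) ->
  measurable_fun setT (fun w => llr_sum f0 f1 (xs ^~ w) n).
Proof.
move=> mxs.
rewrite (_ : (fun w => _) =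
    fun w => \sum_(k < n) llr f0 f1 (xs k.+1 w)); last first.
  by apply/funext => w; rewrite /llr_sum big_add1 big_mkord.
apply: measurable_sum => k; apply: measurableT_comp => //.
by apply: mxs => /=.
Qed.

End sensor_measurable.

Section past_integrals.
Context {R : realType} {L : nat}.
Context {d : measure_display} {Omega : measurableType d}.
Variable X : nat -> 'I_L -> {mfun Omega >-> R}.

Definition past_measurable (n : nat) (F : Omega -> R) : Prop :=
  measurable_fun [set: g_sigma_algebraType (past X n)]
    (F : g_sigma_algebraType (past X n) -> R).

Lemma past_measurable_obs n k l : (1 <= k <= n)%N -> past_measurable n (X k l).
Proof.
move=> kn _ B mB; rewrite setTI; apply: sub_sigma_algebra.
by exists k, l; split => //; exists B.
Qed.

Lemma past_measurableW n F : past_measurable n F -> measurable_fun setT F.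
Proof.
by move=> mF _ B mB; rewrite setTI; apply: g_past_measurable;
  have := mF measurableT B mB; rewrite setTI; exact.
Qed.

Lemma past_measurableS m n F : (m <= n)%N -> past_measurable m F ->
  past_measurable n F.
Proof.
move=> mn mF _ B mB; apply: (sub_g_past mn); exact: mF.
Qed.

Variable P : probability Omega R.
Hypothesis indepX :
  mutually_independent P (fun i : nat * 'I_L => X i.1.+1 i.2 : Omega -> R).

(** The indicator of [A] is absorbed into the factor known at time [n]. This identity takes the
    place of conditioning on the past. *)
Lemma past_ge0_integralM n l A (F : Omega -> R) (G : R -> R) :
  <<s past X n >> A -> past_measurable n F -> (forall w, 0 <= F w) ->
  measurable_fun setT G -> (forall y, 0 <= G y) ->
  (\int[P]_(w in A) (F w * G (X n.+1 l w))%:E =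
   (\int[P]_(w in A) (F w)%:E) * \int[P]_w (G (X n.+1 l w))%:E)%E.
Proof.
move=> pA mF F0 mG G0.
rewrite [in LHS]integral_mkcond [in X in (X * _)%E]integral_mkcond.
pose FA : g_sigma_algebraType (past X n) -> \bar R :=
  fun w => ((F w)%:E * (\1_A w)%:E)%E.
have mFA : measurable_fun setT FA.
  apply: emeasurable_funM; apply/measurable_EFinP; first exact: mF.
  exact: (@measurable_indic _ (g_sigma_algebraType (past X n)) R setT A pA).
have -> : (\int[P]_w ((fun w => (F w * G (X n.+1 l w))%:E) \_ A) w =
    \int[P]_w (FA w * (EFin \o G) (X n.+1 l w)))%E.
  apply: eq_integral => w _; rewrite /FA patchE indicE.
  by case: ifP => _; rewrite ?mule1 ?mule0 ?mul0e.
have -> : (\int[P]_w ((fun w => (F w)%:E) \_ A) w = \int[P]_w (FA w))%E.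
  apply: eq_integral => w _; rewrite /FA patchE indicE.
  by case: ifP => _; rewrite ?mule1 ?mule0 ?mul0e.
apply: (ge0_integral_indep (S := past X n)) => //.
- exact: measurable_past.
- by move=> B C pB mC; exact: past_indep.
- by move=> w; rewrite /FA mule_ge0// lee_fin.
- exact/measurable_EFinP.
Qed.

Lemma past_ge0_integral n l A (G : R -> R) :
  <<s past X n >> A -> measurable_fun setT G -> (forall y, 0 <= G y) ->
  (\int[P]_(w in A) (G (X n.+1 l w))%:E =
   P A * \int[P]_w (G (X n.+1 l w))%:E)%E.
Proof.
move=> pA mG G0.
have := @past_ge0_integralM n l A (cst 1) G pA (measurable_cst _) (fun=> ler01) mG G0.
under eq_integral do rewrite mul1r.
move=> ->; congr (_ * _)%E.
exact: etrans (integral_cst P (g_past_measurable pA) _) (mul1e _).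
Qed.

Lemma past_integral n l A (G : R -> R) :
  <<s past X n >> A -> measurable_fun setT G ->
  P.-integrable setT (fun w => (G (X n.+1 l w))%:E) ->
  (\int[P]_(w in A) (G (X n.+1 l w))%:E =
   P A * \int[P]_w (G (X n.+1 l w))%:E)%E.
Proof.
move=> pA mG iG.
have mA : measurable A := g_past_measurable pA.
have posE w : (fun w => (G (X n.+1 l w))%:E)^\+%E w = (G^\+ (X n.+1 l w))%:E.
  by rewrite funeposE -EFin_max.
have negE w : (fun w => (G (X n.+1 l w))%:E)^\-%E w = (G^\- (X n.+1 l w))%:E.
  by rewrite funenegE -EFinN -EFin_max.
rewrite [in LHS]integralE [in X in (_ * X)%E]integralE.
rewrite muleBr ?fin_num_measure//; last first.
  rewrite fin_num_adde_defr//.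
  apply: integrable_fin_num => //; exact: integrable_funepos.
under eq_integral do rewrite posE.
under [X in (_ - X)%E]eq_integral do rewrite negE.
have h1 := past_ge0_integral l pA (measurable_funrpos mG) (funrpos_ge0 G).
have h2 := past_ge0_integral l pA (measurable_funrneg mG) (funrneg_ge0 G).
rewrite h1 h2; congr (_ * _ - _ * _)%E.
- by apply: eq_integral => w _; rewrite posE.
- by apply: eq_integral => w _; rewrite negE.
Qed.

End past_integrals.

Lemma sume_nat_const {R : realType} (n : nat) (x : \bar R) : (0 <= x)%E ->
  (\sum_(0 <= k < n) x = n%:R%:E * x)%E.
Proof.
move=> x0; elim: n => [|n IH]; first by rewrite big_geq// mul0e.
by rewrite big_nat_recr//= IH -natr1 EFinD ge0_muleDl// mul1e.
Qed.

Section stopping.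
Context {R : realType} {L : nat}.
Context {d : measure_display} {Omega : measurableType d}.
Variables (f0 f1 : 'I_L -> R -> R) (X : nat -> 'I_L -> {mfun Omega >-> R}).
Variables (mu : 'I_L -> R) (h : 'I_L -> \bar R) (D : 'I_L -> R) (A : R).
Hypothesis mllr : forall l, measurable_fun setT (llr (f0 l) (f1 l)).

Definition stat (n : nat) (l : 'I_L) (w : Omega) : R :=
  decusum (f0 l) (f1 l) (mu l) (h l) (obs X l w) n.

Lemma past_measurable_stat n l : past_measurable X n (stat n l).
Proof.
apply: (@measurable_decusum _ _ (g_sigma_algebraType (past X n)) _ _ _ _
  (mllr l) (fun k => X k l)).
by move=> k; exact: past_measurable_obs.
Qed.

Lemma past_setle n (F G : Omega -> R) : past_measurable X n F ->
  past_measurable X n G -> <<s past X n >> [set w | F w <= G w].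
Proof. by move=> mF mG; exact: (measurable_fun_setle mF mG). Qed.

Definition alive (n : nat) : set Omega :=
  [set w | ((n%:R : R)%:E < tau f0 f1 X mu h D A w)%E].

Lemma aliveP n w : alive n w <-> forall k, (1 <= k <= n)%N ->
  forall l, Yn f0 f1 X mu h D k l w <= A.
Proof.
rewrite /alive/= /tau lt_first_time; split.
  move=> /asboolP al k kn l; rewrite leNgt; apply/negP => lA.
  apply: (al k kn); rewrite ltNge; apply/negP => /bigmax_leP[_ /(_ l isT)].
  by rewrite lee_fin leNgt lA.
move=> al; apply/asboolP => k kn; rewrite ltNge; apply/negP; rewrite negbK.
by apply/bigmax_leP; split => [|l _]; rewrite ?leNye// lee_fin al.
Qed.

Lemma alive0 : alive 0 = setT.
Proof.
apply/seteqP; split => // w _; apply/aliveP => k.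
by rewrite leqn0 => /andP[/[swap]/eqP->].
Qed.

Lemma aliveS n : alive n.+1 = alive n `&`
  [set w | forall l, Yn f0 f1 X mu h D n.+1 l w <= A].
Proof.
apply/seteqP; split => [w /aliveP al|w [/aliveP al alS]].
  split; last by move=> l; apply: al; rewrite leqnn.
  by apply/aliveP => k /andP[k1 kn]; apply: al; rewrite k1 leqW.
apply/aliveP => k /andP[k1]; rewrite leq_eqVlt => /predU1P[->//|kn].
by apply: al; rewrite k1.
Qed.

Lemma sub_alive m n : (m <= n)%N -> alive n `<=` alive m.
Proof.
move=> mn w /aliveP al; apply/aliveP => k /andP[k1 km]; apply: al.
by rewrite k1 (leq_trans km).
Qed.

Lemma YnE n l w : Yn f0 f1 X mu h D n l w =
  if D l < stat n l w then stat n l w else 0.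
Proof.
rewrite /Yn /sent /transmits /stat.
by case: ifPn => _; rewrite (mulr1, mulr0).
Qed.

Lemma past_measurable_sent n l :
  past_measurable X n (Yn f0 f1 X mu h D n l).
Proof.
have mW := @past_measurable_stat n l.
rewrite /past_measurable (_ : Yn f0 f1 X mu h D n l =
  fun w => if D l < stat n l w then stat n l w else 0); last first.
  by apply/funext => w; exact: YnE.
apply: measurable_fun_ifT => //.
exact: measurable_fun_ltr.
Qed.

Lemma past_alive n : <<s past X n >> (alive n).
Proof.
elim: n => [|n IH].
  rewrite alive0.
  exact: (@measurableT _ (g_sigma_algebraType (past X 0))).
rewrite aliveS; apply: (@measurableI _ (g_sigma_algebraType (past X n.+1))).
  exact: (sub_g_past (leqnSn n)).
rewrite (_ : [set w | _] = \bigcap_(l in [set: 'I_L])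
    [set w | Yn f0 f1 X mu h D n.+1 l w <= A]).
  apply: (@fin_bigcap_measurable _ (g_sigma_algebraType (past X n.+1))) => // l _.
  apply: past_setle; first exact: past_measurable_sent.
  exact: measurable_cst.
by apply/seteqP; split => w /= wA l; [move=> _|]; apply: wA.
Qed.

Lemma measurable_alive n : measurable (alive n).
Proof. by apply: (@g_past_measurable _ _ _ _ X n); exact: past_alive. Qed.

Lemma tau_subE g w : (maxe (tau f0 f1 X mu h D A w - (g%:R : R)%:E) 0 =
  \sum_(g <= n <oo) (\1_(alive n) w)%:E)%E.
Proof.
rewrite /tau first_time_subE; apply: eq_eseriesr => n _.
rewrite indicE; congr (nat_of_bool _)%:R%:E.
by apply/idP/idP; rewrite inE.
Qed.

Variable P : probability Omega R.

(** Turns a mean delay into a series of probabilities of past events, so that a one-step inequality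
    on each of these events can be summed. *)
Lemma integral_tau_sub g (E : set Omega) : measurable E ->
  (\int[P]_(w in E) maxe (tau f0 f1 X mu h D A w - (g%:R : R)%:E) 0 =
  \sum_(g <= n <oo) P (E `&` alive n))%E.
Proof.
move=> mE; under eq_integral do rewrite tau_subE -nneseries_addn//.
have iE n : (\int[P]_(w in E) (\1_(alive (n + g)) w)%:E = P (E `&` alive (n + g)))%E.
  by rewrite setIC; exact: integral_indic (measurable_alive _).
rewrite -nneseries_addn// integral_nneseries//.
  by apply: eq_eseriesr => n _; exact: iE.
by move=> n; apply/measurable_EFinP/measurable_indic; exact: measurable_alive.
Qed.

Lemma integral_tau :
  (\int[P]_w tau f0 f1 X mu h D A w = \sum_(0 <= n <oo) P (alive n))%E.
Proof.
rewrite (_ : (fun w => _) = (fun w => maxe (tau f0 f1 X mu h D A w - (0%:R : R)%:E) 0)%E).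
  by rewrite integral_tau_sub//; under eq_eseriesr do rewrite setTI.
by apply/funext => w; rewrite sube0 max_l// first_time_ge0.
Qed.

End stopping.

(** * The false alarm rate *)

Section shiryaev_roberts.
Context {R : realType}.
Variables (f0 f1 : R -> R) (mu h : R) (x : nat -> R).
Hypothesis h0 : 0 <= h.

Local Notation W := (decusum f0 f1 mu h%:E x).

(* The Shiryaev-Roberts statistic, updated at the sampled times only. *)
Fixpoint sroberts (n : nat) : R :=
  if n is m.+1 then
    if 0 <= W m then (1 + sroberts m) * expR (llr f0 f1 (x m.+1))
    else sroberts m
  else 0.

Lemma sroberts_ge0 n : 0 <= sroberts n.
Proof.
elim: n => //= n IH; case: ifP => // _.
by rewrite mulr_ge0 ?expR_ge0// addr_ge0.
Qed.

Lemma trunc_belowE y : trunc_below h%:E y = Num.max y (- h).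
Proof. by rewrite /trunc_below -EFinN -EFin_max. Qed.

(** A positive value can only come from a sample taken at [W >= 0], not from a skip or a truncation.
    The 1 added in the recursion pays for a start at [W = 0], where the induction hypothesis is
    silent. *)
Lemma expR_decusum_le n : 0 < W n -> expR (W n) <= sroberts n.
Proof.
elim: n => [|n IH] /=; first by rewrite ltxx.
case: ifPn => [W0|_]; last by rewrite lt_min ltxx andbF.
rewrite trunc_belowE lt_max oppr_gt0 [h < 0]ltNge h0 orbF => y0.
rewrite max_l; last by rewrite (le_trans _ (ltW y0))// oppr_le0.
rewrite expRD ler_wpM2r ?expR_ge0//.
move: W0; rewrite le_eqVlt => /predU1P[<-|/IH/le_trans]; last by apply; lra.
by rewrite expR0 lerDl sroberts_ge0.
Qed.

End shiryaev_roberts.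

Section false_alarm.
Context {R : realType} {L : nat}.
Context {d : measure_display} {Omega : measurableType d}.
Variables (f0 f1 : 'I_L -> R -> R) (X : nat -> 'I_L -> {mfun Omega >-> R}).
Variables (mu h D : 'I_L -> R) (A : R) (P : option nat -> probability Omega R).
Hypothesis mllr : forall l, measurable_fun setT (llr (f0 l) (f1 l)).
Hypothesis h0 : forall l, 0 <= h l.
Hypothesis A0 : 0 <= A.
Hypothesis indepX :
  mutually_independent (P None) (fun i : nat * 'I_L => X i.1.+1 i.2 : Omega -> R).
Hypothesis mean_le1 : forall n l,
  (\int[P None]_w (expR (llr (f0 l) (f1 l) (X n.+1 l w)))%:E <= 1)%E.

Let H l : \bar R := (h l)%:E.
Let al := alive f0 f1 X mu H D A.
Let sr n l w : R := sroberts (f0 l) (f1 l) (mu l) (h l) (obs X l w) n.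

Let sr0 n l w : 0 <= sr n l w. Proof. exact: sroberts_ge0. Qed.

Let msr n l : past_measurable X n (sr n l).
Proof.
elim: n => [|n IH]; first exact: measurable_cst.
apply: measurable_fun_ifT.
- apply: measurable_fun_ler; first exact: measurable_cst.
  apply: (past_measurableS (leqnSn n)).
  exact: (@past_measurable_stat _ _ _ _ f0 f1 X mu H mllr).
- apply: measurable_funM.
    apply: measurable_funD; first exact: measurable_cst.
    exact: (past_measurableS (leqnSn n)).
  apply: measurableT_comp => //; apply: measurableT_comp => //.
  by apply: (@past_measurable_obs _ _ _ _ X n.+1 n.+1 l); rewrite leqnn.
- exact: (past_measurableS (leqnSn n)).
Qed.

Let pal n : <<s past X n >> (al n). Proof. exact: past_alive. Qed.

Let mal n : measurable (al n). Proof. exact: measurable_alive. Qed.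

Let msrW n l : measurable_fun setT (sr n l).
Proof. by apply: (@past_measurableW _ _ _ _ X n); exact: msr. Qed.

Let sr_step n l :
  (\int[P None]_(w in al n) (sr n.+1 l w)%:E <=
   \int[P None]_(w in al n) (sr n l w)%:E + P None (al n))%E.
Proof.
(* The update is [F1 * exp (llr) + F2] with both coefficients known at time [n], so a likelihood
   ratio of mean at most 1 adds at most 1. *)
pose S w := 0 <= stat f0 f1 X mu H n l w.
pose F1 w := if S w then 1 + sr n l w else 0.
pose F2 w := if S w then 0 else sr n l w.
have mS : measurable_fun [set: g_sigma_algebraType (past X n)] S.
  apply: measurable_fun_ler; first exact: measurable_cst.
  exact: (@past_measurable_stat _ _ _ _ f0 f1 X mu H mllr).
have mF1 : past_measurable X n F1.
  apply: measurable_fun_ifT => //.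
  by apply: measurable_funD; [exact: measurable_cst|exact: msr].
have mF2 : past_measurable X n F2.
  by apply: measurable_fun_ifT => //; exact: msr.
have F10 w : 0 <= F1 w by rewrite /F1; case: ifP => // _; rewrite addr_ge0.
have F20 w : 0 <= F2 w by rewrite /F2; case: ifP.
have me : measurable_fun setT (fun y => expR (llr (f0 l) (f1 l) y)).
  exact: measurableT_comp.
have srE w : sr n.+1 l w = F1 w * expR (llr (f0 l) (f1 l) (X n.+1 l w)) + F2 w.
  rewrite /sr/= /F1 /F2 /S /stat /=; case: ifP => _; first by rewrite addr0.
  by rewrite mul0r add0r.
under eq_integral do rewrite srE EFinD.
have mW F : past_measurable X n F -> measurable_fun (al n) (EFin \o F).
  by move=> mF; apply/measurable_EFinP/measurable_funTS; exact: past_measurableW mF.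
rewrite ge0_integralD//; last 4 first.
- by move=> w _; rewrite lee_fin mulr_ge0// expR_ge0.
- apply/measurable_EFinP/measurable_funTS; apply: measurable_funM.
    exact: past_measurableW mF1.
  exact: (measurableT_comp me (measurable_funPT (X n.+1 l))).
- by move=> w _; rewrite lee_fin.
- exact: mW.
rewrite (past_ge0_integralM indepX l (@pal n) mF1 F10 me (fun y => expR_ge0 _)).
have i0 F : (forall w, 0 <= F w) -> (0 <= \int[P None]_(w in al n) (F w)%:E)%E.
  by move=> F0; apply: integral_ge0 => w _; rewrite lee_fin.
apply: (@le_trans _ _ (\int[P None]_(w in al n) (F1 w)%:E +
    \int[P None]_(w in al n) (F2 w)%:E)%E).
  by rewrite leeD2r// -[leRHS]mule1 lee_wpmul2l// i0.
rewrite -ge0_integralD//; last 4 first.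
- by move=> w _; rewrite lee_fin.
- exact: mW.
- by move=> w _; rewrite lee_fin.
- exact: mW.
have -> : (\int[P None]_(w in al n) (sr n l w)%:E + P None (al n) =
    \int[P None]_(w in al n) ((sr n l w)%:E + 1))%E.
  rewrite ge0_integralD//.
  - congr (_ + _)%E; exact: esym (etrans (integral_cst _ (mal n) _) (mul1e _)).
  - by move=> w _; rewrite lee_fin.
  - exact: mW.
apply: ge0_le_integral => //.
- by move=> w _; rewrite adde_ge0// lee_fin.
- by apply: emeasurable_funD; exact: mW.
- by apply: emeasurable_funD; [exact: mW|exact: measurable_cst].
move=> w _; rewrite -!EFinD lee_fin /F1 /F2; case: ifP => _; lra.
Qed.

Let ssr n w : R := \sum_(l < L) sr n l w.

Let mssr n : measurable_fun setT (ssr n).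
Proof. exact: measurable_sum. Qed.

Let ssr0 n w : 0 <= ssr n w.
Proof. exact: sumr_ge0. Qed.

Let ssrE n m : (\int[P None]_(w in al n) (ssr m w)%:E =
  \sum_(l < L) \int[P None]_(w in al n) (sr m l w)%:E)%E.
Proof.
rewrite /ssr; under eq_integral do rewrite -sumEFin.
rewrite ge0_integral_sum//.
- by move=> l; apply/measurable_EFinP/measurable_funTS.
- by move=> l w _; rewrite lee_fin.
Qed.

Let ssr_step n :
  (\int[P None]_(w in al n) (ssr n.+1 w)%:E <=
   \int[P None]_(w in al n) (ssr n w)%:E + L%:R%:E * P None (al n))%E.
Proof.
rewrite !ssrE.
rewrite (_ : (L%:R%:E * P None (al n) = \sum_(l < L) P None (al n))%E).
  by rewrite -big_split/=; apply: lee_sum => l _; exact: sr_step.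
by rewrite -(sume_nat_const L)// big_mkord.
Qed.

(** The value that raises the alarm exceeds [A >= 0], so it is a positive statistic and not the 0 of
    a silent sensor; its term alone is at least [exp A]. *)
Let ssr_stop n w : (al n `\` al n.+1) w -> expR A <= ssr n.+1 w.
Proof.
rewrite /al aliveS => -[aln]; rewrite not_andP => -[//|].
move=> /existsNP[l]/negP; rewrite -ltNge => AY.
rewrite /ssr (bigD1 l)//.
apply: (@le_trans _ _ (sr n.+1 l w)); last by rewrite lerDl sumr_ge0.
move: AY; rewrite YnE; case: ifPn => [_ AW|_]; last by rewrite ltNge A0.
have W0 := le_lt_trans A0 AW.
apply: le_trans (expR_decusum_le (h0 l) W0).
by rewrite ler_expR ltW.
Qed.

(** Optional stopping, one step at a time: on [al n] the sum grows in mean by at most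
    [L * P (al n)], and the paths that leave carry at least [exp A] with them. *)
Let sum_ssr_le n :
  (\int[P None]_(w in al n) (ssr n w)%:E +
    (expR A)%:E * P None (~` al n) <= L%:R%:E * \sum_(0 <= k < n) P None (al k))%E.
Proof.
elim: n => [|n IH].
  rewrite big_geq// mule0 /al alive0 setCT measure0 mule0 adde0.
  rewrite integral0_eq// => w _; congr EFin.
  by rewrite /ssr big1.
have mst : measurable (al n `\` al n.+1) by exact: measurableD.
have alU : al n = al n.+1 `|` (al n `\` al n.+1).
  by rewrite setDUK//; exact: sub_alive.
have alC : ~` al n.+1 = ~` al n `|` (al n `\` al n.+1).
  apply/seteqP; split => [w nal|w [nal|[]//]].
    by have [|] := pselect (al n w); [right|left].
  by apply: contra_not nal; exact: sub_alive.
rewrite big_nat_recr//= ge0_muleDr//; last exact: sume_ge0.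
rewrite alC measureU//; last 2 first.
- exact: measurableC.
- by apply/seteqP; split => // w [? []].
rewrite ge0_muleDr// addeA addeAC.
apply: (@le_trans _ _ (\int[P None]_(w in al n) (ssr n.+1 w)%:E +
    (expR A)%:E * P None (~` al n))%E).
  rewrite leeD2r// [in leRHS]alU ge0_integral_setU//; last 3 first.
  - by apply/measurable_EFinP/measurable_funTS.
  - by move=> w _; rewrite lee_fin.
  - by apply/disj_setPS => w [? []].
  rewrite leeD2l//.
  rewrite -integral_cst//; apply: ge0_le_integral => //.
  - by move=> w _; rewrite lee_fin expR_ge0.
  - by apply/measurable_EFinP/measurable_funTS.
  - by move=> w wst; rewrite lee_fin ssr_stop.
apply: (le_trans (leeD2r _ (ssr_step n))).
by rewrite addeAC leeD2r.
Qed.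

Lemma FAR_le (alpha : R) : 0 < alpha -> expR A = L%:R / alpha -> (1 <= L)%N ->
  (FAR f0 f1 X mu H D A P <= alpha%:E)%E.
Proof.
move=> alpha0 AE L1.
rewrite /FAR integral_tau//.
set t := (\sum_(0 <= n <oo) _)%E.
have t0 : (0 <= t)%E by exact: nneseries_ge0.
(* If [E tau] is infinite, its inverse in the extended reals is 0. *)
have [tfin|] := boolP (t \is a fin_num); last first.
  rewrite fin_num_abs -leNgt leye_eq gee0_abs// => /eqP ->.
  by rewrite invey lee_fin ltW.
have partial n : (\sum_(0 <= k < n) P None (al k) <= t)%E.
  exact: nneseries_lim_ge.
(* The probabilities [P (al k)] decrease in [k], so the first [n] terms of the series for [E tau]
   are at least [P (al n)]; hence [P (al n)] tends to 0. *)
have decr n : (n%:R%:E * P None (al n) <= t)%E.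
  apply: le_trans (partial n).
  rewrite -sume_nat_const// big_nat [leRHS]big_nat.
  apply: lee_sum => k /andP[_ kn]; apply: le_measure; rewrite ?inE//.
  exact/sub_alive/ltnW.
have main n : expR A * (1 - fine (P None (al n))) <= L%:R * fine t.
  rewrite -lee_fin EFinM EFinB fineK ?fin_num_measure// -probability_setC//.
  rewrite EFinM fineK//; apply: le_trans (le_trans (sum_ssr_le n) _).
    by rewrite leeDr// integral_ge0// => w _; rewrite lee_fin.
  by rewrite lee_wpmul2l// lee_fin.
have eA0 : 0 < expR A by exact: expR_gt0.
have tA : expR A <= L%:R * fine t.
  apply/ler_addgt0Pr => e e0.
  (* Chosen so that [exp A * P (al n) <= e], by [n * P (al n) <= E tau]. *)
  pose n := (Num.truncn (expR A * fine t / e)).+1.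
  have nlt : expR A * fine t / e < n%:R by exact: truncnS_gt.
  apply: le_trans (lerD (main n) (lexx _)).
  rewrite mulrBr mulr1 -addrA lerDl addrC subr_ge0.
  have := decr n; rewrite -(fineK tfin) -(fineK (fin_num_measure (P None) _ (mal n))).
  rewrite -EFinM lee_fin => dn.
  have n0 : 0 < n%:R :> R by rewrite ltr0n.
  rewrite -(ler_pM2l n0) mulrCA; apply: (@le_trans _ _ (expR A * fine t)).
    by rewrite ler_wpM2l// ltW.
  by rewrite -ler_pdivrMr// ltW.
rewrite -(fineK tfin) inver; case: ifPn => [/eqP t00|tn0].
  by move: tA; rewrite t00 mulr0 leNgt eA0.
have tp : 0 < fine t by rewrite lt0r tn0 fine_ge0.
rewrite lee_fin; move: tA; rewrite AE ler_pM2l ?ltr0n//.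
by move=> ta; rewrite -[leRHS]invrK lef_pV2// posrE invr_gt0.
Qed.

End false_alarm.

(** * The detection delay *)

Section drift.
Context {R : realType} {L : nat}.
Context {d : measure_display} {Omega : measurableType d}.
Variables (X : nat -> 'I_L -> {mfun Omega >-> R}) (P : probability Omega R).
Hypothesis indepX :
  mutually_independent P (fun i : nat * 'I_L => X i.1.+1 i.2 : Omega -> R).

(** A conditional drift inequality in integrated form, with [E] ranging over past events. The
    coefficients [F0], [F1], [F2] are known at time [n], and all terms of the bound are nonnegative,
    so its integral splits whether or not it is finite. *)
Lemma past_drift n l E (F0 F1 F2 U V : Omega -> R) (G1 G2 : R -> R) (k1 k2 : R) :
  <<s past X n >> E ->
  past_measurable X n F0 -> past_measurable X n F1 -> past_measurable X n F2 ->
  (forall w, 0 <= F0 w) -> (forall w, 0 <= F1 w) -> (forall w, 0 <= F2 w) ->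
  measurable_fun setT G1 -> measurable_fun setT G2 ->
  (forall y, 0 <= G1 y) -> (forall y, 0 <= G2 y) ->
  0 <= k1 -> 0 <= k2 ->
  (\int[P]_w (G1 (X n.+1 l w))%:E <= k1%:E)%E ->
  (\int[P]_w (G2 (X n.+1 l w))%:E <= k2%:E)%E ->
  measurable_fun setT U -> measurable_fun setT V -> (forall w, E w -> 0 <= U w) ->
  (forall w, E w -> U w <= F0 w + F1 w * G1 (X n.+1 l w) + F2 w * G2 (X n.+1 l w)) ->
  (forall w, E w -> F0 w + F1 w * k1 + F2 w * k2 + 1 <= V w) ->
  (\int[P]_(w in E) (U w)%:E + P E <= \int[P]_(w in E) (V w)%:E)%E.
Proof.
move=> pE pF0 pF1 pF2 F00 F10 F20 mG1 mG2 G10 G20 k10 k20 Gk1 Gk2 mU mV U0 UF FV.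
have mE : measurable E := g_past_measurable pE.
have mF0 : measurable_fun E F0 by apply: measurable_funTS; exact: past_measurableW pF0.
have mF1 : measurable_fun E F1 by apply: measurable_funTS; exact: past_measurableW pF1.
have mF2 : measurable_fun E F2 by apply: measurable_funTS; exact: past_measurableW pF2.
have mX1 : measurable_fun E (fun w => G1 (X n.+1 l w)).
  by apply: measurable_funTS; exact: (measurableT_comp mG1 (measurable_funPT _)).
have mX2 : measurable_fun E (fun w => G2 (X n.+1 l w)).
  by apply: measurable_funTS; exact: (measurableT_comp mG2 (measurable_funPT _)).
have i0 (F : Omega -> R) : (forall w, 0 <= F w) -> (0 <= \int[P]_(w in E) (F w)%:E)%E.
  by move=> F_ge0; apply: integral_ge0 => w _; rewrite lee_fin.
have mFG1 : measurable_fun E (fun w => F1 w * G1 (X n.+1 l w)).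
  exact: measurable_funM.
have mFG2 : measurable_fun E (fun w => F2 w * G2 (X n.+1 l w)).
  exact: measurable_funM.
apply: (@le_trans _ _ (\int[P]_(w in E)
    (F0 w + F1 w * G1 (X n.+1 l w) + F2 w * G2 (X n.+1 l w))%:E + P E)%E).
  rewrite leeD2r//; apply: ge0_le_integral => //.
  - by apply/measurable_EFinP; exact: measurable_funTS.
  - by apply/measurable_EFinP; do 2?apply: measurable_funD.
under eq_integral do rewrite 2!EFinD.
rewrite ge0_integralD//; last 4 first.
- by move=> w _; rewrite -EFinD lee_fin addr_ge0// mulr_ge0.
- by apply: emeasurable_funD; exact/measurable_EFinP.
- by move=> w _; rewrite lee_fin mulr_ge0.
- exact/measurable_EFinP.
rewrite ge0_integralD//; last 4 first.
- by move=> w _; rewrite lee_fin.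
- exact/measurable_EFinP.
- by move=> w _; rewrite lee_fin mulr_ge0.
- exact/measurable_EFinP.
rewrite (past_ge0_integralM indepX l pE pF1 F10 mG1 G10).
rewrite (past_ge0_integralM indepX l pE pF2 F20 mG2 G20).
apply: (@le_trans _ _ (\int[P]_(w in E) (F0 w)%:E +
    \int[P]_(w in E) (F1 w)%:E * k1%:E + \int[P]_(w in E) (F2 w)%:E * k2%:E + P E)%E).
  rewrite leeD2r// leeD//; last by rewrite lee_wpmul2l// i0.
  by rewrite leeD2l// lee_wpmul2l// i0.
have mulk (F : Omega -> R) (k : R) : measurable_fun E F -> (forall w, 0 <= F w) -> 0 <= k ->
    (\int[P]_(w in E) (F w)%:E * k%:E = \int[P]_(w in E) (F w * k)%:E)%E.
  move=> mF F_ge0 k_ge0; rewrite -ge0_integralZr//.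
  - exact/measurable_EFinP.
  - by move=> w _; rewrite lee_fin.
rewrite !mulk// -[X in (_ + X <= _)%E]mul1e -(integral_cst P mE 1%E).
have mFk (F : Omega -> R) (k : R) : measurable_fun E F ->
    measurable_fun E (fun w => (F w * k)%:E).
  by move=> mF; apply/measurable_EFinP; exact: measurable_funM.
rewrite -3?ge0_integralD//.
all: try (by move=> w _; rewrite ?lee_fin// -?EFinD ?lee_fin ?addr_ge0// mulr_ge0).
- apply: ge0_le_integral => //.
  + by move=> w _; rewrite -!EFinD lee_fin !addr_ge0// mulr_ge0.
  + by do 3!(apply: emeasurable_funD; last by [exact: mFk|exact: measurable_cst]);
      exact/measurable_EFinP.
  + by apply/measurable_EFinP; exact: measurable_funTS.
all: do ?(apply: emeasurable_funD; last by [exact: mFk|exact/measurable_EFinP]);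
  by [exact: mFk|exact/measurable_EFinP].
Qed.

End drift.

Section lyapunov.
Context {R : realType}.
Variables (mu h A c I rho : R).
Hypotheses (mu0 : 0 < mu) (h0 : 0 <= h) (A0 : 0 <= A) (c0 : 0 < c) (I0 : 0 < I).
Hypotheses (rho0 : 0 <= rho) (rho1 : rho < 1).

(** The most samples that can be skipped after an undershoot truncated at [- h]. *)
Definition max_skip : R := (Num.ceil (h / mu))%:~R.
(** The solution [B] of [(B + max_skip) * rho = B]; with this weight the potential does not increase
    in mean when a sample is taken. *)
Definition skip_weight : R := max_skip * rho / (1 - rho).

(* Bounds the expected number of samples still to be skipped by a statistic at
   level [w] that drifts upwards, [rho] being the mean of [exp (- llr / 2)]. *)
Definition skip_potential (w : R) : R :=
  if 0 <= w then skip_weight * expR (- w / 2)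
  else skip_weight + (Num.ceil (- w / mu))%:~R.

(** From a level of at most [A], an increment capped at [c] does not pass [A + c], so the minimum
    never cuts into the drift. *)
Definition lyapunov (w : R) : R :=
  (A + c - Num.min w (A + c)) / I + skip_potential w.

Lemma max_skip_ge0 : 0 <= max_skip.
Proof.
by rewrite /max_skip ler0z -(ceil0 R) le_ceil// divr_ge0// ltW.
Qed.

Lemma skip_weight_ge0 : 0 <= skip_weight.
Proof.
by rewrite divr_ge0 ?mulr_ge0 ?max_skip_ge0// subr_ge0 ltW.
Qed.

Lemma skip_potential_ge0 (w : R) : 0 <= skip_potential w.
Proof.
rewrite /skip_potential; case: ifPn => [w0|].
  by rewrite mulr_ge0 ?skip_weight_ge0 ?expR_ge0.
rewrite -ltNge => w0; rewrite addr_ge0 ?skip_weight_ge0//.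
by rewrite ler0z -(ceil0 R) le_ceil// divr_ge0 ?oppr_ge0// ltW.
Qed.

Lemma skip_potential_le (w : R) : - h <= w ->
  skip_potential w <= skip_weight + max_skip.
Proof.
move=> hw; rewrite /skip_potential; case: ifPn => [w0|].
  apply: (@le_trans _ _ skip_weight); last by rewrite lerDl max_skip_ge0.
  rewrite ler_piMr ?skip_weight_ge0// -[leRHS]expR0 ler_expR.
  by rewrite mulNr oppr_le0 divr_ge0.
move=> _; rewrite lerD2l /max_skip ler_int le_ceil//.
by rewrite ler_pM2r ?invr_gt0//; lra.
Qed.

Lemma lyapunov_ge0 (w : R) : 0 <= lyapunov w.
Proof.
rewrite addr_ge0 ?skip_potential_ge0// divr_ge0 ?(ltW I0)// subr_ge0.
by rewrite ge_min lexx orbT.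
Qed.

Lemma lyapunov_le (w : R) : - h <= w ->
  lyapunov w <= (A + c + h) / I + skip_weight + max_skip.
Proof.
move=> hw; rewrite -addrA lerD ?skip_potential_le//.
rewrite ler_pM2r ?invr_gt0// lerD2l lerNl le_min hw/=.
by move: h0 A0 c0; lra.
Qed.

(** While [w + mu < 0], a skip lowers the ceiling by at least 1; on reaching 0 the ceiling, at least
    1, disappears altogether. The first term does not increase. *)
Lemma lyapunov_skip (w : R) : w < 0 -> lyapunov (Num.min (w + mu) 0) + 1 <= lyapunov w.
Proof.
move=> w0; rewrite /lyapunov -addrA lerD//.
  rewrite ler_pM2r ?invr_gt0// lerD2l lerN2 le_min2//.
  by rewrite le_min (ltW w0) andbT lerDl ltW.
rewrite /skip_potential [in leRHS]leNgt w0/=.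
have [wmu|wmu] := ltP (w + mu) 0.
  rewrite [0 <= w + mu]leNgt wmu/= -addrA lerD2l.
  rewrite (_ : - (w + mu) / mu = - w / mu - 1); last first.
    by field; rewrite gt_eqF.
  rewrite -lerBrDr -[X in _ <= _ - X]/(1%:~R) -intrB ler_int ceil_le_int intrB lerD2r.
  exact: ceil_ge.
rewrite lexx oppr0 mul0r expR0 mulr1 lerD2l.
rewrite -[leLHS]/(1%:~R) ler_int -gtz0_ge1 ceil_gt0.
by rewrite divr_gt0// oppr_gt0.
Qed.

(** Ending below 0 costs at most [skip_weight + max_skip], and there [exp (- (w + y) / 2) >= 1], as
    in a Chernoff bound. Ending above 0, the same exponential is the one in the potential. *)
Lemma lyapunov_sample (w y : R) : 0 <= w <= A ->
  lyapunov (Num.max (w + y) (- h)) <=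
  (A - w) / I + (c - Num.min y c) / I +
  (skip_weight + max_skip) * expR (- w / 2) * expR (- y / 2).
Proof.
move=> /andP[w0 wA]; rewrite /lyapunov lerD//.
  rewrite -mulrDl ler_pM2r ?invr_gt0//.
  have : w + Num.min y c <= Num.min (Num.max (w + y) (- h)) (A + c).
    rewrite le_min le_max; apply/andP; split.
      by rewrite lerD2l ge_min lexx.
    by rewrite lerD// ge_min lexx orbT.
  lra.
rewrite -mulrA -expRD (_ : - w / 2 + - y / 2 = - (w + y) / 2); last by field.
have BK0 : 0 <= skip_weight + max_skip.
  by rewrite addr_ge0 ?skip_weight_ge0 ?max_skip_ge0.
have [wy0|wy0] := leP 0 (w + y).
  rewrite max_l; last by move: h0; lra.
  rewrite /skip_potential wy0 ler_wpM2r ?expR_ge0// lerDl.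
  exact: max_skip_ge0.
apply: (@le_trans _ _ (skip_weight + max_skip)).
  by rewrite skip_potential_le// le_max lexx orbT.
rewrite ler_peMr// -[leLHS]expR0 ler_expR; lra.
Qed.

(** The bound for a sampling step after averaging, with [c / I - 1] and [rho] in place of the two
    means; the equation solved by [skip_weight] closes it. *)
Lemma lyapunov_drift (w : R) : 0 <= w <= A ->
  (A - w) / I + (c / I - 1) + (skip_weight + max_skip) * expR (- w / 2) * rho + 1
    <= lyapunov w.
Proof.
move=> /andP[w0 wA]; rewrite /lyapunov /skip_potential w0.
rewrite min_l; last by move: c0; lra.
rewrite mulrAC (_ : (skip_weight + max_skip) * rho = skip_weight); last first.
  by rewrite /skip_weight; field; move: rho1; lra.
rewrite (_ : (A + c - w) / I = (A - w) / I + c / I); last first.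
  by rewrite -mulrDl; congr (_ / _); lra.
lra.
Qed.

Lemma measurable_lyapunov : measurable_fun setT lyapunov.
Proof.
apply: measurable_funD.
  apply: measurable_funM => //; apply: measurable_funB => //.
  exact: measurable_minr.
apply: measurable_fun_ifT.
- exact: measurable_fun_ler.
- apply: measurable_funM => //; apply: measurableT_comp => //.
  by apply: measurable_funM => //; exact: measurable_funN.
- apply: measurable_funD => //.
  apply: (@nonincreasing_measurable _ setT (fun x : R => (Num.ceil (- x / mu))%:~R)) => //.
  move=> x y xy; rewrite ler_int le_ceil// ler_pM2r ?invr_gt0// lerN2//.
Qed.

End lyapunov.

Section delay.
Context {R : realType} {L : nat}.
Context {d : measure_display} {Omega : measurableType d}.
Variables (f0 f1 : 'I_L -> R -> R) (X : nat -> 'I_L -> {mfun Omega >-> R}).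
Variables (mu h D : 'I_L -> R) (A : R) (P : probability Omega R).
Hypothesis mllr : forall l, measurable_fun setT (llr (f0 l) (f1 l)).
Hypothesis indepX :
  mutually_independent P (fun i : nat * 'I_L => X i.1.+1 i.2 : Omega -> R).
Variables (l : 'I_L) (g : nat) (c I rho : R).
Hypotheses (mu0 : 0 < mu l) (h0 : 0 <= h l) (D0 : 0 <= D l) (DA : D l <= A).
Hypotheses (g1 : (1 <= g)%N) (c0 : 0 < c) (I0 : 0 < I) (Ic : I <= c).
Hypotheses (rho0 : 0 <= rho) (rho1 : rho < 1).
Hypothesis drift : forall n, (g <= n.+1)%N ->
  (\int[P]_w (c - Num.min (llr (f0 l) (f1 l) (X n.+1 l w)) c)%:E <= (c - I)%:E)%E.
Hypothesis affinity : forall n, (g <= n.+1)%N ->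
  (\int[P]_w (expR (- llr (f0 l) (f1 l) (X n.+1 l w) / 2))%:E <= rho%:E)%E.

Let H l' : \bar R := (h l')%:E.
Let al := alive f0 f1 X mu H D A.
Let W n w : R := stat f0 f1 X mu H n l w.
Let Phi := lyapunov (mu l) (h l) A c I rho.
Let A0 : 0 <= A := le_trans D0 DA.

(** Bounds [lyapunov] at every level from [- h] up, hence whatever happened before the change; only
    the part [A / I] grows with the threshold. *)
Definition delay_bound : R :=
  (A + c + h l) / I + skip_weight (mu l) (h l) rho + max_skip (mu l) (h l).

Let W_ge n w : - h l <= W n w.
Proof.
rewrite /W /stat; elim: n => [|n IH] /=; first by rewrite oppr_le0.
case: ifPn => _; first by rewrite trunc_belowE le_max lexx orbT.
by rewrite le_min oppr_le0 h0 andbT (le_trans IH)// lerDl ltW.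
Qed.

(** A value above [D l] is transmitted and compared with [A]; any other is at most [D l <= A]. *)
Let W_le n w : al n w -> W n w <= A.
Proof.
case: n => [|n]; first by move=> _; exact: A0.
move=> /aliveP/(_ n.+1 (introT andP (conj isT (leqnn _))) l); rewrite YnE.
by case: ltP => // WD _; exact: le_trans WD DA.
Qed.

Let mW n : past_measurable X n (W n).
Proof. exact: past_measurable_stat. Qed.

Let mPhi : measurable_fun setT Phi.
Proof. exact: measurable_lyapunov. Qed.

Let delay_step n E : (g <= n.+1)%N -> <<s past X n >> E -> E `<=` al n ->
  (\int[P]_(w in E) (Phi (W n.+1 w))%:E + P E <=
   \int[P]_(w in E) (Phi (W n w))%:E)%E.
Proof.
move=> gn pE Eal.
pose S w := 0 <= W n w.
have mS : measurable_fun [set: g_sigma_algebraType (past X n)] S.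
  by apply: measurable_fun_ler; [exact: measurable_cst|exact: mW].
pose BK := skip_weight (mu l) (h l) rho + max_skip (mu l) (h l).
have BK0 : 0 <= BK.
  by rewrite addr_ge0 ?skip_weight_ge0 ?max_skip_ge0.
(* The maxima with 0 make the coefficient nonnegative everywhere. On [E] they are inactive: [W <= A]
   before an alarm, and [Phi] is at least 1 while samples are skipped. *)
pose F0 w := if S w then Num.max (A - W n w) 0 / I else Num.max (Phi (W n w) - 1) 0.
pose F1 w : R := if S w then 1 else 0.
pose F2 w := if S w then BK * expR (- W n w / 2) else 0.
pose Y y := llr (f0 l) (f1 l) y.
pose G1 y := (c - Num.min (Y y) c) / I.
pose G2 y := expR (- Y y / 2).
have mPW k : past_measurable X k (fun w => Phi (W k w)).
  by apply: (measurableT_comp mPhi); exact: mW.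
apply: (@past_drift _ _ _ _ X P indepX n l E F0 F1 F2 _ _ G1 G2 (c / I - 1) rho) => //.
- apply: measurable_fun_ifT => //.
    apply: measurable_funM => //; apply: measurable_maxr => //.
    by apply: measurable_funB => //; exact: mW.
  by apply: measurable_maxr => //; apply: measurable_funB => //; exact: mPW.
- exact: measurable_fun_ifT.
- apply: measurable_fun_ifT => //; apply: measurable_funM => //.
  apply: measurableT_comp => //; apply: measurable_funM => //.
  by apply: measurable_funN; exact: mW.
- move=> w; rewrite /F0; case: ifP => _; last by rewrite le_max lexx orbT.
  by rewrite divr_ge0 ?(ltW I0)// le_max lexx orbT.
- by move=> w; rewrite /F1; case: ifP.
- by move=> w; rewrite /F2; case: ifP => // _; rewrite mulr_ge0 ?expR_ge0.
- apply: measurable_funM => //; apply: measurable_funB => //.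
  by apply: measurable_minr => //; exact: mllr.
- apply: measurableT_comp => //; apply: measurable_funM => //.
  by apply: measurable_funN; exact: mllr.
- by move=> y; rewrite divr_ge0 ?(ltW I0)// subr_ge0 ge_min lexx orbT.
- by move=> y; exact: expR_ge0.
- by rewrite subr_ge0 ler_pdivlMr ?mul1r.
- rewrite (_ : c / I - 1 = (c - I) / I); last by field; rewrite gt_eqF.
  under eq_integral do rewrite /G1 EFinM.
  rewrite ge0_integralZr//.
  + by rewrite EFinM lee_wpmul2r ?lee_fin ?invr_ge0 ?(ltW I0)//; exact: drift.
  + apply/measurable_EFinP; apply: measurable_funB => //.
    apply: measurable_minr => //.
    exact: (measurableT_comp (mllr l) (measurable_funPT (X n.+1 l))).
  + by move=> w _; rewrite lee_fin subr_ge0 ge_min lexx orbT.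
  + by rewrite lee_fin invr_ge0 ltW.
- exact: affinity.
- by apply: (@past_measurableW _ _ _ _ X n.+1); exact: mPW.
- by apply: (@past_measurableW _ _ _ _ X n); exact: mPW.
- by move=> w _; exact: lyapunov_ge0.
- move=> w Ew; rewrite /F0 /F1 /F2 /S.
  have -> : W n.+1 w = if 0 <= W n w then trunc_below (H l) (W n w + Y (X n.+1 l w))
    else Num.min (W n w + mu l) 0 by [].
  case: ifPn => [W0|]; last first.
    rewrite -ltNge => W0; rewrite !mul0r !addr0 le_max lerBrDr.
    by rewrite lyapunov_skip.
  rewrite trunc_belowE mul1r [Num.max (A - _) 0]max_l; last first.
    by rewrite subr_ge0 W_le//; exact: Eal.
  by apply: lyapunov_sample => //; rewrite W0 W_le//; exact: Eal.
- move=> w Ew; rewrite /F0 /F1 /F2 /S.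
  case: ifPn => [W0|].
    rewrite max_l; last first.
    by rewrite subr_ge0 W_le//; exact: Eal.
    by rewrite mul1r; apply: lyapunov_drift => //; rewrite W0 W_le//; exact: Eal.
  rewrite -ltNge => W0; rewrite !mul0r !addr0.
  rewrite max_l ?subrK// subr_ge0.
  apply: le_trans (lyapunov_skip _ _ _ _ _ _ W0) => //.
  by rewrite lerDr lyapunov_ge0.
Qed.

Lemma integral_delay_le E : <<s past X g.-1 >> E ->
  (\int[P]_(w in E) maxe (tau f0 f1 X mu H D A w - (g%:R : R)%:E) 0 <=
   delay_bound%:E * P E)%E.
Proof.
move=> pE; have mE : measurable E := g_past_measurable pE.
rewrite integral_tau_sub//.
have pEal n : (g.-1 <= n)%N -> <<s past X n >> (E `&` al n).
  move=> gn; apply: (@measurableI _ (g_sigma_algebraType (past X n))).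
    exact: (sub_g_past gn).
  exact: past_alive.
have mEal n : measurable (E `&` al n) by apply: measurableI => //; exact: measurable_alive.
have mPW n B : measurable_fun B (fun w => (Phi (W n w))%:E).
  apply/measurable_EFinP; apply: measurable_funTS.
  by apply: (measurableT_comp mPhi); apply: (@past_measurableW _ _ _ _ X n); exact: mW.
(* The sum starts at [g.-1], the last time whose state is known from the past before the change; the
   step to [g] already uses a sample taken after it. The first term is dropped at the end. *)
have main m : (\sum_(g.-1 <= n < g.-1 + m) P (E `&` al n) +
    \int[P]_(w in E `&` al (g.-1 + m)%N) (Phi (W (g.-1 + m)%N w))%:E <=
    delay_bound%:E * P E)%E.
  elim: m => [|m IH].
    rewrite addn0 big_geq// add0e -integral_cst//.
    apply: (@le_trans _ _ (\int[P]_(w in E `&` al g.-1) delay_bound%:E)%E).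
      apply: ge0_le_integral => //.
      - by move=> w _; rewrite lee_fin lyapunov_ge0.
      - by move=> w _; rewrite lee_fin; exact: lyapunov_le.
    apply: ge0_subset_integral => //.
    by move=> w _; rewrite lee_fin; apply: le_trans (lyapunov_le _ _ _ _ _ _ _ (W_ge 0%N w));
      rewrite ?lyapunov_ge0.
  rewrite addnS big_nat_recr/= ?leq_addr//; apply: le_trans IH.
  rewrite -addeA leeD2l// addeC.
  have gm : (g <= (g.-1 + m).+1)%N by rewrite -addSn prednK// leq_addr.
  apply: le_trans (delay_step gm (pEal _ (leq_addr _ _)) (@subIsetr _ _ _)).
  rewrite leeD2r//; apply: ge0_subset_integral => //.
  - exact: (mPW (g.-1 + m).+1).
  - by move=> w _; rewrite lee_fin lyapunov_ge0.
  - by apply: setIS; apply: sub_alive; exact: leqnSn.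
apply: (@le_trans _ _ (\sum_(g.-1 <= n <oo) P (E `&` al n))%E).
  rewrite [leRHS](nneseries_split _ 1)// addn1 prednK// leeDr//.
  exact: sume_ge0.
apply: lime_le; first exact: is_cvg_nneseries.
near=> n; have gn : (g.-1 <= n)%N by near: n; exact: nbhs_infty_ge.
rewrite -(subnKC gn); apply: le_trans (main (n - g.-1)%N).
by rewrite leeDl// integral_ge0// => w _; rewrite lee_fin lyapunov_ge0.
Unshelve. all: by end_near. Qed.

End delay.

Section conditional_expectation.
Local Open Scope ereal_scope.
Context {R : realType} {d : measure_display} {T : measurableType d}.
Variables (P : probability T R) (S : set (set T)) (f : T -> \bar R).
Hypotheses (mS : S `<=` measurable) (mf : measurable_fun setT f).
Hypotheses (f0 : forall w, 0 <= f w) (intf : \int[P]_w f w < +oo).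

Let T' := g_sigma_algebraType S.
Let toT' (w : T) : T' := w.

Let sS : <<s S >> `<=` @measurable d T.
Proof. by apply: smallest_sub => //; exact: sigma_algebra_measurable. Qed.

Let mtoT' : measurable_fun setT toT'.
Proof. by move=> _ B mB; rewrite setTI; exact: sS. Qed.

Let toT'_mixin := isMeasurableFun.Build _ _ _ _ _ mtoT'.
Let toT'_mfun : {mfun T >-> T'} := HB.pack toT' toT'_mixin.
Let P' : probability T' R := distribution P toT'_mfun.

(** A finite measure on the sub-sigma-algebra; its derivative with respect to the restriction of [P]
    is a conditional expectation of [f]. *)
Definition density_on_sub (A : set (g_sigma_algebraType S)) : \bar R :=
  \int[P]_(w in A) f w.

Let nu0 : density_on_sub set0 = 0. Proof. exact: integral_set0. Qed.

Let nu_ge0 A : 0 <= density_on_sub A. Proof. exact: integral_ge0. Qed.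

Let nu_sigma : semi_sigma_additive density_on_sub.
Proof.
move=> F mF tF mUF.
apply: (semi_sigma_additive_nng_induced mf f0) => //.
- by move=> i; apply: sS; exact: (mF i).
- by apply: sS; exact: mUF.
Qed.

HB.instance Definition _ := isMeasure.Build _ _ _ density_on_sub
  nu0 nu_ge0 nu_sigma.

Let nu_fin : fin_num_fun density_on_sub.
Proof.
move=> A mA; rewrite ge0_fin_numE//.
apply: le_lt_trans intf; apply: ge0_subset_integral => //.
exact/sS.
Qed.

HB.instance Definition _ := @Measure_isFinite.Build _ _ _ density_on_sub nu_fin.

Lemma is_cond_exp_exists : exists g, is_cond_exp P <<s S >> f g.
Proof.
have dom : density_on_sub `<< P'.
  apply/null_content_dominatesP => A mA PA0.
  apply: null_set_integral => //.
  - by apply: sS; exact: mA.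
  - exact: measurable_funTS.
have [g [g0 gfin intg gE]] := radon_nikodym_sigma_finite dom.
exists g; split => //.
- move=> B mB; have := measurable_int _ intg measurableT B mB.
  by rewrite setTI.
- move=> A sA; have mg : measurable_fun (A : set T') g.
    have mgT := measurable_int _ intg.
    exact: measurable_funS mgT.
  transitivity (\int[P']_(x in (A : set T')) g x); last exact/esym/gE.
  by rewrite [RHS]ge0_integral_pushforward.
Qed.

Lemma cond_expP : is_cond_exp P <<s S >> f (cond_exp P <<s S >> f).
Proof. by rewrite /cond_exp; apply: xgetPex; exact: is_cond_exp_exists. Qed.

(** The set where a version is at least [C + 1 / (k + 1)] belongs to the sub-sigma-algebra, so the
    assumed bound applies to it and forces it to be null. *)
Lemma ess_sup_cond_exp_le (C : R) : 
  (forall A, <<s S >> A -> \int[P]_(w in A) f w <= C%:E * P A) ->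
  ess_sup P (cond_exp P <<s S >> f) <= C%:E.
Proof.
move=> fC; have [g0 mg gE] := cond_expP.
set g := cond_exp _ _ _ in g0 mg gE *.
have mgT : measurable_fun setT g.
  by move=> _ B mB; rewrite setTI; apply: sS; exact: mg.
apply/ess_supP.
have C0 : (0 <= C)%R.
  rewrite -lee_fin -[leRHS]mule1 -(probability_setT P).
  apply: le_trans (fC _ (@measurableT _ T')).
  exact: integral_ge0.
pose E k := g @^-1` [set y | (C + k.+1%:R^-1)%:E <= y].
have mE' k : <<s S >> (E k).
  apply: mg; rewrite (_ : [set _ | _] = `[(C + k.+1%:R^-1)%:E, +oo]%classic).
    exact: emeasurable_itv.
  by apply/seteqP; split => y /=; rewrite in_itv/= leey andbT.
have mE k : measurable (E k) by exact: sS.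
have PE0 k : P (E k) = 0.
  apply/eqP; rewrite eq_le measure_ge0 andbT leNgt; apply/negP => PE.
  have : (C + k.+1%:R^-1)%:E * P (E k) <= C%:E * P (E k).
    apply: le_trans (fC _ (mE' k)); rewrite -gE// -integral_cst//.
    apply: ge0_le_integral => //.
    - by move=> w _; rewrite lee_fin addr_ge0.
    - exact: measurable_funTS.
  rewrite lee_pmul2r//; last by rewrite fin_num_measure.
  by rewrite lee_fin gerDl leNgt invr_gt0 ltr0n.
apply: (@negligibleS _ _ _ P (\bigcup_k E k)).
  move=> w /= /negP; rewrite -ltNge => Cg.
  have [gy|gy] := eqVneq (g w) +oo.
    by exists 0%N => //; rewrite /E/= gy leey.
  have gfin : g w \is a fin_num by rewrite ge0_fin_numE// lt_neqAle gy leey.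
  move: Cg; rewrite -(fineK gfin) lte_fin -subr_gt0 => Cg.
  exists (Num.truncn (fine (g w) - C)^-1) => //.
  rewrite /E/= -(fineK gfin) lee_fin addrC -lerBrDr.
  by rewrite -[leRHS]invrK lef_pV2 ?posrE ?invr_gt0 ?ltr0n// ltW// truncnS_gt.
apply: negligible_bigcup => k; apply/negligibleP => //.
exact: PE0.
Qed.

End conditional_expectation.

Section detection_delay.
Context {R : realType} {L : nat}.
Context {d : measure_display} {Omega : measurableType d}.
Variables (f0 f1 : 'I_L -> R -> R) (X : nat -> 'I_L -> {mfun Omega >-> R}).
Variables (mu h D : 'I_L -> R) (A : R) (P : option nat -> probability Omega R).
Hypothesis mllr : forall l, measurable_fun setT (llr (f0 l) (f1 l)).
Hypothesis indepX : forall g, (1 <= g)%N -> mutually_independent (P (Some g))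
  (fun i : nat * 'I_L => X i.1.+1 i.2 : Omega -> R).
Variables (l : 'I_L) (c I rho : R).
Hypotheses (mu0 : 0 < mu l) (h0 : 0 <= h l) (D0 : 0 <= D l) (DA : D l <= A).
Hypotheses (c0 : 0 < c) (I0 : 0 < I) (Ic : I <= c).
Hypotheses (rho0 : 0 <= rho) (rho1 : rho < 1).
Hypothesis drift : forall g n, (1 <= g <= n.+1)%N ->
  (\int[P (Some g)]_w (c - Num.min (llr (f0 l) (f1 l) (X n.+1 l w)) c)%:E
     <= (c - I)%:E)%E.
Hypothesis affinity : forall g n, (1 <= g <= n.+1)%N ->
  (\int[P (Some g)]_w (expR (- llr (f0 l) (f1 l) (X n.+1 l w) / 2))%:E
     <= rho%:E)%E.

Let H l' : \bar R := (h l')%:E.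

(** Whether sample [k] is taken depends on the statistic at [k.-1], so the sampling decisions too
    are functions of the observations up to [n]. *)
Lemma information_past n :
  information f0 f1 X mu H n `<=` <<s past X n >>.
Proof.
apply: smallest_sub; first exact: smallest_sigma_algebra.
move=> E [k [l' [/andP[k1 kn]]]].
have sn : <<s past X n >> [set w | Sn f0 f1 X mu H k l' w].
  apply: (@past_setle _ _ _ _ X n (cst 0) (stat f0 f1 X mu H k.-1 l')).
    exact: measurable_cst.
  apply: (past_measurableS (m := k.-1)).
    by rewrite (leq_trans (leq_pred _) kn).
  exact: past_measurable_stat.
move=> [->//|[B mB ->]].
apply: (@measurableI _ (g_sigma_algebraType (past X n))) => //.
apply: sub_sigma_algebra; exists k, l'; rewrite k1 kn; split => //.
by exists B.
Qed.

Lemma WADD_le : (WADD f0 f1 X mu H D A P <= (delay_bound mu h A l c I rho)%:E)%E.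
Proof.
apply: ge_ereal_sup => _ [g g1 <-].
have bound E : <<s past X g.-1 >> E -> _ :=
  @integral_delay_le _ _ _ _ f0 f1 X mu h D A (P (Some g)) mllr (indepX g1)
    l g c I rho mu0 h0 D0 DA g1 c0 I0 Ic rho0 rho1
    (fun n gn => drift (introT andP (conj g1 gn)))
    (fun n gn => affinity (introT andP (conj g1 gn))) E.
have infoE : <<s information f0 f1 X mu H g.-1 >> = information f0 f1 X mu H g.-1.
  by apply: sigma_algebra_id; exact: smallest_sigma_algebra.
rewrite -infoE; apply: ess_sup_cond_exp_le.
- move=> E /information_past; exact: g_past_measurable.
- under eq_fun do rewrite tau_subE -nneseries_addn//.
  apply: (@ge0_emeasurable_sum _ _ _ setT
    (fun n w => (\1_(alive f0 f1 X mu H D A (n + g)) w)%:E)) => [n w _ _|n _].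
    by rewrite lee_fin.
  by apply/measurable_EFinP/measurable_indic; exact: measurable_alive.
- by move=> w; rewrite le_max lexx orbT.
- by apply: le_lt_trans (bound setT (@measurableT _ (g_sigma_algebraType _))) _;
    rewrite [X in (_ * X)%E](probability_setT (P (Some g))) mule1 ltry.
- by move=> E; rewrite infoE => iE; apply: bound; exact: (@information_past _ E iE).
Qed.

End detection_delay.

(** * Renewal-reward limits for convolutions *)

Section renewal_convolution.
Context {R : realType}.
Implicit Types u a b : R^nat.

Definition convolution u a (n : nat) : R := \sum_(k < n.+1) u k * a (n - k)%N.

Lemma sum_convolution u a n :
  \sum_(m < n) convolution u a m = \sum_(k < n) u k * series a (n - k)%N.
Proof.
elim: n => [|n IH]; first by rewrite !big_ord0.
rewrite big_ord_recr/= IH /convolution.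
have -> : \sum_(k < n) u k * series a (n - k)%N =
    \sum_(k < n.+1) u k * series a (n - k)%N.
  by rewrite big_ord_recr/= subnn /series/= big_geq// mulr0 addr0.
rewrite -big_split/=; apply: eq_bigr => k _.
rewrite -mulrDr; congr (_ * _).
by rewrite (subSn (leq_ord k)) /series/= big_nat_recr.
Qed.

(** The error is a sum of tails [alpha - series a j] with weights [u <= 1]; read backwards, it is at
    most the Cesaro mean of a null sequence. *)
Lemma mean_convolution_error u a (alpha : R) :
  (forall k, 0 <= u k <= 1) -> (forall k, 0 <= a k) ->
  series a @ \oo --> alpha ->
  (fun n => n.+1%:R^-1 * (alpha * \sum_(k < n.+1) u k -
     \sum_(m < n.+1) convolution u a m)) @ \oo --> (0 : R).
Proof.
move=> u01 a0 acvg.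
have nd : nondecreasing_seq (series a).
  by apply/nondecreasing_seqP => n; rewrite /series/= big_nat_recr//= lerDl.
have a_le n : series a n <= alpha.
  rewrite -(cvg_lim (@Rhausdorff R) acvg).
  by apply: nondecreasing_cvgn_le => //; apply/cvg_ex; exists alpha.
pose r n := alpha - series a n.+1.
have r0 : r @ \oo --> (0 : R).
  rewrite -(subrr alpha); apply: cvgB; first exact: cvg_cst.
  by rewrite (cvg_shiftS (series a)).
apply: (@squeeze_cvgr _ _ _ _ (cst 0) (arithmetic_mean r)).
- apply: nearW => n /=; apply/andP; split.
    rewrite mulr_ge0// ?invr_ge0// subr_ge0 sum_convolution mulr_sumr.
    apply: ler_sum => k _; rewrite [leRHS]mulrC ler_wpM2l//.
    by have /andP[] := u01 k.
  rewrite /arithmetic_mean/= ler_wpM2l ?invr_ge0//.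
  rewrite sum_convolution mulr_sumr -sumrB /series/= big_mkord.
  rewrite [leRHS](reindex_inj rev_ord_inj)/=.
  apply: ler_sum => k _; rewrite /r subSS.
  rewrite (mulrC alpha) -mulrBr (subSn (leq_ord k)).
  have /andP[u0 u1] := u01 k.
  by rewrite /series/= ler_piMl// subr_ge0; exact: a_le.
- exact: cvg_cst.
- exact: cesaro.
Qed.

(** For [b], whose convolution is constantly 1, the error estimate gives [1 / beta] as the limiting
    mean of [u]; for [a], it multiplies that mean by [alpha]. *)
Lemma renewal_reward u a b (alpha beta : R) :
  (forall k, 0 <= u k <= 1) -> (forall k, 0 <= a k) -> (forall k, 0 <= b k) ->
  series a @ \oo --> alpha -> series b @ \oo --> beta ->
  (forall n, convolution u b n = 1) ->
  (fun n => n.+1%:R^-1 * \sum_(m < n.+1) convolution u a m) @ \oo -->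
    alpha / beta.
Proof.
move=> u01 a0 b0 acvg bcvg ub1.
have beta0 : 0 < beta.
  (* At time 0 the convolution is the single product [u 0 * b 0], and it equals 1. *)
  have b00 : 0 < b 0%N.
    rewrite lt0r b0 andbT; apply/eqP => b00.
    have := ub1 0%N; rewrite /convolution big_ord1 subnn b00 mulr0 => /eqP.
    by rewrite eq_sym oner_eq0.
  apply: (lt_le_trans b00).
  have nd : nondecreasing_seq (series b).
    by apply/nondecreasing_seqP => n; rewrite /series/= big_nat_recr//= lerDl.
  rewrite -(cvg_lim (@Rhausdorff R) bcvg).
  apply: le_trans (nondecreasing_cvgn_le nd _ 1%N).
    by rewrite /series/= big_nat1.
  by apply/cvg_ex; exists beta.
have Ucvg : (fun n => n.+1%:R^-1 * \sum_(k < n.+1) u k) @ \oo --> beta^-1.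
  have -> : (fun n => n.+1%:R^-1 * \sum_(k < n.+1) u k) =
      (fun n => beta^-1 + beta^-1 * (n.+1%:R^-1 * (beta * \sum_(k < n.+1) u k -
         \sum_(m < n.+1) convolution u b m))).
    apply/funext => n.
    rewrite [X in _ - X](eq_bigr (fun=> 1)); last by move=> m _; exact: ub1.
    rewrite sumr_const card_ord.
    have := pnatr_eq0 R n.+1; move: (n.+1%:R) => N /negbT N0.
    by field; rewrite N0 gt_eqF.
  rewrite -[X in _ --> X]addr0 -[X in _ --> _ + X](mulr0 beta^-1).
  apply: cvgD; first exact: cvg_cst.
  apply: cvgMr; exact: mean_convolution_error.
have -> : (fun n => n.+1%:R^-1 * \sum_(m < n.+1) convolution u a m) =
    (fun n => alpha * (n.+1%:R^-1 * \sum_(k < n.+1) u k) -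
      n.+1%:R^-1 * (alpha * \sum_(k < n.+1) u k - \sum_(m < n.+1) convolution u a m)).
  by apply/funext => n; ring.
rewrite -[X in _ --> X]subr0; apply: cvgB; last exact: mean_convolution_error.
by apply: cvgMr.
Qed.

End renewal_convolution.

(** * Cycles along one path of one sensor *)

Section sensor_cycles.
Context {R : realType}.
Variables (f0 f1 : R -> R) (mu h : R).
Hypotheses (mu0 : 0 < mu) (h0 : 0 <= h).
Implicit Type x : nat -> R.

Local Notation W := (decusum f0 f1 mu h%:E).
Local Notation Y x n := (llr f0 f1 (x n)).
Local Notation Z := (llr_sum f0 f1).

Arguments decusum : simpl never.

(* A cycle starts at [n]. The second disjunct only happens if [h = 0], when an
   undershoot is truncated to [0] at once. *)
Definition regen x (n : nat) : bool :=
  if n is m.+1 then (W x n == 0) && ((W x m < 0) || (W x m + Y x n < 0))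
  else true.

Arguments regen : simpl never.

(** Time [n] still belongs to the cycle that started at 0. *)
Fixpoint fresh x (n : nat) : bool :=
  if n is m.+1 then fresh x m && ~~ regen x n else true.

Lemma decusumS x n : W x n.+1 =
  if 0 <= W x n then Num.max (W x n + Y x n.+1) (- h) else Num.min (W x n + mu) 0.
Proof. by rewrite -trunc_belowE. Qed.

Lemma regenS x n :
  regen x n.+1 = (W x n.+1 == 0) && ((W x n < 0) || (W x n + Y x n.+1 < 0)).
Proof. by []. Qed.

Lemma freshS x n : fresh x n.+1 = fresh x n && ~~ regen x n.+1.
Proof. by []. Qed.

Definition shift (k : nat) x : nat -> R := fun i => x (k + i)%N.

Lemma regen_decusum x k : regen x k -> W x k = 0.
Proof. by case: k => // k /andP[/eqP]. Qed.

Lemma decusum_shift x k j : regen x k -> W x (k + j) = W (shift k x) j.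
Proof.
move=> rk; elim: j => [|j IH]; first by rewrite addn0 (regen_decusum rk).
by rewrite addnS !decusumS -IH /shift addnS.
Qed.

Lemma regen_shift x k j : regen x k -> regen x (k + j.+1) = regen (shift k x) j.+1.
Proof.
move=> rk; by rewrite addnS /regen -addnS !decusum_shift// /shift addnS.
Qed.

(* Each time [n] lies in exactly one cycle. *)
Lemma cycle_decomposition (Q : pred R) x n :
  (Q (W x n))%:R = \sum_(k < n.+1)
    (regen x k && (fresh (shift k x) (n - k) && Q (W (shift k x) (n - k))))%:R :> R.
Proof.
transitivity ((Q (W x n))%:R *
    \sum_(k < n.+1) (regen x k && fresh (shift k x) (n - k))%:R : R); last first.
  rewrite mulr_sumr; apply: eq_bigr => k _.
  have [rk|] := boolP (regen x k); last by rewrite /= mulr0.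
  have kn : (k <= n)%N by rewrite -ltnS.
  rewrite -(decusum_shift _ rk) subnKC//=.
  by case: fresh; case: Q; rewrite ?mulr1 ?mulr0.
rewrite -[LHS]mulr1; congr (_ * _); apply/esym.
elim: n => [|n IH]; first by rewrite big_ord1/=.
rewrite big_ord_recr/= subnn andbT.
have -> : \sum_(k < n.+1) (regen x k && fresh (shift k x) (n.+1 - k))%:R =
    (~~ regen x n.+1)%:R * \sum_(k < n.+1)
      (regen x k && fresh (shift k x) (n - k))%:R :> R.
  rewrite mulr_sumr; apply: eq_bigr => k _.
  have [rk|] := boolP (regen x k); last by rewrite /= mulr0.
  have kn : (k <= n)%N by rewrite -ltnS.
  rewrite subSn// freshS/=.
  rewrite -regen_shift// addnS subnKC//.
  by case: fresh; case: regen; rewrite ?mulr1 ?mulr0 ?mul0r.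
by rewrite IH mulr1; case: regen; rewrite ?addr0 ?add0r.
Qed.

Definition ladder_open x (n : nat) : bool := ((n%:R : R)%:E < ladder_time f0 f1 x)%E.

Lemma ladder_openP x n : reflect (forall k, (1 <= k <= n)%N -> 0 <= Z x k)
  (ladder_open x n).
Proof.
rewrite /ladder_open /ladder_time lt_first_time.
by apply: (iffP (asboolP _)) => al k kn; have := al k kn; rewrite leNgt => /negP.
Qed.

Lemma llr_sumS x n : Z x n.+1 = Z x n + Y x n.+1.
Proof. by rewrite /llr_sum big_nat_recr. Qed.

Lemma ladder_openS x n : ladder_open x n.+1 = ladder_open x n && (0 <= Z x n.+1).
Proof.
apply/ladder_openP/andP => [al|[/ladder_openP al Z0] k /andP[k1]].
  split; last by apply: al; rewrite leqnn.
  by apply/ladder_openP => k /andP[k1 kn]; apply: al; rewrite k1 leqW.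
by rewrite leq_eqVlt => /predU1P[->//|kn]; apply: al; rewrite k1.
Qed.

Lemma ladder_open_fresh x n : ladder_open x n ->
  [/\ fresh x n, W x n = Z x n & 0 <= W x n].
Proof.
elim: n => [|n IH]; first by move=> _; rewrite /llr_sum big_geq.
rewrite ladder_openS => /andP[/IH[fr WZ W0] Z0].
have WE : W x n.+1 = Z x n.+1.
  by rewrite decusumS W0 WZ -llr_sumS max_l// (le_trans _ Z0)// oppr_le0.
split; rewrite ?WE//.
by rewrite freshS fr regenS WZ -llr_sumS [Z x n.+1 < 0]ltNge Z0 [Z x n < 0]ltNge -WZ W0 andbF.
Qed.

(** In its first cycle the statistic is the random walk up to the first negative value, and then
    stays below 0 until it reaches 0, which ends the cycle; for [h = 0] that happens at once. *)
Lemma fresh_sampled x n : fresh x n && (0 <= W x n) = ladder_open x n.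
Proof.
apply/andP/idP => [|/ladder_open_fresh[]//].
elim: n => [_|n IH []]; first by apply/ladder_openP => k; case: k.
rewrite freshS regenS => /andP[fr nr] W0.
rewrite ladder_openS; have [Wn|Wn] := leP 0 (W x n); last first.
  move: nr W0; rewrite Wn orTb andbT decusumS [0 <= W x n]leNgt Wn/= le_min lexx andbT.
  by move=> /eqP W1 W0; exfalso; apply: W1; rewrite min_r.
have lo := IH (conj fr Wn); have [_ WZ _] := ladder_open_fresh lo.
rewrite lo/= leNgt; apply/negP => Z0.
move: nr W0; rewrite decusumS Wn WZ -llr_sumS Z0 orbT andbT.
rewrite le_max [0 <= Z x n.+1]leNgt Z0/= => /eqP + hh.
apply; rewrite max_r; first by apply/eqP; rewrite eq_le hh oppr_le0 h0.
by rewrite (le_trans (ltW Z0)).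
Qed.

Lemma fresh_transmits (D : R) x n : 0 <= D ->
  fresh x n && (D < W x n) = ladder_open x n && (D < Z x n).
Proof.
move=> D0; apply/andP/andP => [[fr DW]|[lo DZ]].
  have lo : ladder_open x n.
    by rewrite -fresh_sampled fr (ltW (le_lt_trans D0 DW)).
  by have [_ <- _] := ladder_open_fresh lo.
by have [fr -> _] := ladder_open_fresh lo.
Qed.

Lemma sub_fresh x m n : (m <= n)%N -> fresh x n -> fresh x m.
Proof.
elim: n => [|n IH]; first by rewrite leqn0 => /eqP ->.
rewrite leq_eqVlt => /predU1P[->//|]; rewrite ltnS => mn.
by rewrite freshS => /andP[/(IH mn)].
Qed.

Lemma ladder_height_le0 x : ladder_height f0 f1 x <= 0.
Proof.
rewrite /ladder_height /ladder_time.
have [[m [_ Zm _ ->]]|[_ ->]] := @first_time_cases R (fun n => Z x n < 0).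
  by rewrite /= natrK ltW.
by rewrite /= truncn0 /llr_sum big_geq.
Qed.

Let skip x : nat := `|Num.ceil (`|trunc_below h%:E (ladder_height f0 f1 x)| / mu)|%N.

Lemma skip_timeE x : skip_time f0 f1 mu h%:E x = (skip x)%:R.
Proof.
rewrite /skip_time /skip natr_absz [in RHS]ger0_norm//.
by rewrite -(ceil0 R) le_ceil// divr_ge0// ltW.
Qed.

(** At the ladder time [m] the statistic is [- v] and from there rises by [mu] per skipped sample;
    it reaches 0 after [ceil (v / mu)] of them, which ends the cycle. *)
Lemma fresh_ladder_time x m n : ladder_time f0 f1 x = (m%:R : R)%:E ->
  fresh x n = (n < m + skip x)%N.
Proof.
move=> mE.
have lo_lt k : ladder_open x k = (k < m)%N by rewrite /ladder_open mE lte_fin ltr_nat.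
have hE : ladder_height f0 f1 x = Z x m.
  by rewrite /ladder_height mE/= natrK.
have [m1 Zm] : (1 <= m)%N /\ Z x m < 0.
  have [[m' [m1' Qm' _ ]]|[_]] := @first_time_cases R (fun n => Z x n < 0).
    by rewrite -/(ladder_time f0 f1 x) mE => -[/eqP]; rewrite eqr_nat => /eqP ->.
  by rewrite -/(ladder_time f0 f1 x) mE.
have lom : ladder_open x m.-1 by rewrite lo_lt prednK.
have [fr WZ W0] := ladder_open_fresh lom.
pose v := - Num.max (Z x m) (- h).
have v0 : 0 <= v by rewrite oppr_ge0 ge_max (ltW Zm) oppr_le0.
have Wm : W x m = - v.
  by rewrite -(prednK m1) decusumS W0 WZ -llr_sumS prednK// opprK.
have sE : skip x = `|Num.ceil (v / mu)|%N.
  by rewrite /skip hE trunc_belowE -(opprK (Num.max _ _)) -/v normrN ger0_norm.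
have ltskip i : (i < skip x)%N = (i%:R * mu < v).
  have c0 : 0 <= Num.ceil (v / mu).
    by rewrite -(ceil0 R) le_ceil// divr_ge0// ltW.
  by rewrite sE -ltz_nat gez0_abs// ceil_gt_int -ltr_pdivlMr.
have steps i : (i <= skip x)%N -> W x (m + i) = Num.min (- v + i%:R * mu) 0 /\
    ((i < skip x)%N -> fresh x (m + i)).
  elim: i => [_|i IH iS].
    rewrite addn0 mul0r addr0 Wm min_l ?oppr_le0//; split => //.
    rewrite ltskip mul0r => vp; rewrite -(prednK m1) freshS fr regenS prednK//.
    by rewrite Wm oppr_eq0 (gt_eqF vp).
  have [Wi /(_ iS) fri] := IH (ltnW iS).
  have ip : i%:R * mu < v by rewrite -ltskip.
  have Wi0 : W x (m + i) = - v + i%:R * mu by rewrite Wi min_l//; lra.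
  have WS : W x (m + i.+1) = Num.min (- v + i.+1%:R * mu) 0.
    rewrite addnS decusumS Wi0 ifF; last by apply/negbTE; rewrite -ltNge; lra.
    by rewrite -natr1 mulrDl mul1r addrA.
  split => //; rewrite ltskip => ip'.
  rewrite addnS freshS fri regenS -addnS WS min_l; last by lra.
  by rewrite lt_eqF//; lra.
(* If nothing is skipped then [v = 0], and the cycle ends at [m] itself through the second disjunct
   of [regen]. Otherwise the last skip leads from below 0 to 0. *)
have stop : ~~ fresh x (m + skip x).
  have [s0|s0] := posnP (skip x).
    have v00 : v = 0.
      by apply/eqP; have := ltskip 0%N; rewrite s0 mul0r eq_le v0 andbT leNgt => <-.
    rewrite s0 addn0 -(prednK m1) freshS fr regenS prednK// Wm v00 oppr0 eqxx.
    by rewrite WZ -[X in Y x X](prednK m1) -llr_sumS prednK// Zm orbT.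
  have sP : (skip x).-1.+1 = skip x by rewrite prednK.
  have [Ws frs] := steps (skip x).-1 (leq_pred _).
  have [WS _] := steps _ (leqnn (skip x)).
  have ip : (skip x).-1%:R * mu < v by rewrite -ltskip sP.
  have ip' : ~~ ((skip x)%:R * mu < v) by rewrite -ltskip ltnn.
  rewrite -{1}sP addnS freshS regenS -addnS sP WS min_r; last first.
    by move: ip'; rewrite -leNgt; lra.
  have Wlt : W x (m + (skip x).-1) < 0 by rewrite Ws gt_min; apply/orP; left; lra.
  by rewrite eqxx Wlt/= andbF.
have [nlt|nge] := ltnP n (m + skip x).
  have [nm|mn] := ltnP n m.
    by apply: sub_fresh fr; rewrite -ltnS prednK.
  rewrite -(subnKC mn); have [|_] := steps (n - m)%N.
    by rewrite leq_subLR ltnW.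
  by apply; rewrite ltn_subLR.
by apply/negbTE; apply: contra stop; exact: sub_fresh.
Qed.

Lemma ladder_time_series x :
  (\sum_(0 <= n <oo) ((ladder_open x n)%:R : R)%:E = ladder_time f0 f1 x)%E.
Proof. by rewrite /ladder_time [RHS]first_timeE. Qed.

Lemma fresh_series x : (\sum_(0 <= n <oo) ((fresh x n)%:R : R)%:E =
  ladder_time f0 f1 x + (skip_time f0 f1 mu h%:E x)%:E)%E.
Proof.
have [[m [_ _ _ mE]]|[nZ ooE]] := @first_time_cases R (fun n => Z x n < 0).
  under eq_eseriesr do rewrite (fresh_ladder_time _ mE).
  by rewrite nneseries_ind_lt// subr0 skip_timeE natrD EFinD -mE.
(* If the walk is never negative, the cycle never ends: both sides are infinite, and the finite
   default value of [skip_time] is absorbed. *)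
rewrite -ladder_time_series; have lo n : ladder_open x n.
  by apply/ladder_openP => k /andP[k1 _]; rewrite leNgt; apply/negP; exact: nZ.
rewrite (eq_eseriesr (g := fun n => ((ladder_open x n)%:R)%:E)); last first.
  by move=> n _; have [-> _ _] := ladder_open_fresh (lo n); rewrite lo.
by rewrite ladder_time_series /ladder_time ooE addye.
Qed.

End sensor_cycles.

Section boolean_events.
Context {R : realType} {d : measure_display} {T : measurableType d}.

Lemma measurable_bool_set (b : T -> bool) : measurable_fun setT b ->
  measurable [set w | b w].
Proof.
move=> mb; have mB : measurable [set true] by [].
by have := mb measurableT _ mB; rewrite setTI.
Qed.

Lemma probability_bool (P : probability T R) (b : T -> bool) :
  measurable_fun setT b ->
  P [set w | b w] = (\int[P]_w ((b w)%:R : R)%:E)%E.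
Proof.
move=> mb; rewrite -[in LHS](setIT [set w | b w]).
rewrite -integral_indic//; last exact: measurable_bool_set.
apply: eq_integral => w _; rewrite indicE; congr (nat_of_bool _)%:R%:E.
by apply/idP/idP; rewrite inE.
Qed.

Variables (f0 f1 : R -> R) (mu h : R).
Hypothesis mllr : measurable_fun setT (llr f0 f1).
Variable xs : nat -> T -> R.

Lemma measurable_regen n :
  (forall k, (1 <= k <= n)%N -> measurable_fun setT (xs k)) ->
  measurable_fun setT (fun w => regen f0 f1 mu h (xs ^~ w) n).
Proof.
case: n => [|n] mxs; first exact: measurable_cst.
have mW k : (k <= n.+1)%N ->
    measurable_fun setT (fun w => decusum f0 f1 mu h%:E (xs ^~ w) k).
  move=> kn; apply: measurable_decusum => // i /andP[i1 ik].
  by apply: mxs; rewrite i1 (leq_trans ik).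
have mY : measurable_fun setT (fun w => llr f0 f1 (xs n.+1 w)).
  by apply: measurableT_comp => //; apply: mxs; rewrite leqnn.
rewrite (_ : (fun w => _) = fun w =>
  (decusum f0 f1 mu h%:E (xs ^~ w) n.+1 == 0) &&
   ((decusum f0 f1 mu h%:E (xs ^~ w) n < 0) ||
    (decusum f0 f1 mu h%:E (xs ^~ w) n + llr f0 f1 (xs n.+1 w) < 0)))//.
apply: measurable_and.
  by apply: measurable_fun_eqr; [exact: mW|exact: measurable_cst].
apply: measurable_or.
  by apply: measurable_fun_ltr; [exact: mW|exact: measurable_cst].
by apply: measurable_fun_ltr; [apply: measurable_funD => //; exact: mW|].
Qed.

Lemma measurable_fresh n :
  (forall k, (1 <= k <= n)%N -> measurable_fun setT (xs k)) ->
  measurable_fun setT (fun w => fresh f0 f1 mu h (xs ^~ w) n).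
Proof.
elim: n => [|n IH] mxs; first exact: measurable_cst.
apply: measurable_and.
  by apply: IH => k /andP[k1 kn]; apply: mxs; rewrite k1 leqW.
by apply: measurable_neg; exact: measurable_regen.
Qed.

Lemma measurable_ladder_open n :
  (forall k, (1 <= k <= n)%N -> measurable_fun setT (xs k)) ->
  measurable_fun setT (fun w => ladder_open f0 f1 (xs ^~ w) n).
Proof.
elim: n => [|n IH] mxs.
  rewrite (_ : (fun w => _) = cst true); first exact: measurable_cst.
  by apply/funext => w; apply/ladder_openP => k; case: k.
under eq_fun do rewrite ladder_openS.
apply: measurable_and.
  by apply: IH => k /andP[k1 kn]; apply: mxs; rewrite k1 leqW.
by apply: measurable_fun_ler => //; exact: measurable_llr_sum.
Qed.

End boolean_events.

(** * The law of a shifted path *)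

Section cylinders.
Context {R : realType}.

(* The coordinate [0] is left out: a path [shift k x] is to be independent of
   [x 1, ..., x k]. *)
Definition cylinders : set (set (nat -> R)) :=
  [set A | exists n B, [/\ (1 <= n)%N, measurable B & A = [set x | B (x n)]]].

Lemma measurable_coordinate n : (1 <= n)%N ->
  measurable_fun [set: g_sigma_algebraType cylinders]
    (fun x : g_sigma_algebraType cylinders => x n : R).
Proof.
move=> n1 _ B mB; rewrite setTI; apply: sub_sigma_algebra.
by exists n, B.
Qed.

(** Unlike the cylinders over a single coordinate, boxes are closed under intersection, so two
    measures can be compared on them. *)
Definition boxes : set (set (nat -> R)) :=
  [set A | exists m B, (forall i, measurable (B i)) /\
     A = [set x | forall i, (1 <= i <= m)%N -> B i (x i)]].

Lemma boxesI : setI_closed boxes.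
Proof.
move=> _ _ [m [B [mB ->]]] [n [C [mC ->]]].
exists (maxn m n), (fun i => (if (i <= m)%N then B i else setT) `&`
  (if (i <= n)%N then C i else setT)); split.
  by move=> i; apply: measurableI; case: ifP.
apply/seteqP; split => [x [Bx Cx] i /andP[i1 _]|x BCx].
  by split; case: ifPn => // im; [apply: Bx|apply: Cx]; rewrite i1.
split => i /andP[i1 im].
  by have [] := BCx i; rewrite ?i1 ?leq_max ?im.
by have [] := BCx i; rewrite ?i1 ?leq_max ?im ?orbT.
Qed.

Lemma boxes_cylinders : boxes `<=` <<s cylinders >>.
Proof.
move=> _ [m [B [mB ->]]].
rewrite (_ : [set x | _] = \bigcap_(i in [set i | (1 <= i <= m)%N])
    [set x | B i (x i)]); last by [].
apply: (@bigcap_measurableType _ (g_sigma_algebraType cylinders)) => i /andP[i1 _].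
by apply: sub_sigma_algebra; exists i, (B i).
Qed.

Lemma cylinders_boxes : <<s cylinders >> `<=` <<s boxes >>.
Proof.
apply: sub_smallest2r; first exact: smallest_sigma_algebra.
move=> _ [n [B [n1 mB ->]]].
exists n, (fun i => if i == n then B else setT); split.
  by move=> i; case: ifP.
apply/seteqP; split => x /= Bx => [i /andP[_ _]|].
  by case: eqP => // ->.
by have := Bx n; rewrite eqxx n1 leqnn; exact.
Qed.

End cylinders.

Section shifted_law.
Context {R : realType} {L : nat}.
Context {d : measure_display} {Omega : measurableType d}.
Variables (X : nat -> 'I_L -> {mfun Omega >-> R}) (P : probability Omega R).
Hypothesis indepX :
  mutually_independent P (fun i : nat * 'I_L => X i.1.+1 i.2 : Omega -> R).
Variable l : 'I_L.
Hypothesis statX : forall n (B : set R), measurable B ->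
  P (X n.+1 l @^-1` B) = P (X 1 l @^-1` B).

Let seqT := g_sigma_algebraType (@cylinders R).
Let path k (w : Omega) : seqT := shift k (obs X l w).

Let mpath k : measurable_fun setT (path k).
Proof.
apply: (@measurability _ _ Omega seqT setT (path k) (@cylinders R)) => //.
move=> _ [_ [n [B [n1 mB ->]]] <-].
rewrite setTI; rewrite -[X in measurable X]setTI.
exact: (measurable_funPT (X (k + n)%N l)).
Qed.

Let box k m (B : nat -> set R) : set Omega :=
  [set w | forall i, (1 <= i <= m)%N -> B i (X (k + i)%N l w)].

Let boxS k m B : box k m.+1 B = box k m B `&` X (k + m).+1 l @^-1` B m.+1.
Proof.
apply/seteqP; split => [w Bw|w [Bw BS] i /andP[i1]].
  split; last by rewrite /= -addnS; apply: Bw; rewrite leqnn.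
  by move=> i /andP[i1 im]; apply: Bw; rewrite i1 leqW.
rewrite leq_eqVlt => /predU1P[->|]; first by rewrite addnS.
by rewrite ltnS => im; apply: Bw; rewrite i1.
Qed.

Let past_box k m B : (forall i, measurable (B i)) ->
  <<s past X (k + m) >> (box k m B).
Proof.
move=> mB; rewrite (_ : box k m B = \bigcap_(i in [set i | (1 <= i <= m)%N])
    (X (k + i)%N l @^-1` B i)); last by [].
apply: (@bigcap_measurableType _ (g_sigma_algebraType (past X (k + m)))).
move=> i /andP[i1 im]; apply: sub_sigma_algebra.
exists (k + i)%N, l; split; last by exists (B i).
by rewrite (leq_trans i1 (leq_addl _ _)) leq_add2l.
Qed.

(** Induction on the last coordinate: the shorter box and [E] both lie in the past of that
    observation, whose law does not depend on time. *)
Let box_law k m B E : (forall i, measurable (B i)) -> <<s past X k >> E ->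
  (P (box k m B `&` E) = P E * \prod_(i < m) P (X 1 l @^-1` B i.+1))%E.
Proof.
move=> mB pE; elim: m => [|m IH].
  rewrite big_ord0 mule1; congr (P _); apply/seteqP; split => [w []//|w Ew].
  by split => // i; case: i.
rewrite boxS setIAC past_indep//.
  by rewrite IH statX// big_ord_recr/= muleA.
apply: (@measurableI _ (g_sigma_algebraType (past X (k + m)))).
  exact: past_box.
exact: (sub_g_past (leq_addr m k)).
Qed.

Let path_indep k E G : <<s past X k >> E -> <<s @cylinders R >> G ->
  P (path k @^-1` G `&` E) = (P (path k @^-1` G) * P E)%E.
Proof.
move=> pE cG; have mE : measurable E := g_past_measurable pE.
apply: (@indep_g_sigma_algebra _ _ _ P
  [set A | exists m B, (forall i, measurable (B i)) /\ A = box k m B]) => //.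
- move=> _ [m [B [mB ->]]].
  by apply: (@g_past_measurable _ _ _ _ X (k + m)); exact: past_box.
- move=> A1 A2 [m1 [B1 [mB1 E1]]] [m2 [B2 [mB2 E2]]].
  have [m [B [mB]]] := @boxesI R _ _
    (ex_intro _ m1 (ex_intro _ B1 (conj mB1 erefl)))
    (ex_intro _ m2 (ex_intro _ B2 (conj mB2 erefl))).
  move=> BE; exists m, B; split => //.
  by rewrite E1 E2; have := congr1 (fun A => path k @^-1` A) BE.
- exists 0%N, (fun=> setT); split => //.
  by apply/seteqP; split.
- move=> _ [m [B [mB ->]]]; rewrite box_law//.
  have := @box_law k m B setT mB (@measurableT _ (g_sigma_algebraType _)).
  by rewrite setIT [X in (X * _)%E](probability_setT P) mul1e muleC => ->.
- have : preimage_set_system setT (path k) (@boxes R).-sigma.-measurable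
      (path k @^-1` G).
    by exists G; [exact: cylinders_boxes|rewrite setTI].
  rewrite -g_sigma_preimageE; apply: sub_smallest2r.
    exact: smallest_sigma_algebra.
  by move=> _ [_ [m [B [mB ->]]] <-]; rewrite setTI; exists m, B.
Qed.

Let path_mixin k := isMeasurableFun.Build _ _ _ _ _ (@mpath k).
Let path_mfun k : {mfun Omega >-> seqT} := HB.pack (path k) (path_mixin k).

Let path_law k G : <<s @cylinders R >> G ->
  P (path k @^-1` G) = P (path 0 @^-1` G).
Proof.
move=> cG.
have setT_box : boxes [set: nat -> R].
  by exists 0%N, (fun=> setT); split => //; apply/seteqP; split.
have cov : \bigcup_(k in [set: nat]) (fun=> [set: seqT]) k = setT.
  by apply/seteqP; split => // x _; exists 0%N.
apply: (@g_sigma_algebra_measure_unique _ R seqT (@boxes R) _ _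
  (fun=> setT_box) cov (distribution P (path_mfun k))
  (distribution P (path_mfun 0))) => //.
- exact: boxes_cylinders.
- exact: boxesI.
- move=> _ [m [B [mB ->]]].
  have bl i := @box_law i m B setT mB (@measurableT _ (g_sigma_algebraType _)).
  have := etrans (bl k) (esym (bl 0%N)).
  by rewrite !setIT.
- move=> _; rewrite [ltLHS](probability_setT P) ltry//.
- exact: cylinders_boxes.
Qed.

(** Regeneration at a fixed time: on boxes, the path after [k] is independent of the past and has
    the product law of the original path; both facts extend to the generated sigma-algebra. *)
Lemma shifted_path_law k E G : <<s past X k >> E -> <<s @cylinders R >> G ->
  P (E `&` [set w | G (shift k (obs X l w))]) =
  (P E * P [set w | G (obs X l w)])%E.
Proof.
move=> pE cG; rewrite setIC.
rewrite [LHS](path_indep pE cG) (path_law k cG) muleC; congr (_ * P _)%E.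
Qed.

End shifted_law.

Section ereal_series.
Context {R : realType}.

Lemma cvg_series_fine (p : nat -> \bar R) (r : R) :
  (forall n, 0 <= p n)%E -> (forall n, p n \is a fin_num) ->
  (\sum_(0 <= n <oo) p n = r%:E)%E -> series (fine \o p) @ \oo --> r.
Proof.
move=> p0 pfin pr.
have : (\sum_(0 <= k < n) p k)%E @[n --> \oo] --> r%:E.
  by rewrite -pr; apply: is_cvg_nneseries.
move/fine_cvg; apply: cvg_trans; apply: near_eq_cvg.
by apply: nearW => n; rewrite /series/= sum_fine.
Qed.

Lemma measurable_bool_EFin {d : measure_display} {T : measurableType d}
    (b : T -> bool) : measurable_fun setT b ->
  measurable_fun setT (fun w => ((b w)%:R : R)%:E).
Proof.
move=> mb; rewrite (_ : (fun w => _) = fun w => if b w then 1%E else 0%E).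
  exact: measurable_fun_ifT.
by apply/funext => w; case: (b w).
Qed.

Lemma integral_sum_bool {d : measure_display} {Omega : measurableType d}
    (P : probability Omega R) (b : nat -> Omega -> bool) (m n : nat) :
  (forall k, measurable_fun setT (b k)) ->
  (\int[P]_w (\sum_(m <= k < n) (b k w)%:R)%:E =
   (\sum_(m <= k < n) fine (P [set w | b k w]))%:E)%E.
Proof.
move=> mb; under eq_integral do rewrite -sumEFin.
rewrite ge0_integral_sum//; last first.
  by move=> k; exact: measurable_bool_EFin.
rewrite -sumEFin; apply: eq_bigr => k _.
rewrite -probability_bool// fineK// fin_num_measure//.
exact: measurable_bool_set.
Qed.

Lemma limf_esup_le {T : choiceType} {X : filteredType T} (f : X -> \bar R)
    (F : set_system X) (c : \bar R) :
  (\forall x \near F, f x <= c)%E -> (limf_esup f F <= c)%E.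
Proof.
move=> Fc; rewrite /limf_esup.
apply: (@le_trans _ _ (ereal_sup (f @` [set x | f x <= c]%E))).
  by apply: ereal_inf_lbound; exists [set x | f x <= c]%E.
by apply: ge_ereal_sup => _ [x xc <-].
Qed.

Lemma limn_esup_EFin (v : R^nat) (a : R) : v @ \oo --> a ->
  limn_esup (EFin \o v) = a%:E.
Proof.
move=> va; have vaE : (EFin \o v) @ \oo --> a%:E by apply: cvg_EFin => //; exact: nearW.
by rewrite is_cvg_limn_esupE; [exact: cvg_lim|apply/cvg_ex; exists a%:E].
Qed.

End ereal_series.

(** * Sampling and transmission frequencies for finite [h] *)

Section duty_cycle.
Context {R : realType} {L : nat}.
Context {d : measure_display} {Omega : measurableType d}.
Variables (f0 f1 : 'I_L -> R -> R) (X : nat -> 'I_L -> {mfun Omega >-> R}).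
Variables (mu h D : 'I_L -> R) (PP : option nat -> probability Omega R).
Local Notation P := (PP None).
Hypothesis mllr : forall l, measurable_fun setT (llr (f0 l) (f1 l)).
Hypothesis indepX :
  mutually_independent P (fun i : nat * 'I_L => X i.1.+1 i.2 : Omega -> R).
Variables (l : 'I_L) (rho : R).
Hypothesis statX : forall n (B : set R), measurable B ->
  P (X n.+1 l @^-1` B) = P (X 1 l @^-1` B).
Hypotheses (mu0 : 0 < mu l) (h0 : 0 <= h l) (D0 : 0 <= D l).
Hypotheses (rho0 : 0 <= rho) (rho1 : rho < 1).
Hypothesis affinity : forall n,
  (\int[P]_w (expR (llr (f0 l) (f1 l) (X n.+1 l w) / 2))%:E <= rho%:E)%E.

Let H l' : \bar R := (h l')%:E.
Let seqT := g_sigma_algebraType (@cylinders R).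
Let W x n := decusum (f0 l) (f1 l) (mu l) (h l)%:E x n.
Let rg x n := regen (f0 l) (f1 l) (mu l) (h l) x n.
Let fr x n := fresh (f0 l) (f1 l) (mu l) (h l) x n.
Let lo x n := ladder_open (f0 l) (f1 l) x n.
Let x_ w := obs X l w.

Let mcoord n k : (1 <= k <= n)%N ->
  measurable_fun [set: seqT] (fun x : seqT => x k : R).
Proof. by move=> /andP[k1 _]; exact: measurable_coordinate. Qed.

Let mrg n : measurable_fun setT (fun w => rg (x_ w) n).
Proof. exact: (@measurable_regen _ _ _ _ _ _ _ (mllr l) (fun k w => x_ w k)). Qed.

Let mfr n : measurable_fun setT (fun w => fr (x_ w) n).
Proof. exact: (@measurable_fresh _ _ _ _ _ _ _ (mllr l) (fun k w => x_ w k)). Qed.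

Let mlo n : measurable_fun setT (fun w => lo (x_ w) n).
Proof. exact: (@measurable_ladder_open _ _ _ _ _ (mllr l) (fun k w => x_ w k)). Qed.

Let mW n : measurable_fun setT (fun w => W (x_ w) n).
Proof. exact: (@measurable_decusum _ _ _ _ _ _ _ (mllr l) (fun k w => x_ w k)). Qed.

Let past_rg n : <<s past X n >> [set w | rg (x_ w) n].
Proof.
apply: (@measurable_bool_set _ (g_sigma_algebraType (past X n))).
apply: (@measurable_regen _ _ (g_sigma_algebraType (past X n)) _ _ _ _ (mllr l)
  (fun k => X k l)).
by move=> k; exact: past_measurable_obs.
Qed.

(** The renewal sequence of the cycles. *)
Let u k : R := fine (P [set w | rg (x_ w) k]).

Section predicate.
Variable Q : R -> bool.
Hypothesis mQ : measurable_fun setT Q.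

Definition cycle_prob (j : nat) : R :=
  fine (P [set w | fresh (f0 l) (f1 l) (mu l) (h l) (obs X l w) j &&
    Q (decusum (f0 l) (f1 l) (mu l) (h l)%:E (obs X l w) j)]).

Let mfQ j : measurable_fun setT (fun w => fr (x_ w) j && Q (W (x_ w) j)).
Proof. by apply: measurable_and => //; apply: measurableT_comp => //; exact: mW. Qed.

Let cyl_fQ j : <<s @cylinders R >> [set x | fr x j && Q (W x j)].
Proof.
apply: (@measurable_bool_set _ seqT); apply: measurable_and.
  by apply: (@measurable_fresh _ _ _ _ _ _ _ (mllr l) (fun k (x : seqT) => x k));
    exact: mcoord.
apply: measurableT_comp => //.
by apply: (@measurable_decusum _ _ _ _ _ _ _ (mllr l) (fun k (x : seqT) => x k));
  exact: mcoord.
Qed.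

(** Split by the start [k] of the cycle that contains [n]: the start is an event of the past up to
    [k], and what happens inside the cycle is an event of the shifted path. *)
Lemma decusum_convolution n :
  fine (P [set w | Q (decusum (f0 l) (f1 l) (mu l) (h l)%:E (obs X l w) n)]) =
  convolution u cycle_prob n.
Proof.
apply: EFin_inj; rewrite fineK; last first.
  apply: fin_num_measure; apply: measurable_bool_set.
  by apply: measurableT_comp => //; exact: mW.
rewrite probability_bool; last by apply: measurableT_comp => //; exact: mW.
under eq_integral do rewrite (cycle_decomposition _ _ _ _ Q) -sumEFin.
have mk (k : 'I_n.+1) : measurable_fun setT (fun w =>
    rg (x_ w) k && (fr (shift k (x_ w)) (n - k) && Q (W (shift k (x_ w)) (n - k)))).
  apply: measurable_and => //; apply: measurable_and.
    apply: (@measurable_fresh _ _ _ _ _ _ _ (mllr l) (fun j w => X (k + j)%N l w)).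
    by move=> j _; exact: (measurable_funPT (X (k + j)%N l)).
  apply: measurableT_comp => //.
  apply: (@measurable_decusum _ _ _ _ _ _ _ (mllr l) (fun j w => X (k + j)%N l w)).
  by move=> j _; exact: (measurable_funPT (X (k + j)%N l)).
rewrite ge0_integral_sum//; last first.
  by move=> k; exact: measurable_bool_EFin (mk k).
rewrite /convolution -sumEFin; apply: eq_bigr => k _.
rewrite -probability_bool; last exact: mk.
rewrite (_ : [set w | _] = [set w | rg (x_ w) k] `&`
    [set w | [set x | fr x (n - k) && Q (W x (n - k))] (shift k (obs X l w))]); last first.
  by apply/seteqP; split => w /= => [/andP[]//|[rk fQ]]; apply/andP.
rewrite (shifted_path_law indepX statX)//.
rewrite EFinM /u /cycle_prob !fineK//.
- by apply: fin_num_measure; apply: measurable_bool_set; exact: mfQ.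
- by apply: fin_num_measure; apply: measurable_bool_set; exact: mrg.
Qed.

Lemma cycle_prob_ge0 j : 0 <= cycle_prob j. Proof. exact: fine_ge0. Qed.

Lemma cycle_prob_series (r : R) :
  (\int[P]_w \sum_(0 <= j <oo) ((fr (x_ w) j && Q (W (x_ w) j))%:R : R)%:E = r%:E)%E ->
  series cycle_prob @ \oo --> r.
Proof.
move=> rE; apply: (@cvg_series_fine _ (fun j => P [set w | fr (x_ w) j && Q (W (x_ w) j)])).
- by [].
- by move=> j; apply: fin_num_measure; apply: measurable_bool_set; exact: mfQ.
- rewrite -rE integral_nneseries//; last first.
    by move=> j; apply: measurable_bool_EFin; exact: mfQ.
  by apply: eq_eseriesr => j _; rewrite probability_bool//; exact: mfQ.
Qed.

End predicate.

Let u01 k : 0 <= u k <= 1.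
Proof.
rewrite /u fine_ge0//= -lee_fin fineK; last first.
  by apply: fin_num_measure; apply: measurable_bool_set; exact: mrg.
by apply: probability_le1; apply: measurable_bool_set; exact: mrg.
Qed.

Let mladder : measurable_fun setT (fun w => ladder_time (f0 l) (f1 l) (x_ w)).
Proof.
under eq_fun do rewrite -ladder_time_series.
apply: (@ge0_emeasurable_sum _ _ _ setT (fun n w => ((lo (x_ w) n)%:R)%:E)) => // n _.
exact: measurable_bool_EFin.
Qed.

(** Cycle length minus ladder time, which avoids a partial sum at a random index. If the ladder time
    is infinite, [fine] sends both terms to 0, and the skip time is 0 by default. *)
Let mskip : measurable_fun setT
  (fun w => skip_time (f0 l) (f1 l) (mu l) (H l) (x_ w)).
Proof.
rewrite (_ : (fun w => _) = fun w =>
  fine (\sum_(0 <= n <oo) ((fr (x_ w) n)%:R : R)%:E)%E -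
  fine (ladder_time (f0 l) (f1 l) (x_ w))).
  apply: measurable_funB; last by apply: measurableT_comp => //.
  apply: measurableT_comp => //.
  apply: (@ge0_emeasurable_sum _ _ _ setT (fun n w => ((fr (x_ w) n)%:R)%:E)) => // n _.
  exact: measurable_bool_EFin.
apply/funext => w; rewrite fresh_series//.
have [[m [_ _ _ mE]]|[_ ooE]] :=
    @first_time_cases R (fun n => llr_sum (f0 l) (f1 l) (x_ w) n < 0).
  have {}mE : ladder_time (f0 l) (f1 l) (x_ w) = (m%:R : R)%:E := mE.
  by rewrite mE/= addrAC subrr add0r.
have {}ooE : ladder_time (f0 l) (f1 l) (x_ w) = +oo%E := ooE.
rewrite ooE addye//= subr0.
rewrite /skip_time /ladder_height ooE/= truncn0 /llr_sum big_geq//.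
by rewrite trunc_belowE max_l ?oppr_le0// normr0 mul0r ceil0.
Qed.

Let ladder_ge0 w : (0 <= ladder_time (f0 l) (f1 l) (x_ w))%E.
Proof. exact: first_time_ge0. Qed.

Let skip_ge0 w : 0 <= skip_time (f0 l) (f1 l) (mu l) (H l) (x_ w).
Proof. by rewrite skip_timeE. Qed.

Lemma mean_skip_time_fin : mean_skip_time f0 f1 X mu H PP l \is a fin_num.
Proof.
rewrite ge0_fin_numE; last by apply: integral_ge0 => w _; rewrite lee_fin.
apply: (@le_lt_trans _ _ (max_skip (mu l) (h l))%:E); last exact: ltry.
rewrite /mean_skip_time -(integral_cst_prob P); apply: ge0_le_integral => //.
- by move=> w _; rewrite lee_fin.
- exact/measurable_EFinP.
move=> w _; rewrite lee_fin /skip_time /max_skip ler_int le_ceil//.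
rewrite ler_pM2r ?invr_gt0// trunc_belowE ler_norml le_max lexx orbT/=.
by rewrite ge_max (le_trans (ladder_height_le0 _ _ _) h0) (le_trans _ h0)// oppr_le0.
Qed.

(* [P (tau > n) <= E (exp (Z_n / 2)) <= rho ^ n] *)
Let ladder_tail n : (P [set w | lo (x_ w) n] <= (rho ^+ n)%:E)%E.
Proof.
have mZ k : past_measurable X k (fun w => llr_sum (f0 l) (f1 l) (x_ w) k).
  apply: (@measurable_llr_sum _ _ (g_sigma_algebraType (past X k)) _ _ (mllr l)
    (fun i => X i l)).
  by move=> i; exact: past_measurable_obs.
have me k : past_measurable X k
    (fun w => expR (llr_sum (f0 l) (f1 l) (x_ w) k / 2)).
  by apply: measurableT_comp => //; apply: measurable_funM => //; exact: mZ.
have mZW k : measurable_fun setT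
    (fun w => expR (llr_sum (f0 l) (f1 l) (x_ w) k / 2)).
  by apply: (@past_measurableW _ _ _ _ X k); exact: me.
apply: (@le_trans _ _ (\int[P]_w (expR (llr_sum (f0 l) (f1 l) (x_ w) n / 2))%:E)%E).
  rewrite probability_bool//; apply: ge0_le_integral => //.
  - exact: measurable_bool_EFin.
  - exact/measurable_EFinP.
  - move=> w _; rewrite lee_fin; case: (boolP (lo _ _)) => [lon|_]; last exact: expR_ge0.
    rewrite -[leLHS]expR0 ler_expR divr_ge0//.
    by have [_ <- ] := ladder_open_fresh (mu l) h0 lon.
elim: n => [|n IH].
  under eq_integral do rewrite /llr_sum big_geq// mul0r expR0.
  by rewrite integral_cst_prob expr0.
under eq_integral do rewrite llr_sumS mulrDl expRD.
have mG : measurable_fun setT (fun y => expR (llr (f0 l) (f1 l) y / 2)).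
  by apply: measurableT_comp => //; exact: measurable_funM.
rewrite (past_ge0_integralM indepX l (@measurableT _ (g_sigma_algebraType _))
  (me n) (fun w => expR_ge0 _) mG (fun y => expR_ge0 _)).
rewrite exprSr EFinM; apply: lee_pmul.
- by apply: integral_ge0 => w _; rewrite lee_fin expR_ge0.
- by apply: integral_ge0 => w _; rewrite lee_fin expR_ge0.
- exact: IH.
- exact: affinity.
Qed.

Let mean_ladder_timeE : mean_ladder_time f0 f1 X PP l =
  (\sum_(0 <= n <oo) P [set w | lo (x_ w) n])%E.
Proof.
rewrite /mean_ladder_time; under eq_integral do rewrite -ladder_time_series.
rewrite integral_nneseries//; last first.
  by move=> n; apply: measurable_bool_EFin; exact: mlo.
by apply: eq_eseriesr => n _; rewrite probability_bool//; exact: mlo.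
Qed.

Lemma mean_ladder_time_fin : mean_ladder_time f0 f1 X PP l \is a fin_num.
Proof.
rewrite ge0_fin_numE; last exact: integral_ge0.
rewrite mean_ladder_timeE.
apply: (@le_lt_trans _ _ ((1 - rho)^-1)%:E); last exact: ltry.
apply: lime_le; first exact: is_cvg_nneseries.
apply: nearW => n; apply: (@le_trans _ _ (\sum_(0 <= k < n) (rho ^+ k)%:E)%E).
  by apply: lee_sum => k _; exact: ladder_tail.
have r1 : rho != 1 by rewrite lt_eqF.
rewrite sumEFin lee_fin.
have := congr1 (fun v : R^nat => v n) (@geometric_seriesE R 1 rho r1).
rewrite /series/= mul1r; under eq_bigr do rewrite mul1r.
move=> ->; rewrite ler_piMl ?invr_ge0 ?subr_ge0 ?(ltW rho1)//.
by rewrite gerBl exprn_ge0.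
Qed.

Let aT := fine (mean_ladder_time f0 f1 X PP l).
Let aS := fine (mean_skip_time f0 f1 X mu H PP l).

Let series_fresh : series (cycle_prob xpredT) @ \oo --> aT + aS.
Proof.
apply: cycle_prob_series; first exact: measurable_cst.
rewrite EFinD /aT /aS !fineK ?mean_ladder_time_fin ?mean_skip_time_fin//.
rewrite /mean_ladder_time /mean_skip_time -ge0_integralD//; last 2 first.
- by move=> w _; rewrite lee_fin.
- exact/measurable_EFinP.
apply: eq_integral => w _; rewrite -fresh_series//.
by apply: eq_eseriesr => n _; rewrite andbT.
Qed.

Let series_sampled : series (cycle_prob (fun y => 0 <= y)) @ \oo --> aT.
Proof.
apply: cycle_prob_series; first exact: measurable_fun_ler.
rewrite /aT fineK ?mean_ladder_time_fin//; apply: eq_integral => w _.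
by rewrite -ladder_time_series; apply: eq_eseriesr => n _; rewrite fresh_sampled.
Qed.

Let ladder_transmissionsE w : (ladder_transmissions (f0 l) (f1 l) (D l) (x_ w) =
  \sum_(0 <= n <oo) ((fr (x_ w) n && (D l < W (x_ w) n))%R%:R : R)%:E)%E.
Proof.
(* The statistic is 0 at time 0, so it does not exceed [D l], and the series from 0 agrees with the
   one from 1 in the definition. *)
rewrite [RHS]nneseries_recl//.
rewrite /W /= ltNge D0/= add0e /ladder_transmissions eseries_mkcond.
apply: eq_eseriesr => n _; rewrite fresh_transmits//.
by rewrite -/(ladder_open (f0 l) (f1 l) (x_ w) n); case: (_ && _).
Qed.

Lemma mean_ladder_transmissions_fin :
  mean_ladder_transmissions f0 f1 X D PP l \is a fin_num.
Proof.
have mt : measurable_fun setT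
    (fun w => ladder_transmissions (f0 l) (f1 l) (D l) (x_ w)).
  under eq_fun do rewrite ladder_transmissionsE.
  apply: (@ge0_emeasurable_sum _ _ _ setT
    (fun n w => ((fr (x_ w) n && (D l < W (x_ w) n))%R%:R)%:E)) => // n _.
  apply: measurable_bool_EFin; apply: measurable_and => //.
  exact: measurable_fun_ltr.
rewrite ge0_fin_numE; last first.
  by apply: integral_ge0 => w _; rewrite ladder_transmissionsE nneseries_ge0.
apply: le_lt_trans (_ : (mean_ladder_time f0 f1 X PP l < +oo)%E); last first.
  by rewrite ltey_eq mean_ladder_time_fin.
apply: ge0_le_integral => //.
  by move=> w _; rewrite ladder_transmissionsE nneseries_ge0.
move=> w _; rewrite ladder_transmissionsE -ladder_time_series.
apply: lee_nneseries => // n _.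
by rewrite lee_fin ler_nat fresh_transmits// /lo; case: ladder_open; case: ltP.
Qed.

Let aU := fine (mean_ladder_transmissions f0 f1 X D PP l).

Let series_transmits : series (cycle_prob (fun y => D l < y)) @ \oo --> aU.
Proof.
apply: cycle_prob_series; first exact: measurable_fun_ltr.
rewrite /aU fineK ?mean_ladder_transmissions_fin//; apply: eq_integral => w _.
by rewrite -ladder_transmissionsE.
Qed.

Let cycle_eq1 n : convolution u (cycle_prob xpredT) n = 1.
Proof.
rewrite -decusum_convolution; last exact: measurable_cst.
have -> : [set w : Omega | true] = setT by apply/seteqP; split.
by rewrite (probability_setT P).
Qed.

Let mean_frequency (Q : R -> bool) (a : R) : measurable_fun setT Q ->
  series (cycle_prob Q) @ \oo --> a ->
  (fun n => n.+1%:R^-1 * \sum_(m < n.+1)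
     fine (P [set w | Q (W (x_ w) m)])) @ \oo --> a / (aT + aS).
Proof.
move=> mQ sQ.
under eq_fun do under eq_bigr do rewrite decusum_convolution//.
apply: (@renewal_reward _ u _ (cycle_prob xpredT)) => //.
- by move=> k; exact: cycle_prob_ge0.
- by move=> k; exact: cycle_prob_ge0.
Qed.

Let aTSE : (mean_ladder_time f0 f1 X PP l + mean_skip_time f0 f1 X mu H PP l =
  (aT + aS)%:E)%E.
Proof. by rewrite EFinD /aT /aS !fineK ?mean_ladder_time_fin ?mean_skip_time_fin. Qed.

Let aTS_gt0 : 0 < aT + aS.
Proof.
have nd : nondecreasing_seq (series (cycle_prob xpredT)).
  apply/nondecreasing_seqP => n.
  by rewrite /series/= big_nat_recr//= lerDl cycle_prob_ge0.
apply: (@lt_le_trans _ _ 1) => //.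
rewrite -(cvg_lim (@Rhausdorff R) series_fresh).
apply: le_trans (nondecreasing_cvgn_le nd _ 1%N); last first.
  by apply/cvg_ex; exists (aT + aS).
rewrite /series/= big_nat1 /cycle_prob.
have -> : [set w | fresh (f0 l) (f1 l) (mu l) (h l) (obs X l w) 0 && true] = setT.
  by apply/seteqP; split.
by rewrite (probability_setT P).
Qed.

Let ratioE (a : R) (x : \bar R) : x = a%:E -> ((a / (aT + aS))%:E =
  x / (mean_ladder_time f0 f1 X PP l + mean_skip_time f0 f1 X mu H PP l))%E.
Proof. by move=> ->; rewrite aTSE inver gt_eqF. Qed.

Lemma PDC_eq : PDC f0 f1 X mu H PP l = (mean_ladder_time f0 f1 X PP l /
  (mean_ladder_time f0 f1 X PP l + mean_skip_time f0 f1 X mu H PP l))%E.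
Proof.
have mS k : measurable_fun setT (fun w => 0 <= W (x_ w) k).
  by apply: measurable_fun_ler => //; exact: mW.
rewrite -(@ratioE aT); last by rewrite fineK// mean_ladder_time_fin.
rewrite /PDC -[RHS](@limn_esup_EFin R (fun g : nat => g%:R^-1 *
    \sum_(1 <= k < g) fine (P [set w | 0 <= W (x_ w) k.-1]))).
  congr limn_esup; apply/funext => g /=.
  by rewrite (integral_sum_bool P _ _ (fun k => mS k.-1)).
(* Sample [k] is decided by the statistic at [k.-1], so for [g = n + 2] the sum covers the [n + 1]
   times from 0 to [n]; the factor [1 - harmonic n.+1] is [(n + 1) / (n + 2)]. *)
rewrite -(cvg_shiftn 2).
have lim1 : (fun n => 1 - harmonic n.+1 : R) @ \oo --> (1 : R).
  rewrite -[X in _ --> X]subr0; apply: cvgB; first exact: cvg_cst.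
  by rewrite (cvg_shiftS (@harmonic R)); exact: cvg_harmonic.
have mQ : measurable_fun setT (fun y : R => 0 <= y) by exact: measurable_fun_ler.
have C : ((fun n => 1 - harmonic n.+1 : R) \* (fun n => n.+1%:R^-1 *
    \sum_(m < n.+1) fine (P [set w | 0 <= W (x_ w) m]))) @ \oo -->
    1 * (aT / (aT + aS)).
  by apply: cvgM => //; exact: mean_frequency series_sampled.
rewrite mul1r in C; suff E : (fun n => (n + 2)%:R^-1 *
    \sum_(1 <= k < n + 2) fine (P [set w | 0 <= W (x_ w) k.-1])) =
   ((fun n => 1 - harmonic n.+1 : R) \* (fun n => n.+1%:R^-1 *
    \sum_(m < n.+1) fine (P [set w | 0 <= W (x_ w) m]))) by rewrite E.
apply/funext => n /=; rewrite addn2 big_add1/= big_mkord mulrA; congr (_ * _).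
rewrite /harmonic/=.
have N1 := pnatr_eq0 R n.+1; have N0 := pnatr_eq0 R n.+2.
rewrite -[n.+2%:R]natr1 in N0 *.
by move: (n.+1%:R) N1 N0 => N /negbT N1 /negbT N0; field; rewrite N0 N1.
Qed.

Lemma PTC_eq : PTC f0 f1 X mu H D PP l = (mean_ladder_transmissions f0 f1 X D PP l /
  (mean_ladder_time f0 f1 X PP l + mean_skip_time f0 f1 X mu H PP l))%E.
Proof.
have mT k : measurable_fun setT (fun w => D l < W (x_ w) k).
  by apply: measurable_fun_ltr => //; exact: mW.
rewrite -(@ratioE aU); last by rewrite fineK// mean_ladder_transmissions_fin.
rewrite /PTC -[RHS](@limn_esup_EFin R (fun g : nat => g%:R^-1 *
    \sum_(1 <= k < g) fine (P [set w | D l < W (x_ w) k]))).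
  congr limn_esup; apply/funext => g /=.
  by rewrite (integral_sum_bool P _ _ mT).
rewrite -(cvg_shiftS)/=.
(* The term of time 0 vanishes because [D l >= 0], so it can be added. *)
have -> : (fun n => n.+1%:R^-1 *
      \sum_(1 <= k < n.+1) fine (P [set w | D l < W (x_ w) k])) =
    (fun n => n.+1%:R^-1 * \sum_(m < n.+1) fine (P [set w | D l < W (x_ w) m])).
  apply/funext => n; rewrite -[in RHS](big_mkord xpredT (fun m =>
    fine (P [set w | D l < W (x_ w) m]))) [in RHS]big_nat_recl//= big_add1/=.
  have -> : [set w | D l < W (x_ w) 0] = set0.
    by apply/seteqP; split => w //=; rewrite /W/= ltNge D0.
  by rewrite measure0 add0r.
by apply: mean_frequency series_transmits; exact: measurable_fun_ltr.
Qed.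

End duty_cycle.

(** * The sampling frequency without truncation *)

Section unlimited_undershoot.
Context {R : realType} {L : nat}.
Context {d : measure_display} {Omega : measurableType d}.
Variables (f0 f1 : 'I_L -> R -> R) (X : nat -> 'I_L -> {mfun Omega >-> R}).
Variables (mu : 'I_L -> R) (PP : option nat -> probability Omega R).
Local Notation P := (PP None).
Hypothesis mllr : forall l, measurable_fun setT (llr (f0 l) (f1 l)).
Hypothesis indepX :
  mutually_independent P (fun i : nat * 'I_L => X i.1.+1 i.2 : Omega -> R).
Variables (l : 'I_L) (K m2 : R).
Hypotheses (mu0 : 0 < mu l) (K0 : 0 < K).
Let Y n (w : Omega) : R := llr (f0 l) (f1 l) (X n.+1 l w).
Hypothesis intY : forall n, P.-integrable setT (EFin \o Y n).
Hypothesis meanY : forall n, (\int[P]_w (Y n w)%:E = (- K)%:E)%E.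
Hypothesis meanY2 : forall n, (\int[P]_w (`|Y n w| ^+ 2)%:E = m2%:E)%E.

Let H (l' : 'I_L) : \bar R := +oo%E.
Let W n w := stat f0 f1 X mu H n l w.
Let s n w : bool := 0 <= W n w.
Let p n : R := fine (P [set w | s n w]).

Let WS n w : W n.+1 w = if s n w then W n w + Y n w else Num.min (W n w + mu l) 0.
Proof.
have truncE y : trunc_below (R := R) +oo%E y = y by rewrite /trunc_below /Order.max ltNge leNye.
by rewrite /W /s /stat /H [LHS]/= truncE.
Qed.

(** Stopping the rise at 0 can only lower the statistic. *)
Let W_le n w : W n w <= \sum_(k < n) (mu l * (1 - (s k w)%:R) + (s k w)%:R * Y k w).
Proof.
elim: n => [|n IH]; first by rewrite big_ord0.
rewrite WS big_ord_recr/=; case: ifPn => sn.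
  by rewrite subrr mulr0 add0r mul1r lerD2r.
by rewrite subr0 mulr1 mul0r addr0 ge_min lerD2r IH.
Qed.

(** Below 0 the statistic only rises, and it gets there by a sample taken at a level [>= 0], so an
    undershoot is never deeper than a single increment; an increment below [- c] is at least
    [- Y ^ 2 / c]. *)
Let W_ge c n w : 0 < c -> - (c + \sum_(k < n) `|Y k w| ^+ 2 / c) <= W n w.
Proof.
move=> c0; have q0 k : 0 <= `|Y k w| ^+ 2 / c by rewrite divr_ge0 ?exprn_ge0// ltW.
elim: n => [|n IH]; first by rewrite big_ord0 addr0 oppr_le0 ltW.
have S0 : 0 <= \sum_(k < n) `|Y k w| ^+ 2 / c by exact: sumr_ge0.
rewrite WS big_ord_recr/=; case: ifPn => sn; last first.
  rewrite le_min; move: (q0 n) c0 mu0; move: IH S0; lra.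
suff : - (c + `|Y n w| ^+ 2 / c) <= Y n w.
  by move: sn (q0 n) S0 c0; rewrite /s; lra.
have [yc|cy] := leP (- c) (Y n w); first by move: yc (q0 n); lra.
have : `|Y n w| <= `|Y n w| ^+ 2 / c.
  rewrite ler_pdivlMr// expr2 ler_wpM2l//.
  by rewrite ltr0_norm; move: cy c0; lra.
rewrite ltr0_norm; move: cy c0; lra.
Qed.

Let ms n : measurable_fun setT (s n).
Proof.
apply: measurable_fun_ler => //.
apply: (@past_measurableW _ _ _ _ X n); exact: past_measurable_stat.
Qed.

Let past_s n : <<s past X n >> [set w | s n w].
Proof.
apply: past_setle; first exact: measurable_cst.
exact: past_measurable_stat.
Qed.

Let probs n : P [set w | s n w] = (p n)%:E.
Proof. by rewrite /p fineK// fin_num_measure//; exact: measurable_bool_set. Qed.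

(** The upper bound on [W] minus the lower one is [c] plus the sum of these terms, which is
    therefore nonnegative along every path. *)
Let G c k w : R :=
  mu l * (1 - (s k w)%:R) + (s k w)%:R * Y k w + `|Y k w| ^+ 2 / c.

Let mean_G c k : 0 < c -> P.-integrable setT (EFin \o G c k) /\
  (\int[P]_w (G c k w)%:E = (mu l * (1 - p k) - K * p k + m2 / c)%:E)%E.
Proof.
move=> c0.
have is1 : P.-integrable setT (fun w => ((s k w)%:R : R)%:E).
  apply: (@le_integrable _ _ _ P setT measurableT _ (cst 1%:E)) => //.
  - exact: measurable_bool_EFin.
  - by move=> w _ /=; rewrite lee_fin; case: (s k w); rewrite ?normr1 ?normr0.
  - exact: finite_measure_integrable_cst.
have i1 : P.-integrable setT (fun w => (mu l)%:E * (1 - ((s k w)%:R)%:E))%E.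
  apply: integrableZl => //; apply: integrableB => //.
  exact: finite_measure_integrable_cst.
have i2 : P.-integrable setT (fun w => ((s k w)%:R * Y k w)%:E).
  apply: (le_integrable measurableT _ _ (intY k)) => //.
    under eq_fun do rewrite EFinM.
    apply: emeasurable_funM; first exact: measurable_bool_EFin.
    exact: measurable_int (intY k).
  move=> w _ /=; rewrite lee_fin; case: (s k w); rewrite ?mul1r ?mul0r//.
  by rewrite normr0.
have iY2 : P.-integrable setT (fun w => (`|Y k w| ^+ 2)%:E).
  apply/integrableP; split.
    apply/measurable_EFinP; apply: measurable_funX; apply: measurableT_comp => //.
    by apply/measurable_EFinP; exact: measurable_int (intY k).
  rewrite (_ : \int[P]_x _ = m2%:E)%E ?ltry// -(meanY2 k).
  by apply: eq_integral => w _; rewrite /= ger0_norm// exprn_ge0.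
have i3 : P.-integrable setT (fun w => ((`|Y k w| ^+ 2)%:E * (c^-1)%:E)%E).
  exact: integrableZr.
split.
  rewrite (_ : EFin \o _ = fun w => ((mu l)%:E * (1 - ((s k w)%:R)%:E) +
      ((s k w)%:R * Y k w)%:E + (`|Y k w| ^+ 2)%:E * (c^-1)%:E)%E)//.
  by apply: integrableD => //; exact: integrableD.
transitivity (\int[P]_w ((mu l)%:E * (1 - ((s k w)%:R)%:E) +
      ((s k w)%:R * Y k w)%:E + (`|Y k w| ^+ 2)%:E * (c^-1)%:E))%E => //.
rewrite integralD//; last exact: integrableD.
rewrite integralD// integralZr// meanY2 integralZl//; last first.
  by apply: integrableB => //; exact: finite_measure_integrable_cst.
rewrite integralB//; last exact: finite_measure_integrable_cst.
rewrite integral_cst_prob -probability_bool// probs.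
(* Wald's identity, one step at a time: the decision [s k] belongs to the past up to [k], while
   [Y k] is a function of the observation at [k.+1]. *)
have -> : (\int[P]_w ((s k w)%:R * Y k w)%:E = (- (K * p k))%:E)%E.
  rewrite (_ : (fun w => _) = (EFin \o Y k) \_ [set w | s k w]); last first.
    apply/funext => w; rewrite patchE/=; case: ifPn => [|/negP] sk.
      by rewrite (set_mem sk) mul1r.
    have /negPf -> : ~~ s k w by apply/negP => skw; apply: sk; exact: mem_set.
    by rewrite mul0r.
  rewrite -integral_mkcond.
  have -> := past_integral (l := l) indepX (past_s (n := k)) (mllr l) (intY k).
  by rewrite probs meanY -EFinM mulrN mulrC.
by rewrite -EFinB -!EFinM -!EFinD.
Qed.

Let sum_p_le c n : 0 < c ->
  (mu l + K) * \sum_(k < n) p k <= n%:R * (mu l + m2 / c) + c.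
Proof.
move=> c0.
have : (0 <= \int[P]_w (c + \sum_(k < n) G c k w)%:E)%E.
  apply: integral_ge0 => w _; rewrite lee_fin.
  have := le_trans (W_ge n w c0) (W_le n w) => B.
  by rewrite /G big_split/=; move: B; lra.
under eq_integral do rewrite EFinD -sumEFin.
rewrite integralD//=; last 2 first.
- exact: finite_measure_integrable_cst.
- by apply: integrable_sum => // k _; exact: (mean_G k c0).1.
rewrite integral_cst_prob integral_sum//; last first.
  by move=> k; exact: (mean_G k c0).1.
have -> : (\sum_(k < n) \int[P]_w (G c k w)%:E =
    \sum_(k < n) (mu l * (1 - p k) - K * p k + m2 / c)%:E)%E.
  by apply: eq_bigr => k _; exact: (mean_G k c0).2.
rewrite sumEFin -EFinD lee_fin !big_split/= sumr_const card_ord sumrN -!mulr_sumr.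
rewrite big_split/= sumr_const card_ord sumrN -[(m2 / c) *+ n]mulr_natl -[1 *+ n]mulr_natl.
lra.
Qed.

Lemma PDC_infty_le : (PDC f0 f1 X mu H PP l <= (mu l / (mu l + K))%:E)%E.
Proof.
have muK : 0 < mu l + K by rewrite addr_gt0.
have m20 : 0 <= m2.
  by rewrite -lee_fin -(meanY2 0); apply: integral_ge0 => w _; rewrite lee_fin exprn_ge0.
apply/lee_addgt0Pr => e e0; rewrite -EFinD; apply: limf_esup_le.
(* Makes [m2 / c <= (mu l + K) * (e / 2)], the [+ 1] keeping [c] positive. The other [e / 2] pays
   for the boundary term [c], which is small against [g]. *)
pose c := 2 * (m2 + 1) / ((mu l + K) * e).
have c0 : 0 < c by rewrite divr_gt0// mulr_gt0// ltr_wpDl.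
near=> g.
have g0 : 0 < g%:R :> R by rewrite ltr0n; near: g; exists 1%N.
rewrite (@integral_sum_bool _ _ _ P (fun k w => s k.-1 w)) -?EFinM ?lee_fin//.
rewrite big_add1/= big_mkord ler_pdivrMl//.
have S := sum_p_le g.-1 c0.
have gc : c / (mu l + K) <= g%:R * (e / 2).
  rewrite -ler_pdivrMr ?divr_gt0//; near: g; exact: nbhs_infty_ger.
have m2c : m2 / c <= (mu l + K) * (e / 2).
  rewrite ler_pdivrMr//; have -> : (mu l + K) * (e / 2) * c = m2 + 1.
    by rewrite /c; field; rewrite ?gt_eqF.
  lra.
rewrite -(ler_pM2l muK); apply: (le_trans S).
have -> : (mu l + K) * (g%:R * (mu l / (mu l + K) + e)) =
   g%:R * mu l + (mu l + K) * (g%:R * e) by field; rewrite gt_eqF.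
rewrite ler_pdivrMr// in gc.
have g1 : g.-1%:R <= g%:R :> R by rewrite ler_nat leq_pred.
have : g.-1%:R * (mu l + m2 / c) <= g%:R * (mu l + (mu l + K) * (e / 2)).
  apply: ler_pM => //; last by rewrite lerD2l.
  by apply: addr_ge0; [exact: ltW mu0|exact: divr_ge0 m20 (ltW c0)].
lra.
Unshelve. all: end_near.
Qed.

End unlimited_undershoot.

(** * Asymptotics in [alpha], and assembly *)

(** For fixed [I] the constant [M] is negligible against [|ln alpha|], which leaves the ratio
    [K / I]; then [I] is taken close to [K]. *)
Lemma limf_esup_ratio_le1 {R : realType} (F : R -> \bar R) (N K : R) :
  1 <= N -> 0 < K ->
  (forall I, 0 < I < K -> exists M D : R, forall alpha : R, 0 < alpha <= 1 ->
    D <= ln (N / alpha) -> (F alpha <= (ln (N / alpha) / I + M)%:E)%E) ->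
  (limf_esup (fun alpha : R => F alpha / (`|ln alpha|%:E / K%:E)) 0^'+ <= 1)%E.
Proof.
move=> N1 K0 FI; apply/lee_addgt0Pr => e e0; rewrite -EFinD.
have N0 : 0 < N by rewrite (lt_le_trans _ N1).
(* The slope [K / I = 1 + e / 2] uses half of the excess [e]; the other half absorbs the constant
   [M'] once [- ln alpha] reaches [2 * K * M' / e]. *)
pose I := K / (1 + e / 2).
have e21 : 1 < 1 + e / 2 by rewrite ltrDl divr_gt0.
have e20 : 0 < 1 + e / 2 by rewrite (lt_trans _ e21).
have I0K : 0 < I < K.
  by rewrite divr_gt0//= ltr_pdivrMr// ltr_pMr.
have [M [D FIM]] := FI _ I0K.
pose M' := ln N / I + M; pose t0 := Num.max (Num.max 1 D) (2 * K * M' / e).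
apply: limf_esup_le; near=> alpha.
have a0 : 0 < alpha by near: alpha; exact: nbhs_right_gt.
have t0_le : t0 <= - ln alpha.
  rewrite lerNr -[leRHS]expRK ler_ln ?posrE ?expR_gt0//.
  by near: alpha; apply: nbhs_right_le; exact: expR_gt0.
have : Num.max (Num.max 1 D) (2 * K * M' / e) <= - ln alpha by [].
rewrite !ge_max => /andP[/andP[t1 tD] tM].
have t_gt0 : 0 < - ln alpha by rewrite (lt_le_trans _ t1).
have a1 : alpha <= 1.
  by rewrite -ler_ln ?posrE// ln1; move: t_gt0; lra.
have lnE : ln (N / alpha) = ln N - ln alpha by rewrite ln_div.
have lnN : 0 <= ln N by rewrite ln_ge0.
have Fa : (F alpha <= (ln (N / alpha) / I + M)%:E)%E.
  by apply: FIM; [rewrite a0|rewrite lnE; move: tD lnN; lra].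
rewrite ler0_norm; last by move: t_gt0; lra.
set t := - ln alpha in t1 tD tM t_gt0 lnE *.
rewrite inver (gt_eqF K0) -EFinM inver gt_eqF ?divr_gt0//.
apply: le_trans (lee_wpmul2r _ Fa) _.
  by rewrite lee_fin invr_ge0 divr_ge0// ltW.
rewrite -EFinM lee_fin lnE ler_pdivrMr ?divr_gt0//.
have -> : (ln N + t) / I + M = t / K * (1 + e / 2) + M'.
  by rewrite /M' /I; field; rewrite !gt_eqF//; move: e0; lra.
have : M' <= t / K * (e / 2).
  move: tM; rewrite ler_pdivrMr// => tM.
  have -> : t / K * (e / 2) = t * e / (2 * K) by field; rewrite gt_eqF.
  by rewrite ler_pdivlMr ?mulr_gt0//; move: tM; lra.
lra.
Unshelve. all: end_near.
Qed.

Section moments.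
Context {R : realType} {d : measure_display} {Omega : measurableType d}.
Variables (P : probability Omega R) (X : {mfun Omega >-> R}).
Variables (nu : {sigma_finite_measure set R -> \bar R}) (f g : R -> R).
Hypotheses (hf : is_density nu f) (hg : is_density nu g).
Hypothesis lawX : forall B : set R, measurable B ->
  P (X @^-1` B) = (\int[nu]_(y in B) (f y)%:E)%E.
Hypothesis moments : forall k, (1 <= k <= 3)%N ->
  (0 < abs_moment nu g f f k < +oo)%E.

Let moment1 : (abs_moment nu g f f 1 < +oo)%E.
Proof. by have /andP[] := @moments 1%N isT. Qed.

Let mY : measurable_fun setT (fun w => llr f g (X w)).
Proof.
have [mf f0 _] := hf; have [mg g0 _] := hg.
by apply: measurableT_comp => //; exact: measurable_llr.
Qed.

Lemma integrable_llr : P.-integrable setT (fun w => (llr f g (X w))%:E).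
Proof.
apply/integrableP; split; first exact/measurable_EFinP.
rewrite (_ : \int[P]_x _ = abs_moment nu g f f 1)%E//.
by rewrite -(mean_abs_llr hf lawX hg).
Qed.

Lemma mean_sqr_llr_fin :
  (\int[P]_w (`|llr f g (X w)| ^+ 2)%:E = (fine (abs_moment nu g f f 2))%:E)%E.
Proof.
rewrite (mean_abs_llr hf lawX hg)// fineK//.
by have /andP[m0 m1] := @moments 2%N isT; rewrite ge0_fin_numE// ltW.
Qed.

(** Stated as an integral against [nu], so that one [rho] serves every observation of density [f],
    under each of the change-point measures. *)
Lemma affinity_lt1 : exists2 rho : R, 0 <= rho < 1 &
  (\int[nu]_y ((expR (llr f g y / 2))%:E * (f y)%:E) = rho%:E)%E.
Proof.
have [mf f0 _] := hf; have [mg g0 _] := hg.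
have mG : measurable_fun setT (fun y => (expR (llr f g y / 2))%:E).
  apply/measurable_EFinP; apply: measurableT_comp => //.
  by apply: measurable_funM => //; exact: measurable_llr.
have G0 y : (0 <= (expR (llr f g y / 2))%:E)%E by rewrite lee_fin expR_ge0.
rewrite -(ge0_integral_law hf lawX mG G0).
have I0 : (0 <= \int[P]_w (expR (llr f g (X w) / 2))%:E)%E.
  by apply: integral_ge0.
have eY : (\int[P]_w (expR (llr f g (X w)))%:E <= 1)%E.
  exact: (@mean_expR_llr _ _ _ P X nu f hf lawX g hg moment1).
have I1 : (\int[P]_w (expR (llr f g (X w) / 2))%:E < 1)%E.
  apply: mean_expR_half_lt1 => //.
  have /andP[+ _] := @moments 1%N isT.
  rewrite -(mean_abs_llr hf lawX hg)//; congr (_ < _)%E.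
have fin : (\int[P]_w (expR (llr f g (X w) / 2))%:E)%E \is a fin_num.
  by rewrite ge0_fin_numE// (lt_le_trans I1)// leey.
exists (fine (\int[P]_w (expR (llr f g (X w) / 2))%:E)); last by rewrite fineK.
by rewrite fine_ge0//= -lte_fin fineK.
Qed.

End moments.

Theorem theoremV1 (R : realType) (L : nat) (hL : (1 <= L)%N)
  (nu : 'I_L -> {sigma_finite_measure set R -> \bar R})
  (f0 f1 : 'I_L -> R -> R)
  (hf0 : forall l, is_density (nu l) (f0 l))
  (hf1 : forall l, is_density (nu l) (f1 l))
  (d : measure_display) (Omega : measurableType d)
  (X : nat -> 'I_L -> {mfun Omega >-> R})
  (P : option nat -> probability Omega R)
  (lstar : 'I_L)
  (hP : forall gamma : option nat, gamma <> Some 0%N ->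
     change_model nu f0 f1 X [set lstar]%SET gamma (P gamma))
  (hKL10 : forall l, (0 < KL (nu l) (f1 l) (f0 l) < +oo)%E)
  (hKL01 : forall l, (0 < KL (nu l) (f0 l) (f1 l) < +oo)%E)
  (hmom0 : forall l (k : nat), (1 <= k <= 3)%N ->
     (0 < abs_moment (nu l) (f1 l) (f0 l) (f0 l) k < +oo)%E)
  (hmom1 : forall l (k : nat), (1 <= k <= 3)%N ->
     (0 < abs_moment (nu l) (f1 l) (f0 l) (f1 l) k < +oo)%E)
  (mu h D : 'I_L -> R)
  (hmu : forall l, 0 < mu l) (hh : forall l, 0 <= h l)
  (hD : forall l, 0 <= D l) :
  let H := fun l => (h l)%:E in
  let A := fun alpha : R => ln (L%:R / alpha) in
  [/\ forall alpha : R, 0 < alpha <= 1 ->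
        (FAR f0 f1 X mu H D (A alpha) P <= alpha%:E)%E,
      forall l, PDC f0 f1 X mu H P l =
        (mean_ladder_time f0 f1 X P l /
         (mean_ladder_time f0 f1 X P l + mean_skip_time f0 f1 X mu H P l))%E,
      forall l, PTC f0 f1 X mu H D P l =
        (mean_ladder_transmissions f0 f1 X D P l /
         (mean_ladder_time f0 f1 X P l + mean_skip_time f0 f1 X mu H P l))%E,
      (limf_esup
         (fun alpha : R => WADD f0 f1 X mu H D (A alpha) P /
            (`|ln alpha|%:E / KL (nu lstar) (f1 lstar) (f0 lstar)))
         0^'+ <= 1)%E
    & forall l, (PDC f0 f1 X mu (fun _ => +oo) P l <=
        (mu l)%:E / ((mu l)%:E + KL (nu l) (f0 l) (f1 l)))%E].
Proof.
move=> H A.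
have mllr l : measurable_fun setT (llr (f0 l) (f1 l)).
  have [m0 g0 _] := hf0 l; have [m1 g1 _] := hf1 l; exact: measurable_llr.
have model0 : change_model nu f0 f1 X [set lstar]%SET None (P None) by exact: hP.
have model1 g : (1 <= g)%N -> change_model nu f0 f1 X [set lstar]%SET (Some g) (P (Some g)).
  by move=> g1; apply: hP => -[g0]; rewrite g0 in g1.
have indepX : mutually_independent (P None)
    (fun i : nat * 'I_L => X i.1.+1 i.2 : Omega -> R).
  by have [] := model0.
have law0 n l (B : set R) : measurable B ->
    P None (X n.+1 l @^-1` B) = (\int[nu l]_(y in B) (f0 l y)%:E)%E.
  move=> mB; have [_ ->//] := model0.
  by rewrite andbF.
have mean_le1 n l :
    (\int[P None]_w (expR (llr (f0 l) (f1 l) (X n.+1 l w)))%:E <= 1)%E.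
  apply: (mean_expR_llr (hf0 l) (law0 n l) (hf1 l)).
  by have /andP[] := hmom0 l 1%N isT.
have aff0 l : exists2 rho : R, 0 <= rho < 1 & forall n,
    (\int[P None]_w (expR (llr (f0 l) (f1 l) (X n.+1 l w) / 2))%:E <= rho%:E)%E.
  have [rho rho01 affE] := affinity_lt1 (hf0 l) (hf1 l) (law0 0%N l) (hmom0 l).
  exists rho => // n; rewrite -affE.
  rewrite (ge0_integral_law (hf0 l) (law0 n l)
    (G := fun y => (expR (llr (f0 l) (f1 l) y / 2))%:E))//.
  by apply/measurable_EFinP; apply: measurableT_comp => //; exact: measurable_funM.
have statX l n (B : set R) : measurable B ->
    P None (X n.+1 l @^-1` B) = P None (X 1 l @^-1` B).
  by move=> mB; rewrite !law0.
have L1 : 1 <= L%:R :> R by rewrite ler1n.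
split.
- move=> alpha /andP[a0 a1].
  have La : 1 <= L%:R / alpha by rewrite ler_pdivlMr// mul1r (le_trans a1).
  apply: FAR_le => //; first exact: ln_ge0.
  by rewrite lnK// posrE (lt_le_trans _ La).
- move=> l; have [rho /andP[rho0 rho1] aff] := aff0 l.
  exact: PDC_eq (statX l) (hmu l) (hh l) rho0 rho1 aff.
- move=> l; have [rho /andP[rho0 rho1] aff] := aff0 l.
  exact: PTC_eq (statX l) (hmu l) (hh l) (hD l) rho0 rho1 aff.
- have [K0 Kfin] := andP (hKL10 lstar).
  have KE : (fine (KL (nu lstar) (f1 lstar) (f0 lstar)))%:E =
      KL (nu lstar) (f1 lstar) (f0 lstar) by rewrite fineK// ge0_fin_numE// ltW.
  (* After the change the samples have density [f1], so the two densities exchange roles and the log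
     likelihood ratio changes sign. *)
  have {}hmom1 k : (1 <= k <= 3)%N ->
      (0 < abs_moment (nu lstar) (f0 lstar) (f1 lstar) (f1 lstar) k < +oo)%E.
    move=> /(hmom1 lstar); rewrite /abs_moment.
    have [_ g0 _] := hf0 lstar; have [_ g1 _] := hf1 lstar.
    by under eq_integral do rewrite abse_log_ratio_swap//.
  have [_ pf0 _] := hf0 lstar; have [_ pf1 _] := hf1 lstar.
  have swap y : llr (f0 lstar) (f1 lstar) y = - llr (f1 lstar) (f0 lstar) y.
    by rewrite llr_swap.
  have law1 g n (B : set R) : (1 <= g <= n.+1)%N -> measurable B ->
      P (Some g) (X n.+1 lstar @^-1` B) =
      (\int[nu lstar]_(y in B) (f1 lstar y)%:E)%E.
    move=> /andP[g1 gn] mB; have [_ ->//] := model1 _ g1.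
    by rewrite finset.in_set1 eqxx/= gn.
  (* The value of [rho] depends on the densities only; change point 1 and its first observation just
     supply a sample of density [f1]. *)
  have [rho /andP[rho0 rho1] affE] := affinity_lt1 (hf1 lstar) (hf0 lstar)
    (fun B => @law1 1%N 0%N B isT) hmom1.
  set K := fine _ in KE; rewrite -KE; rewrite -KE lte_fin in K0.
  apply: (limf_esup_ratio_le1 (N := L%:R)) => // I /andP[I0 IK].
  pose m2 := fine (abs_moment (nu lstar) (f0 lstar) (f1 lstar) (f1 lstar) 2).
  have m20 : 0 <= m2 by apply: fine_ge0; have /andP[/ltW] := hmom1 2%N isT.
  have KI : 0 < K - I by rewrite subr_gt0.
  (* Gives [m2 / c <= K - I], so the increment capped at [c] keeps a mean of at least [I]; the
     summand [I] ensures [I <= c] and [0 < c]. *)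
  pose c := m2 / (K - I) + I.
  have Ic : I <= c by rewrite lerDr divr_ge0// ltW.
  have c0 : 0 < c by rewrite (lt_le_trans I0).
  (* Everything in [delay_bound] but [A / I], hence free of [alpha]. The threshold [D lstar] ensures
     that a silent sensor is below [A]. *)
  exists ((c + h lstar) / I + skip_weight (mu lstar) (h lstar) rho +
    max_skip (mu lstar) (h lstar)), (D lstar) => alpha _ DA.
  have -> : ln (L%:R / alpha) / I + ((c + h lstar) / I +
      skip_weight (mu lstar) (h lstar) rho + max_skip (mu lstar) (h lstar)) =
      delay_bound mu h (A alpha) lstar c I rho.
    by rewrite /delay_bound /A; field; rewrite gt_eqF.
  apply: WADD_le => //.
  + move=> g g1; by have [] := model1 _ g1.
  + move=> g n gn; have law1gn B := law1 g n B gn.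
    have intY := integrable_llr (hf1 lstar) (hf0 lstar) law1gn hmom1.
    apply: (@le_trans _ _ (c - K + m2 / c)%:E); last first.
      rewrite lee_fin -lerBrDl; suff : m2 / c <= K - I by lra.
      rewrite ler_pdivrMr// /c mulrDr mulrCA divff ?gt_eqF// mulr1 lerDl.
      by rewrite mulr_ge0// ltW.
    apply: mean_sub_min_le => //.
    * by apply: measurableT_comp => //.
    * rewrite (_ : EFin \o _ =
          fun w => (- (llr (f1 lstar) (f0 lstar) (X n.+1 lstar w))%:E)%E).
        exact: integrableN.
      by apply/funext => w; rewrite /= swap.
    * under eq_integral do rewrite swap EFinN.
      rewrite integralN/=; last exact: integrable_add_def.
      rewrite (mean_llr (hf1 lstar) law1gn (hf0 lstar)) ?KE ?oppeK//.
      by have /andP[] := hmom1 1%N isT.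
    * under eq_integral do rewrite swap normrN.
      exact: mean_sqr_llr_fin.
  + move=> g n gn; have law1gn B := law1 g n B gn.
    under eq_integral do rewrite swap opprK.
    rewrite -affE (ge0_integral_law (hf1 lstar) law1gn
      (G := fun y => (expR (llr (f1 lstar) (f0 lstar) y / 2))%:E))//.
    apply/measurable_EFinP; apply: measurableT_comp => //.
    apply: measurable_funM => //.
    by have [? ? _] := hf0 lstar; have [? ? _] := hf1 lstar; exact: measurable_llr.
- move=> l; have [K0 Kfin] := andP (hKL01 l).
  have KE : (fine (KL (nu l) (f0 l) (f1 l)))%:E = KL (nu l) (f0 l) (f1 l).
    by rewrite fineK// ge0_fin_numE// ltW.
  set K := fine _ in KE; rewrite -KE in K0 *; rewrite lte_fin in K0.
  rewrite -EFinD inver gt_eqF ?addr_gt0// -EFinM.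
  apply: (@PDC_infty_le _ _ _ _ f0 f1 X mu P mllr indepX l K
    (fine (abs_moment (nu l) (f1 l) (f0 l) (f0 l) 2))) => // n.
  + exact: integrable_llr (hf0 l) (hf1 l) (law0 n l) (hmom0 l).
  + rewrite (mean_llr (hf0 l) (law0 n l) (hf1 l)) ?EFinN ?KE//.
    by have /andP[] := hmom0 l 1%N isT.
  + exact: mean_sqr_llr_fin (hf0 l) (hf1 l) (law0 n l) (hmom0 l).
Qed.
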